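(* Assume (A1). Then $\mathcal{D}_0(y,x)$ is finite for all $y,x\in J$, $\mathcal{D}_0$ is continuous on $J^2$, and for all $y,x\in J$ there exists $\varphi_0\in C^1_*(J^2)$ with $\varphi_0\ge\mathcal{D}_0$ on $J^2$, $\varphi_0(y,x)=\mathcal{D}_0(y,x)$, and such that, writing $E=(\varphi_0-x\partial_x\varphi_0-y\partial_y\varphi_0)(y,x)$: - if $x\in J_i^*$: $E+H_i(\partial_x\varphi_0(y,x))=0$; - if $x=0$: $E+\max_{i\in I_N}H_i^-(\partial^i_x\varphi_0(y,0))=0$; - if $y\in J_j^*$: $E+H_j(-\partial_y\varphi_0(y,x))=0$; - if $y=0$: $E+\max_{j\in I_N}H_j^-(-\partial^j_y\varphi_0(0,x))=0$ when $N\ge2$, and $E+H_1(-\partial^1_y\varphi_0(0,x))=0$ when $N=1$. Moreover, for every $R>0$ there is $C_R>0$ such that, for all $x,y\in J$ with $d(y,x)\le R$, the function $\varphi_0$ associated with $(y,x)$ satisfies $|\partial_x\varphi_0(y,x)|+|\partial_y\varphi_0(y,x)|\le C_R$.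
   Context: Junction: fix an integer $N\ge1$ and $N$ distinct unit vectors $e_1,\dots,e_N\in\mathbb{R}^2$. Set $J_i=[0,\infty)e_i$, $J_i^*=J_i\setminus\{0\}$, $J=\bigcup_{i=1}^NJ_i$, $I_N=\{1,\dots,N\}$. Each $x\in J_i$ is written $x=x_ie_i$, $x_i\ge0$. $J$ carries the geodesic distance $d(x,y)=|x-y|$ if $x,y$ lie in a common branch, $d(x,y)=|x|+|y|$ otherwise. Functions on $J^2$: for $\varphi$ on $J\times J$ (variables $(y,x)$), $\varphi^{ji}$ is its restriction to $J_j\times J_i$ viewed as a function of $(y_j,x_i)\in[0,\infty)^2$; $C^1_*(J^2)$ is the set of continuous $\varphi$ with all $\varphi^{ji}\in C^1([0,\infty)^2)$. For $y\in J_j$, $x\in J_i$: $\partial_x^i\varphi(y,x)=\partial\varphi^{ji}/\partial x_i$, $\partial^j_y\varphi(y,x)=\partial\varphi^{ji}/\partial y_j$; $\partial_x\varphi(y,x)=\partial^i_x\varphi(y,x)$ if $x\in J_i^*$ and the vector $(\partial^i_x\varphi(y,0))_{i\in I_N}$ if $x=0$; similarly for $\partial_y$. Also $x\partial_x\varphi=x_i\partial^i_x\varphi$ for $x\in J_i$ and $y\partial_y\varphi=y_j\partial^j_y\varphi$ for $y\in J_j$ (both vanish at $0$). (A1): there is $\gamma>0$ with $L_i\in C^2(\mathbb{R})$, $L_i''\ge\gamma$ for each $i$; $H_i(p)=\sup_{q\in\mathbb{R}}(pq-L_i(q))$, $H_i^-(p)=\sup_{q\le0}(pq-L_i(q))$.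 Minimal action: $L_0(p)=\min_jL_j(p)$; $A(x)=\mathbb{R}e_i$ if $x\in J_i^*$, $A(0)=\bigcup_i[0,\infty)e_i$; for $P=pe_i\in A(x)$, $L(x,P)=L_i(p)$ if $x\in J_i^*$, $L(0,P)=L_0(p)$. $\mathcal{A}(0,y;1,x)$ is the set of $X\in W^{1,1}([0,1];\mathbb{R}^2)$ with $X(\tau)\in J$, $\dot X(\tau)\in A(X(\tau))$ a.e., $X(0)=y$, $X(1)=x$. The reduced minimal action is $\mathcal{D}_0(y,x)=\inf_{X\in\mathcal{A}(0,y;1,x)}\int_0^1L(X(\tau),\dot X(\tau))\,d\tau$. *)

(* Defs.v *)
From Stdlib Require Import Reals Lra List ClassicalEpsilon.
Open Scope R_scope.

Definition pt := (R * R)%type.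
Definition pt0 : pt := (0, 0).
Definition smul (s : R) (p : pt) : pt := (s * fst p, s * snd p).
Definition padd (p q : pt) : pt := (fst p + fst q, snd p + snd q).
Definition psub (p q : pt) : pt := (fst p - fst q, snd p - snd q).
Definition pnorm (p : pt) : R := sqrt (fst p * fst p + snd p * snd p).

Fixpoint fsum (n : nat) (f : nat -> R) : R :=
  match n with O => 0 | S m => fsum m f + f m end.
Fixpoint bigmax (n : nat) (f : nat -> R) : R :=
  match n with O => f O | S m => Rmax (bigmax m f) (f (S m)) end.
Fixpoint bigmin (n : nat) (f : nat -> R) : R :=
  match n with O => f O | S m => Rmin (bigmin m f) (f (S m)) end.

Definition is_glb (E : R -> Prop) (m : R) : Prop :=
  (forall z, E z -> m <= z) /\ (forall b, (forall z, E z -> b <= z) -> b <= m).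

Definition sup_R (E : R -> Prop) : R :=
  match excluded_middle_informative (exists m, is_lub E m) with
  | left h => proj1_sig (constructive_indefinite_description _ h)
  | right _ => 0
  end.

Definition inf_R (E : R -> Prop) : R :=
  match excluded_middle_informative (exists m, is_glb E m) with
  | left h => proj1_sig (constructive_indefinite_description _ h)
  | right _ => 0
  end.

Definition Ham (Li : R -> R) (p : R) : R :=
  sup_R (fun z => exists q, z = p * q - Li q).
Definition Hamm (Li : R -> R) (p : R) : R :=
  sup_R (fun z => exists q, q <= 0 /\ z = p * q - Li q).

Definition AssumA1 (N : nat) (L : nat -> R -> R) : Prop :=
  exists gamma, 0 < gamma /\
  exists L1 L2 : nat -> R -> R,
    forall i, (i < N)%nat ->
      (forall q, derivable_pt_lim (L i) q (L1 i q)) /\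
      (forall q, derivable_pt_lim (L1 i) q (L2 i q)) /\
      continuity (L2 i) /\
      (forall q, gamma <= L2 i q).

Definition onbranch (e : nat -> pt) (i : nat) (x : pt) : Prop :=
  exists s, 0 <= s /\ x = smul s (e i).
Definition inJ (N : nat) (e : nat -> pt) (x : pt) : Prop :=
  exists i, (i < N)%nat /\ onbranch e i x.

Definition dJ (N : nat) (e : nat -> pt) (x y : pt) : R :=
  match excluded_middle_informative
          (exists i, (i < N)%nat /\ onbranch e i x /\ onbranch e i y) with
  | left _ => pnorm (psub x y)
  | right _ => pnorm x + pnorm y
  end.

Definition contJ2 (N : nat) (e : nat -> pt) (f : pt -> pt -> R) : Prop :=
  forall y x, inJ N e y -> inJ N e x ->
  forall eps, 0 < eps -> exists eta, 0 < eta /\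
    forall y' x', inJ N e y' -> inJ N e x' ->
      dJ N e y y' + dJ N e x x' < eta -> Rabs (f y' x' - f y x) < eps.

Definition C1Q (f f1 f2 : R -> R -> R) : Prop :=
  (forall a b, 0 <= a -> 0 <= b ->
     forall eps, 0 < eps -> exists eta, 0 < eta /\
       forall h k, 0 <= a + h -> 0 <= b + k -> Rabs h + Rabs k < eta ->
         Rabs (f (a + h) (b + k) - f a b - f1 a b * h - f2 a b * k)
           <= eps * (Rabs h + Rabs k)) /\
  (forall a b, 0 <= a -> 0 <= b ->
     forall eps, 0 < eps -> exists eta, 0 < eta /\
       forall a' b', 0 <= a' -> 0 <= b' -> Rabs (a' - a) + Rabs (b' - b) < eta ->
         Rabs (f1 a' b' - f1 a b) < eps /\ Rabs (f2 a' b' - f2 a b) < eps).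

(** C^1_*(J^2): phi continuous on J^2 and every phi^{ji}(y_j,x_i) in C^1([0,oo)^2);
    dy j i = d phi^{ji}/d y_j,  dx j i = d phi^{ji}/d x_i. *)
Definition C1star (N : nat) (e : nat -> pt) (phi : pt -> pt -> R)
    (dx dy : nat -> nat -> R -> R -> R) : Prop :=
  contJ2 N e phi /\
  forall j i, (j < N)%nat -> (i < N)%nat ->
    C1Q (fun s t => phi (smul s (e j)) (smul t (e i))) (dy j i) (dx j i).

Definition L0 (N : nat) (L : nat -> R -> R) (p : R) : R := bigmin (N - 1) (fun j => L j p).

(** LagRel x P l : P in A(x) and l = L(x,P). *)
Definition LagRel (N : nat) (e : nat -> pt) (L : nat -> R -> R) (x P : pt) (l : R) : Prop :=
  (x = pt0 /\ exists i p, (i < N)%nat /\ 0 <= p /\ P = smul p (e i) /\ l = L0 N L p) \/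
  (exists i s p, (i < N)%nat /\ 0 < s /\ x = smul s (e i) /\ P = smul p (e i) /\ l = L i p).

(** Henstock-Kurzweil (gauge) integral on [a,b].
    A tagged division is a list of ((u,w),t) with consecutive intervals [u,w], u<=t<=w. *)
Fixpoint tdiv (a b : R) (l : list ((R * R) * R)) : Prop :=
  match l with
  | nil => a = b
  | ((u, w), t) :: r => u = a /\ u < w /\ u <= t /\ t <= w /\ tdiv w b r
  end.
Definition fine (delta : R -> R) (l : list ((R * R) * R)) : Prop :=
  forall u w t, In ((u, w), t) l -> t - u < delta t /\ w - t < delta t.
Fixpoint rsum (f : R -> R) (l : list ((R * R) * R)) : R :=
  match l with
  | nil => 0
  | ((u, w), t) :: r => f t * (w - u) + rsum f r
  end.
Definition HKint (f : R -> R) (a b I : R) : Prop :=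
  forall eps, 0 < eps -> exists delta : R -> R,
    (forall t, a <= t <= b -> 0 < delta t) /\
    forall l, tdiv a b l -> fine delta l -> Rabs (rsum f l - I) < eps.
Definition HKintegrable (f : R -> R) (a b : R) : Prop := exists I, HKint f a b I.
(** Lebesgue integrability on [a,b] = f and |f| HK-integrable *)
Definition Lint (f : R -> R) (a b : R) : Prop :=
  HKintegrable f a b /\ HKintegrable (fun t => Rabs (f t)) a b.

Definition null (E : R -> Prop) : Prop :=
  forall eps, 0 < eps -> exists a b : nat -> R,
    (forall n, a n <= b n) /\
    (forall z, E z -> exists n, a n < z < b n) /\
    (forall n, fsum n (fun k => b k - a k) < eps).
Definition ae01 (P : R -> Prop) : Prop := null (fun t => 0 <= t <= 1 /\ ~ P t).

(** X in W^{1,1}([0,1];R^2) with weak derivative v: v in L^1 and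
    X(tau) = X(0) + int_0^tau v for tau in [0,1]. *)
Definition W11 (X v : R -> pt) : Prop :=
  Lint (fun t => fst (v t)) 0 1 /\ Lint (fun t => snd (v t)) 0 1 /\
  forall tau, 0 <= tau <= 1 ->
    HKint (fun t => fst (v t)) 0 tau (fst (X tau) - fst (X 0)) /\
    HKint (fun t => snd (v t)) 0 tau (snd (X tau) - snd (X 0)).

(** Set of (finite) values of int_0^1 L(X,Xdot) over admissible X in A(0,y;1,x). *)
Definition actions (N : nat) (e : nat -> pt) (L : nat -> R -> R) (y x : pt) (I : R) : Prop :=
  exists (X v : R -> pt) (ell : R -> R),
    W11 X v /\ X 0 = y /\ X 1 = x /\
    (forall tau, 0 <= tau <= 1 -> inJ N e (X tau)) /\
    ae01 (fun tau => LagRel N e L (X tau) (v tau) (ell tau)) /\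
    HKint ell 0 1 I.

Definition D0 (N : nat) (e : nat -> pt) (L : nat -> R -> R) (y x : pt) : R :=
  inf_R (actions N e L y x).

(** norm of the x-gradient at x = t e_i: |f i| if t>0, the euclidean norm of
    the vector (f k)_{k<N} if t = 0. *)
Definition gradnorm (N : nat) (t : R) (f : nat -> R) (i : nat) : R :=
  match Rlt_dec 0 t with
  | left _ => Rabs (f i)
  | right _ => sqrt (fsum N (fun k => f k * f k))
  end.

(* Main.v *)
Require Import Defs.
From Stdlib Require Import Reals.
From Stdlib Require Import ZArith Lra Lia List Classical ClassicalEpsilon Psatz FunctionalExtensionality.
Open Scope R_scope.

(** Call "energy" of the velocity q on branch i the number [q L_i'(q) - L_i(q)].  Among the
    paths from y (distance s, branch j) to x (distance r, branch i) that visit the vertex, an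
    optimal one runs straight to the vertex, waits, and runs straight to x, with the same
    energy k on both moving pieces; if it waits, then k is the lowest level [- L_0(0)].  Its
    cost [Gam j i s r] is the maximum over [k >= - L_0(0)] of
    [s * slin j k + r * slout i k - k], where the slopes are those of the tangents at energy
    k.  Being a supremum of affine functions with a continuous maximizer, [Gam] is C^1 up to
    the boundary, and D_0 is [Gam] if [j <> i] and [min (L_i (r - s), Gam)] if [j = i].

    Hence [Gam] itself is a test function at every point that is reached best through the
    vertex.  At the other points, with y and x on the branch j, one adds to [Gam] the
    difference [L_j (r - s) - Gam] on J_j x J_j, and its edge values, which are nonnegative, on the
    products where only one of the branches is J_j.

    In the lower bound for D_0 the difficulty is the cost between two passages through the
    vertex, where [L_0] may be below [L_0(0)]: one shows that the time spent at the vertex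
    contributes as if the velocity were zero there, by comparing the length of the path
    with the variation carried by its excursions. *)

(** * The gauge integral *)

(** The conditions at the vertex decide which test function to take. At y = 0 the incoming tangents
    have nonpositive velocities, so each H_j^- sees the full energy k and the maximum is k at every
    level. At x = 0 the outgoing tangents have nonnegative velocities, each H_i^- saturates at -
    L_i(0), and the maximum is - L_0(0) whatever k is: [Gam] then solves the condition only at the
    bottom level. If the level is higher and x = 0, there is no waiting, s equals the incoming speed
    and [Gam] equals L_j(- s), so the straight path is equally cheap. Ties are therefore resolved in
    favour of the straight path.

    The lower bound avoids differentiation almost everywhere. Besides the continuity of primitives
    it rests on two facts: the primitive of a function that is nonnegative off a null set is
    nondecreasing, and the chords of a fine division carry almost all of the integral of the
    absolute velocity. The second fact replaces the statement that the velocity vanishes at almost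
    every time spent at the vertex. *)

Fixpoint tsum (G : R -> R -> R -> R) (l : list ((R * R) * R)) : R :=
  match l with
  | nil => 0
  | ((u, w), t) :: r => G u w t + tsum G r
  end.

Lemma rsum_tsum f l : rsum f l = tsum (fun u w t => f t * (w - u)) l.
Proof. induction l as [|[[u w] t] l IH]; simpl; congruence. Qed.

Lemma tsum_app G l1 l2 : tsum G (l1 ++ l2) = tsum G l1 + tsum G l2.
Proof. induction l1 as [|[[u w] t] l IH]; simpl; lra. Qed.

Lemma tsum_plus G1 G2 l :
  tsum (fun u w t => G1 u w t + G2 u w t) l = tsum G1 l + tsum G2 l.
Proof. induction l as [|[[u w] t] l IH]; simpl; lra. Qed.

Lemma tsum_scal k G l : tsum (fun u w t => k * G u w t) l = k * tsum G l.
Proof. induction l as [|[[u w] t] l IH]; simpl; lra. Qed.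

Lemma tsum_abs G l : Rabs (tsum G l) <= tsum (fun u w t => Rabs (G u w t)) l.
Proof.
  induction l as [|[[u w] t] l IH]; simpl.
  - rewrite Rabs_R0; lra.
  - eapply Rle_trans; [apply Rabs_triang|]; lra.
Qed.

Lemma tdiv_le l : forall a b, tdiv a b l -> a <= b.
Proof.
  induction l as [|[[u w] t] l IH]; simpl; intros a b H; [lra|].
  destruct H as (-> & ? & ? & ? & H); apply IH in H; lra.
Qed.

Lemma tdiv_app l1 : forall l2 a b c, tdiv a b l1 -> tdiv b c l2 -> tdiv a c (l1 ++ l2).
Proof.
  induction l1 as [|[[u w] t] l IH]; simpl; intros l2 a b c H1 H2.
  - now rewrite H1.
  - destruct H1 as (-> & ? & ? & ? & H1); repeat split; auto. eapply IH; eauto.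
Qed.

Lemma fine_app d l1 l2 : fine d l1 -> fine d l2 -> fine d (l1 ++ l2).
Proof. intros H1 H2 u w t Hi; apply in_app_or in Hi as [Hi|Hi]; auto. Qed.

Lemma fine_cons d u w t l : t - u < d t -> w - t < d t -> fine d l -> fine d (((u, w), t) :: l).
Proof. intros H1 H2 H u' w' t' [Hi|Hi]; [inversion Hi; subst; auto|auto]. Qed.

Lemma fine_inv d u w t l : fine d (((u, w), t) :: l) -> t - u < d t /\ w - t < d t /\ fine d l.
Proof.
  intros H; destruct (H u w t) as [H1 H2]; [now left|]. repeat split; auto;
  destruct (H u0 w0 t0) as [H3 H4]; auto; now right.
Qed.

Lemma fine_min d1 d2 l : fine (fun t => Rmin (d1 t) (d2 t)) l -> fine d1 l /\ fine d2 l.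
Proof.
  intros H; split; intros u w t Hi; destruct (H u w t Hi) as [H1 H2];
  generalize (Rmin_l (d1 t) (d2 t)) (Rmin_r (d1 t) (d2 t)); lra.
Qed.

Lemma tsum_le_fine d G G' l : forall a b, tdiv a b l -> fine d l ->
  (forall u w t, a <= u -> u < w -> w <= b -> u <= t <= w -> t - u < d t -> w - t < d t ->
     G u w t <= G' u w t) ->
  tsum G l <= tsum G' l.
Proof.
  induction l as [|[[u w] t] l IH]; simpl; intros a b H Hf HG; [lra|].
  destruct H as (-> & ? & ? & ? & H); apply fine_inv in Hf as (? & ? & Hf).
  generalize (tdiv_le _ _ _ H); intros.
  assert (tsum G l <= tsum G' l).
  { apply (IH w b); auto. intros; apply HG; lra. }
  assert (G a w t <= G' a w t) by (apply HG; lra). lra.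
Qed.

Lemma tsum_le G G' l a b : tdiv a b l ->
  (forall u w t, a <= u -> u < w -> w <= b -> u <= t <= w -> G u w t <= G' u w t) ->
  tsum G l <= tsum G' l.
Proof.
  intros H HG. revert a H HG.
  induction l as [|[[u w] t] l IH]; simpl; intros a H HG; [lra|].
  destruct H as (-> & ? & ? & ? & H).
  generalize (tdiv_le _ _ _ H); intros.
  assert (tsum G l <= tsum G' l).
  { apply (IH w); auto. intros; apply HG; lra. }
  assert (G a w t <= G' a w t) by (apply HG; lra). lra.
Qed.

Lemma tsum_telescope F l : forall a b, tdiv a b l ->
  tsum (fun u w _ => F w - F u) l = F b - F a.
Proof.
  induction l as [|[[u w] t] l IH]; simpl; intros a b H; [subst; lra|].
  destruct H as (-> & ? & ? & ? & H). rewrite (IH _ _ H); lra.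
Qed.

(** The supremum [m] of the points reached by fine divisions is itself reached, and passed unless
    [m = b], by one more interval tagged at [m]. *)
Lemma cousin delta a b : a <= b -> (forall t, a <= t <= b -> 0 < delta t) ->
  exists l, tdiv a b l /\ fine delta l.
Proof.
  intros Hab Hd.
  set (S := fun x => a <= x <= b /\ exists l, tdiv a x l /\ fine delta l).
  assert (Sa : S a).
  { split; [lra|]. exists nil; simpl; split; auto. intros ? ? ? []. }
  destruct (completeness S) as [m [Hub Hlub]].
  { exists b; intros x [Hx _]; lra. }
  { now exists a. }
  assert (Ham : a <= m <= b).
  { split; [now apply Hub|]. apply Hlub; intros x [Hx _]; lra. }
  assert (Hdm := Hd m Ham).
  assert (Hx : exists x, S x /\ m - delta m < x).
  { apply NNPP; intros Hn. assert (m <= m - delta m); [|lra].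
    apply Hlub; intros x Hx. apply Rnot_lt_le; intros Hlt. apply Hn; now exists x. }
  destruct Hx as (x & (Hxab & l & Hl & Hf) & Hxm).
  assert (x <= m) by (apply Hub; split; eauto).
  assert (Hext : forall z, m <= z <= b -> x < z -> z - m < delta m -> S z).
  { intros z Hz Hxz Hzm; split; [lra|]. exists (l ++ ((x, z), m) :: nil); split.
    - eapply tdiv_app; eauto. simpl; repeat split; auto; lra.
    - apply fine_app; auto. apply fine_cons; try lra. intros ? ? ? []. }
  destruct (Req_dec m b) as [->|Hmb].
  - destruct (Req_dec x b) as [->|Hxb].
    + now exists l.
    + destruct (Hext b) as [_ ?]; auto; lra.
  - set (z := Rmin b (m + delta m / 2)).
    assert (Hz : S z).
    { unfold z, Rmin; destruct Rle_dec; apply Hext; lra. }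
    apply Hub in Hz. unfold z, Rmin in Hz; destruct Rle_dec; lra.
Qed.

(* M dominates the error of each tagged interval, so that the errors telescope. *)
Lemma HKint_control f F a b :
  (forall eps, 0 < eps -> exists (M delta : R -> R), M b - M a < eps /\
     (forall t, a <= t <= b -> 0 < delta t) /\
     forall u w t, a <= u -> u < w -> w <= b -> u <= t <= w ->
       t - u < delta t -> w - t < delta t ->
       Rabs (f t * (w - u) - (F w - F u)) <= M w - M u) ->
  HKint f a b (F b - F a).
Proof.
  intros H eps Heps. destruct (H eps Heps) as (M & delta & HM & Hd & Hc).
  exists delta; split; auto. intros l Hl Hf.
  rewrite rsum_tsum, <- (tsum_telescope F l _ _ Hl).
  replace (_ - _) with (tsum (fun u w t => f t * (w - u) + -1 * (F w - F u)) l)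
    by (rewrite tsum_plus, tsum_scal; lra).
  eapply Rle_lt_trans; [apply tsum_abs|].
  eapply Rle_lt_trans; [|exact HM].
  rewrite <- (tsum_telescope M l _ _ Hl).
  eapply tsum_le_fine; eauto. intros u w t ? ? ? ? ? ?; cbv beta.
  replace (_ + _) with (f t * (w - u) - (F w - F u)) by lra. auto.
Qed.

Lemma gauge_min (d1 d2 : R -> R) a b :
  (forall t, a <= t <= b -> 0 < d1 t) -> (forall t, a <= t <= b -> 0 < d2 t) ->
  forall t, a <= t <= b -> 0 < Rmin (d1 t) (d2 t).
Proof. intros H1 H2 t Ht; apply Rmin_glb_lt; auto. Qed.

Lemma HKint_point f a : HKint f a a 0.
Proof.
  replace 0 with (a - a) by lra.
  apply (HKint_control f (fun x => x)). intros eps Heps.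
  exists (fun _ => 0), (fun _ => 1); repeat split; intros; lra.
Qed.

Lemma HKint_const c a b : HKint (fun _ => c) a b (c * (b - a)).
Proof.
  replace (c * (b - a)) with (c * b - c * a) by lra.
  apply (HKint_control _ (fun x => c * x)). intros eps Heps.
  exists (fun _ => 0), (fun _ => 1); repeat split; intros; try lra.
  replace (_ - _) with 0 by lra. rewrite Rabs_R0; lra.
Qed.

Lemma HKint_plus f g a b I J :
  HKint f a b I -> HKint g a b J -> HKint (fun t => f t + g t) a b (I + J).
Proof.
  intros Hf Hg eps Heps.
  destruct (Hf (eps / 2)) as (d1 & Hd1 & H1); [lra|].
  destruct (Hg (eps / 2)) as (d2 & Hd2 & H2); [lra|].
  exists (fun t => Rmin (d1 t) (d2 t)); split; [now apply gauge_min|].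
  intros l Hl Hfi. apply fine_min in Hfi as [Hf1 Hf2].
  specialize (H1 l Hl Hf1); specialize (H2 l Hl Hf2).
  replace (rsum (fun t => f t + g t) l) with (rsum f l + rsum g l)
    by (clear; induction l as [|[[u w] t] l IH]; simpl; lra).
  replace (_ - _) with ((rsum f l - I) + (rsum g l - J)) by lra.
  eapply Rle_lt_trans; [apply Rabs_triang|]; lra.
Qed.

Lemma HKint_scal k f a b I : HKint f a b I -> HKint (fun t => k * f t) a b (k * I).
Proof.
  intros Hf eps Heps.
  assert (0 < Rabs k + 1) by (generalize (Rabs_pos k); lra).
  destruct (Hf (eps / (Rabs k + 1))) as (d & Hd & H1).
  { now apply Rdiv_lt_0_compat. }
  exists d; split; auto. intros l Hl Hfi. specialize (H1 l Hl Hfi).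
  replace (rsum (fun t => k * f t) l) with (k * rsum f l)
    by (clear; induction l as [|[[u w] t] l IH]; simpl; lra).
  rewrite <- Rmult_minus_distr_l, Rabs_mult.
  apply Rle_lt_trans with ((Rabs k) * (eps / (Rabs k + 1))).
  - apply Rmult_le_compat_l; [apply Rabs_pos|lra].
  - apply Rmult_lt_reg_r with (Rabs k + 1); [lra|].
    replace (_ * _ * _) with (Rabs k * eps) by (field; lra). nra.
Qed.

Lemma HKint_ext f g a b I : (forall t, a <= t <= b -> f t = g t) ->
  HKint f a b I -> HKint g a b I.
Proof.
  intros He Hf eps Heps. destruct (Hf eps Heps) as (d & Hd & H).
  exists d; split; auto. intros l Hl Hfi.
  replace (rsum g l) with (rsum f l); auto.
  assert (Hin : forall l a' , a <= a' -> tdiv a' b l -> rsum f l = rsum g l).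
  { clear - He. induction l as [|[[u w] t] l IH]; simpl; auto.
    intros a' Ha (-> & ? & ? & ? & H). generalize (tdiv_le _ _ _ H); intros.
    rewrite (IH w), He; auto; lra. }
  apply (Hin l a); auto; lra.
Qed.

Lemma HKint_le f g a b I J : a <= b -> (forall t, a <= t <= b -> f t <= g t) ->
  HKint f a b I -> HKint g a b J -> I <= J.
Proof.
  intros Hab Hle Hf Hg. apply Rnot_lt_le; intros Hlt.
  destruct (Hf ((I - J) / 2)) as (d1 & Hd1 & H1); [lra|].
  destruct (Hg ((I - J) / 2)) as (d2 & Hd2 & H2); [lra|].
  destruct (cousin (fun t => Rmin (d1 t) (d2 t)) a b Hab) as (l & Hl & Hfi);
    [now apply gauge_min|].
  apply fine_min in Hfi as [Hf1 Hf2].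
  specialize (H1 l Hl Hf1); specialize (H2 l Hl Hf2).
  apply Rabs_def2 in H1; apply Rabs_def2 in H2.
  assert (rsum f l <= rsum g l); [|lra].
  rewrite !rsum_tsum. eapply tsum_le; eauto. intros; cbv beta.
  apply Rmult_le_compat_r; [|apply Hle]; lra.
Qed.

Lemma HKint_unique f a b I J : a <= b -> HKint f a b I -> HKint f a b J -> I = J.
Proof. intros; apply Rle_antisym; eapply HKint_le; eauto; intros; lra. Qed.

(** One fine division of [a,b] with sum close to [I] is fixed and put in front of every fine
    division of [b,c]. *)
Lemma HKint_diff f a b c I J : a <= b -> b <= c ->
  HKint f a b I -> HKint f a c J -> HKint f b c (J - I).
Proof.
  intros Hab Hbc Hf Hg eps Heps.
  destruct (Hf (eps / 2)) as (d1 & Hd1 & H1); [lra|].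
  destruct (Hg (eps / 2)) as (d2 & Hd2 & H2); [lra|].
  destruct (cousin (fun t => Rmin (d1 t) (d2 t)) a b Hab) as (l & Hl & Hfi).
  { apply gauge_min; auto. intros; apply Hd2; lra. }
  apply fine_min in Hfi as [Hf1 Hf2].
  exists d2; split. { intros; apply Hd2; lra. }
  intros l' Hl' Hf'. specialize (H1 l Hl Hf1).
  specialize (H2 (l ++ l') (tdiv_app _ _ _ _ _ Hl Hl') (fine_app _ _ _ Hf2 Hf')).
  rewrite !rsum_tsum, tsum_app in *.
  replace (_ - _) with ((tsum (fun u w t => f t * (w - u)) l + tsum (fun u w t => f t * (w - u)) l' - J)
    + - (tsum (fun u w t => f t * (w - u)) l - I)) by lra.
  eapply Rle_lt_trans; [apply Rabs_triang|]. rewrite Rabs_Ropp; lra.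
Qed.

(** Two fine divisions of [a,b], completed by the same fine division of [b,c], have almost equal
    sums. This Cauchy criterion yields an integral on [a,b]. *)
Lemma HKintegrable_sub f a b c : a <= b -> b <= c -> HKintegrable f a c -> HKintegrable f a b.
Proof.
  intros Hab Hbc [J HJ].
  assert (Hc : forall eps, 0 < eps -> exists d : R -> R, (forall t, a <= t <= b -> 0 < d t) /\
    forall l l', tdiv a b l -> fine d l -> tdiv a b l' -> fine d l' ->
      Rabs (rsum f l - rsum f l') < eps).
  { intros eps Heps. destruct (HJ (eps / 2)) as (d & Hd & H); [lra|].
    destruct (cousin d b c Hbc) as (m & Hm & Hfm). { intros; apply Hd; lra. }
    exists d; split. { intros; apply Hd; lra. }
    intros l l' Hl Hf Hl' Hf'.
    assert (H1 := H (l ++ m) (tdiv_app _ _ _ _ _ Hl Hm) (fine_app _ _ _ Hf Hfm)).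
    assert (H2 := H (l' ++ m) (tdiv_app _ _ _ _ _ Hl' Hm) (fine_app _ _ _ Hf' Hfm)).
    rewrite rsum_tsum, tsum_app, <- !rsum_tsum in H1, H2.
    apply Rabs_def2 in H1; apply Rabs_def2 in H2. apply Rabs_def1; lra. }
  (* the supremum of E is the lower integral *)
  set (E := fun x => exists d : R -> R, (forall t, a <= t <= b -> 0 < d t) /\
    forall l, tdiv a b l -> fine d l -> x <= rsum f l).
  assert (HE1 : forall eps d l, 0 < eps -> (forall t, a <= t <= b -> 0 < d t) ->
    (forall l l', tdiv a b l -> fine d l -> tdiv a b l' -> fine d l' ->
      Rabs (rsum f l - rsum f l') < eps) -> tdiv a b l -> fine d l -> E (rsum f l - eps)).
  { intros eps d l Heps Hd H Hl Hf. exists d; split; auto. intros l' Hl' Hf'.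
    specialize (H l l' Hl Hf Hl' Hf'). apply Rabs_def2 in H; lra. }
  assert (HE2 : forall eps d l, 0 < eps -> (forall t, a <= t <= b -> 0 < d t) ->
    (forall l l', tdiv a b l -> fine d l -> tdiv a b l' -> fine d l' ->
      Rabs (rsum f l - rsum f l') < eps) -> tdiv a b l -> fine d l -> is_upper_bound E (rsum f l + eps)).
  { intros eps d l Heps Hd H Hl Hf x (d' & Hd' & Hx).
    destruct (cousin (fun t => Rmin (d t) (d' t)) a b Hab) as (m & Hm & Hfm);
      [now apply gauge_min|]. apply fine_min in Hfm as [Hf1 Hf2].
    specialize (H l m Hl Hf Hm Hf1). specialize (Hx m Hm Hf2). apply Rabs_def2 in H; lra. }
  destruct (Hc 1) as (d1 & Hd1 & H1); [lra|].
  destruct (cousin d1 a b Hab Hd1) as (l1 & Hl1 & Hf1).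
  destruct (completeness E) as [I [Hub Hlub]].
  { eexists; eapply HE2; eauto; lra. }
  { eexists; eapply HE1; eauto; lra. }
  exists I; intros eps Heps. destruct (Hc (eps / 2)) as (d & Hd & H); [lra|].
  exists d; split; auto. intros l Hl Hf.
  assert (rsum f l - eps / 2 <= I) by (apply Hub; eapply HE1; eauto; lra).
  assert (I <= rsum f l + eps / 2) by (apply Hlub; eapply HE2; eauto; lra).
  apply Rabs_def1; lra.
Qed.

(** Quantifying over all subintervals lets the pieces of a path be estimated with a single
    primitive, fixed only up to a constant. *)
Definition HKprim (f F : R -> R) : Prop :=
  forall a b, 0 <= a -> a <= b -> b <= 1 -> HKint f a b (F b - F a).

Lemma HKprim_of_origin f F :
  (forall t, 0 <= t <= 1 -> HKint f 0 t (F t - F 0)) -> HKprim f F.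
Proof.
  intros H a b Ha Hab Hb. replace (F b - F a) with ((F b - F 0) - (F a - F 0)) by lra.
  apply HKint_diff with 0; auto; apply H; lra.
Qed.

Lemma HKprim_exists f : HKintegrable f 0 1 -> exists F, HKprim f F.
Proof.
  intros Hf.
  exists (fun t => epsilon (inhabits 0) (fun I => HKint f 0 t I)).
  apply HKprim_of_origin. intros t Ht.
  assert (H0 : HKint f 0 0 (epsilon (inhabits 0) (fun I => HKint f 0 0 I))).
  { apply epsilon_spec. exists 0; apply HKint_point. }
  rewrite (HKint_unique f 0 0 _ 0 (Rle_refl 0) H0 (HKint_point f 0)), Rminus_0_r.
  apply epsilon_spec. apply (HKintegrable_sub f 0 t 1); auto; lra.
Qed.

Lemma HKprim_plus f g F G : HKprim f F -> HKprim g G ->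
  HKprim (fun t => f t + g t) (fun t => F t + G t).
Proof.
  intros Hf Hg a b Ha Hab Hb.
  replace (_ - _) with ((F b - F a) + (G b - G a)) by lra. now apply HKint_plus; auto.
Qed.

Lemma HKprim_scal k f F : HKprim f F -> HKprim (fun t => k * f t) (fun t => k * F t).
Proof.
  intros Hf a b Ha Hab Hb.
  replace (_ - _) with (k * (F b - F a)) by lra. now apply HKint_scal; auto.
Qed.

Lemma HKprim_const c : HKprim (fun _ => c) (fun t => c * t).
Proof.
  intros a b Ha Hab Hb. replace (_ - _) with (c * (b - a)) by lra. apply HKint_const.
Qed.

Lemma HKprim_le f g F G a b : HKprim f F -> HKprim g G -> 0 <= a -> a <= b -> b <= 1 ->
  (forall t, a <= t <= b -> f t <= g t) -> F b - F a <= G b - G a.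
Proof. intros HF HG Ha Hab Hb H; apply (HKint_le f g a b); auto. Qed.

(* Keep the intervals on which the error is positive and refine the others. *)
Lemma saks_henstock_pos f F (d : R -> R) : HKprim f F -> forall l a b eta,
  0 < eta -> 0 <= a -> b <= 1 -> (forall t, a <= t <= b -> 0 < d t) ->
  tdiv a b l -> fine d l ->
  exists l', tdiv a b l' /\ fine d l' /\
    tsum (fun u w t => Rmax 0 (f t * (w - u) - (F w - F u))) l - eta
      <= rsum f l' - (F b - F a).
Proof.
  intros HF. induction l as [|[[u w] t] l IH]; simpl; intros a b eta Heta Ha Hb Hd Hl Hf.
  - exists nil; simpl; split; [auto|split; [intros ? ? ? []|subst; lra]].
  - destruct Hl as (-> & ? & ? & ? & Hl). apply fine_inv in Hf as (? & ? & Hf).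
    generalize (tdiv_le _ _ _ Hl); intros Hwb.
    destruct (IH w b (eta / 2)) as (l1 & Hl1 & Hf1 & HS); auto; try lra.
    { intros; apply Hd; lra. }
    destruct (Rle_dec 0 (f t * (w - a) - (F w - F a))) as [Hp|Hp].
    + exists (((a, w), t) :: l1). split; [|split]; simpl.
      * repeat split; auto; lra.
      * now apply fine_cons.
      * rewrite Rmax_right; lra.
    + destruct (HF a w) with (eps := eta / 2) as (d' & Hd' & Hd2); try lra.
      destruct (cousin (fun t => Rmin (d t) (d' t)) a w) as (m & Hm & Hfm); try lra.
      { apply gauge_min; auto. intros; apply Hd; lra. }
      apply fine_min in Hfm as [Hfm1 Hfm2].
      exists (m ++ l1). split; [|split].
      * eapply tdiv_app; eauto.
      * now apply fine_app.
      * specialize (Hd2 m Hm Hfm2). apply Rabs_def2 in Hd2.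
        rewrite (rsum_tsum f (m ++ l1)), tsum_app, <- !rsum_tsum. rewrite Rmax_left; lra.
Qed.

(** Henstock's lemma: the errors are small in absolute value before summation. Since |x| = max(0,x)
    + max(0,-x), the one-sided version is applied to f and to -f. *)
Lemma saks_henstock f F a b eps : HKprim f F -> 0 <= a -> a <= b -> b <= 1 -> 0 < eps ->
  exists d : R -> R, (forall t, a <= t <= b -> 0 < d t) /\
    forall l, tdiv a b l -> fine d l ->
      tsum (fun u w t => Rabs (f t * (w - u) - (F w - F u))) l <= eps.
Proof.
  intros HF Ha Hab Hb Heps.
  assert (HF' := HKprim_scal (-1) _ _ HF).
  destruct (HF a b Ha Hab Hb (eps / 4)) as (d & Hd & H); [lra|].
  exists d; split; auto. intros l Hl Hf.
  destruct (saks_henstock_pos f F d HF l a b (eps / 4)) as (l1 & Hl1 & Hf1 & H1); auto; try lra.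
  destruct (saks_henstock_pos _ _ d HF' l a b (eps / 4)) as (l2 & Hl2 & Hf2 & H2); auto; try lra.
  assert (K1 := H l1 Hl1 Hf1). assert (K2 := H l2 Hl2 Hf2).
  replace (rsum (fun t => -1 * f t) l2) with (- rsum f l2) in H2
    by (clear; induction l2 as [|[[u w] t] l IH]; simpl; lra).
  apply Rabs_def2 in K1; apply Rabs_def2 in K2.
  apply Rle_trans with (tsum (fun u w t => Rmax 0 (f t * (w - u) - (F w - F u))) l
    + tsum (fun u w t => Rmax 0 (-1 * f t * (w - u) - (-1 * F w - -1 * F u))) l); [|lra].
  rewrite <- tsum_plus. eapply tsum_le; eauto. intros; cbv beta.
  unfold Rabs, Rmax; destruct Rcase_abs, Rle_dec, Rle_dec; lra.
Qed.

Lemma tsum_nonneg G l a b : tdiv a b l ->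
  (forall u w t, a <= u -> u < w -> w <= b -> u <= t <= w -> 0 <= G u w t) -> 0 <= tsum G l.
Proof.
  intros Hl H. replace 0 with (tsum (fun _ _ _ => 0) l).
  - eapply tsum_le; eauto.
  - clear; induction l as [|[[u w] t] l IH]; simpl; lra.
Qed.

(** An interval tagged at [t] is completed on both sides by fine divisions, so Henstock's lemma
    bounds its error alone; the term [f t * (w - u)] is small with the length. *)
Lemma HKprim_continuous f F t eps : HKprim f F -> 0 <= t <= 1 -> 0 < eps ->
  exists eta, 0 < eta /\ forall t', 0 <= t' <= 1 -> Rabs (t' - t) < eta ->
    Rabs (F t' - F t) < eps.
Proof.
  intros HF Ht Heps.
  destruct (saks_henstock f F 0 1 (eps / 2) HF) as (d & Hd & H); try lra.
  assert (Hdt := Hd t Ht). assert (Hp := Rabs_pos (f t)).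
  set (eta := Rmin (d t) (eps / 2 / (Rabs (f t) + 1))).
  assert (Hq : 0 < eps / 2 / (Rabs (f t) + 1)) by (apply Rdiv_lt_0_compat; lra).
  assert (Hterm : forall u w, 0 <= u -> u < w -> w <= 1 -> u <= t <= w -> w - u < eta ->
    Rabs (f t * (w - u) - (F w - F u)) <= eps / 2).
  { intros u w Hu Huw Hw Hut Hwu.
    assert (w - u < d t) by (unfold eta, Rmin in Hwu; destruct Rle_dec; lra).
    destruct (cousin d 0 u) as (l1 & Hl1 & Hf1); try lra. { intros; apply Hd; lra. }
    destruct (cousin d w 1) as (l2 & Hl2 & Hf2); try lra. { intros; apply Hd; lra. }
    assert (Hl : tdiv 0 1 (l1 ++ ((u, w), t) :: l2)).
    { eapply tdiv_app; eauto. simpl; repeat split; auto; lra. }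
    assert (K := H _ Hl). rewrite tsum_app in K; simpl in K.
    assert (Hg : forall a' b' l', tdiv a' b' l' ->
      0 <= tsum (fun u w t => Rabs (f t * (w - u) - (F w - F u))) l').
    { intros a' b' l' Hl'; eapply tsum_nonneg; eauto. intros; apply Rabs_pos. }
    assert (G1 := Hg _ _ _ Hl1). assert (G2 := Hg _ _ _ Hl2).
    assert (K' := K (fine_app _ _ _ Hf1 (fine_cons d u w t l2 ltac:(lra) ltac:(lra) Hf2))).
    lra. }
  assert (Hsmall : forall h, 0 <= h < eta -> Rabs (f t) * h < eps / 2).
  { intros h [Hh0 Hh].
    assert (h < eps / 2 / (Rabs (f t) + 1)) by (unfold eta, Rmin in Hh; destruct Rle_dec; lra).
    apply Rle_lt_trans with ((Rabs (f t) + 1) * h); [nra|].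
    apply Rmult_lt_reg_r with (/ (Rabs (f t) + 1)); [apply Rinv_0_lt_compat; lra|].
    replace (_ * _ * _) with h by (field; lra). exact H0. }
  exists eta; split; [apply Rmin_glb_lt; auto|].
  intros t' Ht' Hc.
  destruct (Rtotal_order t t') as [Hlt|[->|Hlt]].
  - rewrite Rabs_right in Hc by lra.
    assert (K := Hterm t t' ltac:(lra) Hlt ltac:(lra) ltac:(lra) Hc).
    assert (K2 := Hsmall (t' - t) ltac:(lra)).
    replace (F t' - F t) with (- (f t * (t' - t) - (F t' - F t)) + f t * (t' - t)) by lra.
    eapply Rle_lt_trans; [apply Rabs_triang|]. rewrite Rabs_Ropp, Rabs_mult.
    rewrite (Rabs_right (t' - t)) by lra. lra.
  - replace (F t' - F t') with 0 by lra. rewrite Rabs_R0; lra.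
  - rewrite Rabs_left in Hc by lra.
    assert (K := Hterm t' t ltac:(lra) Hlt ltac:(lra) ltac:(lra) ltac:(lra)).
    assert (K2 := Hsmall (t - t') ltac:(lra)).
    replace (F t' - F t) with ((f t * (t - t') - (F t - F t')) + - (f t * (t - t'))) by lra.
    eapply Rle_lt_trans; [apply Rabs_triang|]. rewrite Rabs_Ropp, (Rabs_mult (f t)).
    rewrite (Rabs_right (t - t')) by lra. lra.
Qed.

(** * Null sets and comparison almost everywhere *)

Lemma fsum_ge_term n f k : (forall i, 0 <= f i) -> (k < n)%nat -> f k <= fsum n f.
Proof.
  intros Hf. induction n as [|n IH]; simpl; intros Hk; [lia|].
  assert (Hs : forall m, 0 <= fsum m f).
  { induction m; simpl; [lra|]. specialize (Hf m); lra. }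
  destruct (Nat.eq_dec k n) as [->|]; [specialize (Hs n); lra|].
  assert (f k <= fsum n f) by (apply IH; lia). specialize (Hf n); lra.
Qed.

Lemma fsum_le n f g : (forall i, (i < n)%nat -> f i <= g i) -> fsum n f <= fsum n g.
Proof.
  induction n as [|n IH]; simpl; intros H; [lra|].
  assert (fsum n f <= fsum n g) by (apply IH; intros; apply H; lia).
  specialize (H n ltac:(lia)); lra.
Qed.

Lemma fsum_minus n f g : fsum n (fun i => f i - g i) = fsum n f - fsum n g.
Proof. induction n as [|n IH]; simpl; lra. Qed.

Lemma fsum_scal n k f : fsum n (fun i => k * f i) = k * fsum n f.
Proof. induction n as [|n IH]; simpl; lra. Qed.

(** For a <= b, the length of the part of [a,b] to the left of z: nondecreasing in z, with slope 1
    inside [a,b]. *)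
Definition clip (a b z : R) : R := Rmax 0 (Rmin z b - a).

Lemma clip_incr a b u w : u <= w -> clip a b u <= clip a b w.
Proof. unfold clip, Rmax, Rmin; repeat destruct Rle_dec; lra. Qed.

Lemma clip_bounds a b z : a <= b -> 0 <= clip a b z <= b - a.
Proof. unfold clip, Rmax, Rmin; repeat destruct Rle_dec; lra. Qed.

Lemma clip_inside a b u w : a <= u -> u <= w -> w <= b -> clip a b w - clip a b u = w - u.
Proof. unfold clip, Rmax, Rmin; repeat destruct Rle_dec; lra. Qed.

Lemma geom_fsum n : fsum n (fun k => (/ 2) ^ (S k)) <= 1.
Proof.
  assert (fsum n (fun k => (/ 2) ^ (S k)) = 1 - (/ 2) ^ n).
  { induction n as [|n IH]; simpl in *; [lra|]. rewrite IH; lra. }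
  assert (0 < (/ 2) ^ n) by (apply pow_lt; lra). lra.
Qed.

Lemma nat_above x : exists n, x <= INR n.
Proof.
  destruct (Rle_dec x 0) as [H|H]; [exists 0%nat; simpl; lra|].
  assert (H1 : 0 < x) by lra.
  exists (Z.to_nat (up x)). destruct (archimed x) as [Ha _].
  rewrite INR_IZR_INZ, Z2Nat.id; [lra|]. apply le_IZR; lra.
Qed.

(* Cover [{t in E | |g t| <= n}] by intervals of total length [eps / (2^(n+1) (n+1))]; the
   truncated sums of clip functions weighted by n are nondecreasing, at most eps, and
   have slope at least [|g t|] near the tags in E. *)
Lemma null_gauge E g a b eps : null E -> 0 < eps ->
  exists d : R -> R, (forall t, 0 < d t) /\ forall l, tdiv a b l -> fine d l ->
    exists M : R -> R, (forall u w, u <= w -> M u <= M w) /\ M b - M a <= eps /\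
      forall u w t, In ((u, w), t) l -> u < w -> E t -> Rabs (g t) * (w - u) <= M w - M u.
Proof.
  intros HE Heps.
  assert (Hcov : forall n, exists ab : (nat -> R) * (nat -> R),
    (forall k, fst ab k <= snd ab k) /\
    (forall z, E z -> exists k, fst ab k < z < snd ab k) /\
    (forall k, INR n * fsum k (fun i => snd ab i - fst ab i) <= eps * (/ 2) ^ (S n))).
  { intros n.
    assert (Hn := pos_INR n).
    assert (Hq : 0 < eps * (/ 2) ^ (S n)) by (apply Rmult_lt_0_compat; auto; apply pow_lt; lra).
    destruct (HE (eps * (/ 2) ^ (S n) / (INR n + 1))) as (p & q & H1 & H2 & H3).
    { apply Rdiv_lt_0_compat; lra. }
    exists (p, q); simpl fst; simpl snd; repeat split; auto. intros k. specialize (H3 k).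
    apply (Rmult_lt_compat_l (INR n + 1)) in H3; [|lra].
    replace ((INR n + 1) * (eps * (/ 2) ^ S n / (INR n + 1))) with (eps * (/ 2) ^ S n) in H3
      by (field; lra).
    assert (0 <= fsum k (fun i => q i - p i)); [|nra].
    clear - H1; induction k; simpl; [lra|]. specialize (H1 k); lra. }
  apply choice in Hcov as [C HC].
  (* For [t] in [E], [n] bounds |g t|, [k] is an interval of the n-th cover around [t], and [r] is a
     radius that stays inside it and serves as gauge. *)
  set (P := fun t (x : nat * nat * R) => let '(n, k, r) := x in
    0 < r /\ (E t -> Rabs (g t) <= INR n /\ fst (C n) k <= t - r /\ t + r <= snd (C n) k)).
  assert (HP : forall t, exists x, P t x).
  { intros t. destruct (classic (E t)) as [Ht|Ht].
    - destruct (nat_above (Rabs (g t))) as [n Hn].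
      destruct (HC n) as (_ & H2 & _). destruct (H2 t Ht) as [k Hk].
      exists (n, k, Rmin (t - fst (C n) k) (snd (C n) k - t)). unfold P.
      assert (K1 := Rmin_l (t - fst (C n) k) (snd (C n) k - t)).
      assert (K2 := Rmin_r (t - fst (C n) k) (snd (C n) k - t)).
      split; [apply Rmin_glb_lt; lra|]. intros _; repeat split; auto; lra.
    - exists (0%nat, 0%nat, 1). split; [lra|]. tauto. }
  apply choice in HP as [x Hx].
  exists (fun t => snd (x t)); split.
  { intros t. specialize (Hx t). destruct (x t) as [[n k] r]; simpl in *. tauto. }
  intros l Hl Hf.
  (* Only finitely many pairs (n, k) occur at the tags of [l], so [M] can be a finite sum. *)
  assert (HB : exists n0, forall u w t, In ((u, w), t) l ->
    (fst (fst (x t)) < n0)%nat /\ (snd (fst (x t)) < n0)%nat).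
  { clear. induction l as [|[[u w] t] l [n0 IH]]; [exists 0%nat; intros ? ? ? []|].
    exists (S (Nat.max n0 (Nat.max (fst (fst (x t))) (snd (fst (x t)))))).
    intros u' w' t' [Hi|Hi]; [inversion Hi; subst; lia|]. destruct (IH _ _ _ Hi); lia. }
  destruct HB as [n0 HB].
  set (m := fun n k z => INR n * clip (fst (C n) k) (snd (C n) k) z).
  assert (Hm : forall n k u w, u <= w -> 0 <= m n k w - m n k u).
  { intros n k u w Huw. unfold m. assert (K := clip_incr (fst (C n) k) (snd (C n) k) _ _ Huw).
    assert (Hn := pos_INR n). nra. }
  assert (Hdiff : forall u w,
    fsum n0 (fun n => fsum n0 (fun k => m n k w)) - fsum n0 (fun n => fsum n0 (fun k => m n k u))
    = fsum n0 (fun n => fsum n0 (fun k => m n k w - m n k u))).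
  { intros. rewrite <- fsum_minus. f_equal.
    apply functional_extensionality_dep; intros; now rewrite fsum_minus. }
  assert (Hpos : forall j u w, u <= w -> 0 <= fsum n0 (fun k => m j k w - m j k u)).
  { intros j u w Huw. replace 0 with (fsum n0 (fun _ => 0)).
    - apply fsum_le; intros; now apply Hm.
    - clear; induction n0; simpl; lra. }
  exists (fun z => fsum n0 (fun n => fsum n0 (fun k => m n k z))); repeat split.
  - intros u w Huw. assert (K := Hdiff u w).
    apply Rminus_le. apply Ropp_le_cancel. rewrite Ropp_0, Ropp_minus_distr, K.
    replace 0 with (fsum n0 (fun _ => 0)).
    + apply fsum_le; intros; now apply Hpos.
    + clear; induction n0; simpl; lra.
  - rewrite Hdiff. apply Rle_trans with (fsum n0 (fun n => eps * (/ 2) ^ (S n))).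
    + apply fsum_le; intros n _. destruct (HC n) as (H1 & _ & H3).
      eapply Rle_trans; [|apply (H3 n0)]. rewrite <- fsum_scal.
      apply fsum_le; intros k _. unfold m. specialize (H1 k).
      assert (K1 := clip_bounds _ _ a H1). assert (K2 := clip_bounds _ _ b H1).
      assert (Hn := pos_INR n). nra.
    + rewrite fsum_scal. generalize (geom_fsum n0); nra.
  - intros u w t Hi Huw Ht. rewrite Hdiff.
    assert (Hxt := Hx t). destruct (HB _ _ _ Hi) as [Hb1 Hb2].
    destruct (Hf _ _ _ Hi) as [Hf1 Hf2].
    destruct (x t) as [[n k] r]; simpl in *. destruct Hxt as (Hr & Hxt).
    destruct (Hxt Ht) as (H1 & H2 & H3).
    apply Rle_trans with (m n k w - m n k u).
    + unfold m. rewrite <- Rmult_minus_distr_l, clip_inside; try lra.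
      apply Rmult_le_compat_r; lra.
    + eapply Rle_trans; [|apply (fsum_ge_term n0 _ n); auto].
      * apply (fsum_ge_term n0 (fun k => m n k w - m n k u)); auto. intros; apply Hm; lra.
      * intros; apply Hpos; lra.
Qed.

Lemma null_add_point E c : null E -> null (fun t => E t \/ t = c).
Proof.
  intros HE eps Heps. destruct (HE (eps / 2)) as (p & q & H1 & H2 & H3); [lra|].
  exists (fun n => match n with O => c - eps / 8 | S m => p m end).
  exists (fun n => match n with O => c + eps / 8 | S m => q m end).
  repeat split.
  - intros [|n]; auto; lra.
  - intros z [Hz| ->].
    + destruct (H2 z Hz) as [n Hn]; now exists (S n).
    + exists 0%nat; lra.
  - intros n. destruct n as [|n]; [simpl; lra|].
    assert (K : fsum (S n) (fun k => match k with O => c + eps / 8 | S m => q m end -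
      match k with O => c - eps / 8 | S m => p m end) = eps / 4 + fsum n (fun k => q k - p k)).
    { clear; induction n as [|n IH]; [simpl; lra|].
      change (fsum (S (S n)) ?f) with (fsum (S n) f + f (S n)). rewrite IH; simpl; lra. }
    rewrite K. specialize (H3 n). lra.
Qed.

(** In a Riemann sum of g, tags outside the null set contribute nonnegatively and the others at
    least [- (M w - M u)]; the latter telescope to an arbitrarily small loss. *)
Lemma HKprim_nondecreasing_ae g G E a b : HKprim g G -> null E ->
  0 <= a -> a <= b -> b <= 1 -> (forall t, a < t < b -> ~ E t -> 0 <= g t) -> G a <= G b.
Proof.
  intros HG HE Ha Hab Hb Hpos. apply Rnot_lt_le; intros Hlt.
  (* The sign of g is known only inside (a,b), hence the endpoints join the null set. On an
     excursion they may be passages through the vertex. *)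
  set (E' := fun t => (E t \/ t = a) \/ t = b).
  assert (HE' : null E') by (apply null_add_point, null_add_point, HE).
  destruct (null_gauge E' g a b ((G a - G b) / 2) HE') as (d1 & Hd1 & H1); [lra|].
  destruct (HG a b Ha Hab Hb ((G a - G b) / 2)) as (d2 & Hd2 & H2); [lra|].
  destruct (cousin (fun t => Rmin (d1 t) (d2 t)) a b) as (l & Hl & Hf); auto.
  { apply gauge_min; auto. }
  apply fine_min in Hf as [Hf1 Hf2].
  destruct (H1 l Hl Hf1) as (M & HM & HMab & HMt).
  specialize (H2 l Hl Hf2). apply Rabs_def2 in H2.
  assert (K : - (M b - M a) <= rsum g l); [|lra].
  clear H1 Hf1 Hf2 H2 HMab.
  assert (Hgen : forall l a', a <= a' -> tdiv a' b l ->
    (forall u w t, In ((u, w), t) l -> u < w -> E' t -> Rabs (g t) * (w - u) <= M w - M u) ->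
    - (M b - M a') <= rsum g l); [|now apply (Hgen l a); auto; lra].
  clear l Hl HMt. induction l as [|[[u w] t] l IH]; simpl; intros a' Ha' Hl HMt.
  - subst; lra.
  - destruct Hl as (-> & ? & ? & ? & Hl).
    assert (Hwb := tdiv_le _ _ _ Hl).
    assert (- (M b - M w) <= rsum g l) by (apply IH; auto; lra).
    assert (- (M w - M a') <= g t * (w - a')); [|lra].
    destruct (classic (E' t)) as [Ht|Ht].
    + assert (K := HMt a' w t (or_introl eq_refl) ltac:(lra) Ht).
      assert (- Rabs (g t) <= g t) by (unfold Rabs; destruct Rcase_abs; lra). nra.
    + assert (0 <= g t).
      { apply Hpos; [|intros He; apply Ht; now left; left].
        split; apply Rnot_le_lt; intros Hc; apply Ht; unfold E'.
        - left; right; lra.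
        - right; lra. }
      assert (M a' <= M w) by (apply HM; lra). nra.
Qed.

(** On each interval, the increment of A exceeds |F w - F u| by at most the errors of f and |f|,
    which are summable by Henstock's lemma. *)
Lemma variation_gauge f F A eps : HKprim f F -> HKprim (fun t => Rabs (f t)) A ->
  forall a b, 0 <= a -> a <= b -> b <= 1 -> 0 < eps ->
  exists d : R -> R, (forall t, a <= t <= b -> 0 < d t) /\
    forall l, tdiv a b l -> fine d l ->
      A b - A a - eps <= tsum (fun u w _ => Rabs (F w - F u)) l.
Proof.
  intros HF HA a b Ha Hab Hb Heps.
  destruct (saks_henstock _ _ a b (eps / 2) HF) as (d1 & Hd1 & H1); auto; try lra.
  destruct (saks_henstock _ _ a b (eps / 2) HA) as (d2 & Hd2 & H2); auto; try lra.
  exists (fun t => Rmin (d1 t) (d2 t)); split; [now apply gauge_min|].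
  intros l Hl Hfi. apply fine_min in Hfi as [Hf1 Hf2].
  specialize (H1 l Hl Hf1); specialize (H2 l Hl Hf2).
  rewrite <- (tsum_telescope A l _ _ Hl).
  apply Rle_trans with (tsum (fun u w t => Rabs (F w - F u) +
    (Rabs (f t * (w - u) - (F w - F u)) + Rabs (Rabs (f t) * (w - u) - (A w - A u)))) l - eps).
  - apply Rplus_le_compat_r. eapply tsum_le; eauto. intros u w t ? ? ? ?; cbv beta.
    assert (K : Rabs (f t * (w - u)) = Rabs (f t) * (w - u)).
    { rewrite Rabs_mult, (Rabs_right (w - u)); lra. }
    assert (K2 := Rabs_triang (F w - F u) (f t * (w - u) - (F w - F u))).
    replace (F w - F u + (f t * (w - u) - (F w - F u))) with (f t * (w - u)) in K2 by lra.
    assert (K3 := Rle_abs (- (Rabs (f t) * (w - u) - (A w - A u)))). rewrite Rabs_Ropp in K3. lra.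
  - rewrite !tsum_plus. lra.
Qed.

(** The gauge |t - c| forces every interval that contains c to be tagged at c. There the gauge [r]
    keeps the interval so short that the value [h c], which is free, does not matter. *)
Lemma HKint_indicator (h : R -> R) c a b :
  (forall t, t < c -> h t = 1) -> (forall t, c < t -> h t = 0) ->
  HKint h a b (Rmin b c - Rmin a c).
Proof.
  intros H1 H0. apply (HKint_control h (fun t => Rmin t c)). intros eps Heps.
  set (K := Rabs (h c) + 1).
  assert (HK : 0 < K) by (unfold K; generalize (Rabs_pos (h c)); lra).
  set (r := eps / (4 * K)).
  assert (Hr : 0 < r) by (apply Rdiv_lt_0_compat; lra).
  assert (HrK : K * r = eps / 4) by (unfold r; field; lra).
  exists (fun z => K * clip (c - r) (c + r) z).
  exists (fun t => if Req_dec_T t c then r else Rabs (t - c)).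
  repeat split.
  - assert (K1 := clip_bounds (c - r) (c + r) a ltac:(lra)).
    assert (K2 := clip_bounds (c - r) (c + r) b ltac:(lra)).
    apply Rle_lt_trans with (K * (2 * r)); nra.
  - intros t _. destruct Req_dec_T; auto. apply Rabs_pos_lt; lra.
  - intros u w t ? ? ? ? Hu Hw.
    assert (Hc := clip_incr (c - r) (c + r) u w ltac:(lra)).
    destruct Req_dec_T as [->|Hn].
    + rewrite <- Rmult_minus_distr_l, clip_inside by lra.
      assert (Hab : Rabs (h c * (w - u) - (Rmin w c - Rmin u c)) <= Rabs (h c) * (w - u) + (w - u)).
      { eapply Rle_trans; [apply Rabs_triang|]. rewrite Rabs_mult, (Rabs_right (w - u)), Rabs_Ropp by lra.
        apply Rplus_le_compat_l. unfold Rabs, Rmin; destruct Rle_dec, Rle_dec, Rcase_abs; lra. }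
      unfold K; lra.
    + replace (h t * (w - u) - (Rmin w c - Rmin u c)) with 0.
      * rewrite Rabs_R0. nra.
      * destruct (Rlt_le_dec t c) as [Hlt|Hle].
        -- rewrite Rabs_left in Hw by lra. rewrite H1, !Rmin_left by lra. lra.
        -- rewrite Rabs_right in Hu by lra. rewrite H0, !Rmin_right by lra. lra.
Qed.

(** * Energy levels of convex Lagrangians *)

(** Second derivatives serve only to produce [sc_low]. This first-order form of strong convexity
    carries the rest of the proof. *)
Record strconv (g : R) (f f1 : R -> R) : Prop := {
  sc_pos : 0 < g;
  sc_der : forall q, derivable_pt_lim f q (f1 q);
  sc_cont : continuity f1;
  sc_low : forall a b, f a + f1 a * (b - a) + g / 2 * (b - a) ^ 2 <= f b }.

Lemma mvt (f f1 : R -> R) a b : (forall q, derivable_pt_lim f q (f1 q)) -> a < b ->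
  exists c, f b - f a = f1 c * (b - a) /\ a < c < b.
Proof.
  intros Hd Hab. apply (MVT_cor2 f f1 a b Hab). intros; apply Hd.
Qed.

(** The function [h], equal to f minus the linear and quadratic terms of the bound, has a derivative
    with the sign of q - a, so its minimum is at a. *)
Lemma strconv_of_second_derivative g f f1 f2 : 0 < g ->
  (forall q, derivable_pt_lim f q (f1 q)) -> (forall q, derivable_pt_lim f1 q (f2 q)) ->
  (forall q, g <= f2 q) -> strconv g f f1.
Proof.
  intros Hg Hf Hf1 Hf2.
  assert (Hm : forall a b, a <= b -> g * (b - a) <= f1 b - f1 a).
  { intros a b [Hab| ->]; [|lra]. destruct (mvt f1 f2 a b Hf1 Hab) as (c & -> & _).
    specialize (Hf2 c); nra. }
  split; auto.
  { intros q. apply derivable_continuous_pt. exists (f2 q). apply Hf1. }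
  intros a b.
  set (h := fun q => f q - f1 a * (q - a) - g / 2 * ((q - a) * (q - a))).
  assert (Hh : forall q, derivable_pt_lim h q (f1 q - f1 a - g * (q - a))).
  { intros q. unfold h.
    replace (f1 q - f1 a - g * (q - a))
      with (f1 q - f1 a * (1 - 0) - g / 2 * ((1 - 0) * (q - a) + (q - a) * (1 - 0))) by lra.
    assert (Hid : derivable_pt_lim (fun q => q - a) q (1 - 0)).
    { apply (derivable_pt_lim_minus (fun q => q) (fun _ => a));
        [apply derivable_pt_lim_id|apply derivable_pt_lim_const]. }
    apply (derivable_pt_lim_minus (fun q => f q - f1 a * (q - a))
      (fun q => g / 2 * ((q - a) * (q - a)))).
    - apply (derivable_pt_lim_minus f (fun q => f1 a * (q - a))); [apply Hf|].
      now apply (derivable_pt_lim_scal (fun q => q - a)).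
    - apply (derivable_pt_lim_scal (fun q => (q - a) * (q - a))).
      now apply (derivable_pt_lim_mult (fun q => q - a) (fun q => q - a)). }
  assert (Hha : h a = f a) by (unfold h; lra).
  enough (h a <= h b) by (rewrite Hha in *; unfold h in *; lra).
  destruct (Rtotal_order a b) as [Hab|[->|Hab]]; [|lra|].
  - destruct (mvt h _ a b Hh Hab) as (c & He & Hc). assert (K := Hm a c ltac:(lra)). nra.
  - destruct (mvt h _ b a Hh Hab) as (c & He & Hc). assert (K := Hm c a ltac:(lra)). nra.
Qed.

(** Motion towards the vertex has negative velocity; after reflection it is described by a
    nonnegative speed, like motion away from it. *)
Lemma strconv_reflect g f f1 : strconv g f f1 ->
  strconv g (fun q => f (- q)) (fun q => - f1 (- q)).
Proof.
  intros [Hg Hd Hc Hl]; split; auto.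
  - intros q. replace (- f1 (- q)) with (f1 (- q) * -1) by lra.
    apply (derivable_pt_lim_comp (fun q => - q) f); auto.
    apply derivable_pt_lim_opp, derivable_pt_lim_id.
  - intros q. apply (continuity_pt_opp (fun q => f1 (- q))).
    apply (continuity_pt_comp (fun q => - q) f1); auto.
    apply continuity_pt_opp, derivable_continuous_pt, derivable_pt_id.
  - intros a b. specialize (Hl (- a) (- b)). nra.
Qed.

Definition energy (f f1 : R -> R) (q : R) : R := q * f1 q - f q.

Definition speed (f f1 : R -> R) (k : R) : R :=
  epsilon (inhabits 0) (fun w => 0 <= w /\ energy f f1 w = k).

Definition slope (f f1 : R -> R) (k : R) : R := f1 (speed f f1 k).

Lemma continuity_pt_eps f x : continuity_pt f x <->
  forall eps, 0 < eps -> exists eta, 0 < eta /\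
    forall y, Rabs (y - x) < eta -> Rabs (f y - f x) < eps.
Proof.
  split.
  - intros H eps Heps. destruct (H eps Heps) as (eta & Heta & H1).
    exists eta; split; auto. intros y Hy. destruct (Req_dec x y) as [->|Hn].
    + replace (_ - _) with 0 by lra. now rewrite Rabs_R0.
    + apply (H1 y). split; [split; [exact I|auto]|exact Hy].
  - intros H eps Heps. destruct (H eps Heps) as (eta & Heta & H1).
    exists eta; split; auto. intros y [_ Hy]. now apply (H1 y).
Qed.

(* The abstract behaviour of [k |-> speed f f1 k] above the level [c]. *)
Record speedlike (c : R) (u : R -> R) : Prop := {
  sl_nonneg : forall k, c <= k -> 0 <= u k;
  sl_incr : forall k k', c <= k -> k < k' -> u k < u k';
  sl_cont : forall k, c <= k -> forall eps, 0 < eps -> exists eta, 0 < eta /\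
     forall k', c <= k' -> Rabs (k' - k) < eta -> Rabs (u k' - u k) < eps;
  sl_unbounded : forall B, exists k, c <= k /\ B <= u k }.

Section Convex.
Context (g c : R) (f f1 : R -> R) (Hsc : strconv g f f1) (Hc : - f 0 <= c).

Lemma sc_mono a b : a <= b -> g * (b - a) <= f1 b - f1 a.
Proof.
  intros Hab. assert (K1 := sc_low _ _ _ Hsc a b). assert (K2 := sc_low _ _ _ Hsc b a).
  destruct Hab as [Hab| ->]; [|lra].
  apply Rmult_le_reg_r with (b - a); [lra|]. nra.
Qed.

Lemma sc_sq_nonneg x : 0 <= g / 2 * x ^ 2.
Proof.
  assert (K := sc_pos _ _ _ Hsc). apply Rmult_le_pos; [lra|apply pow2_ge_0].
Qed.

(** The energy increases by the gap at a of the tangent taken at b, plus [a * (f1 b - f1 a)]. The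
    gap is at least quadratic and the product is nonnegative because a >= 0. *)
Lemma energy_incr a b : 0 <= a -> a <= b ->
  energy f f1 a + g / 2 * (b - a) ^ 2 <= energy f f1 b.
Proof.
  intros Ha Hab. unfold energy. assert (K := sc_low _ _ _ Hsc b a).
  assert (K1 := sc_mono a b Hab). assert (K2 := sc_pos _ _ _ Hsc).
  assert (0 <= f1 b - f1 a) by nra. assert (0 <= a * (f1 b - f1 a)) by now apply Rmult_le_pos.
  nra.
Qed.

Lemma energy_continuity : continuity (energy f f1).
Proof.
  intros q. apply (continuity_pt_minus (fun q => q * f1 q) f).
  - apply (continuity_pt_mult (fun q => q) f1); [|apply (sc_cont _ _ _ Hsc)].
    apply derivable_continuous_pt, derivable_pt_id.
  - apply derivable_continuous_pt. exists (f1 q). apply (sc_der _ _ _ Hsc).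
Qed.

Lemma speed_spec k : c <= k -> 0 <= speed f f1 k /\ energy f f1 (speed f f1 k) = k.
Proof.
  intros Hk. unfold speed. apply epsilon_spec.
  assert (Hg := sc_pos _ _ _ Hsc).
  assert (H0 : energy f f1 0 <= k) by (unfold energy; lra).
  (* Since b >= 1, g/2 b^2 >= g/2 b >= k - [energy f f1 0], so the quadratic growth of the energy
     passes k before b. *)
  set (b := 1 + 2 * (k - energy f f1 0) / g).
  assert (Hb : 1 <= b).
  { unfold b. assert (0 <= 2 * (k - energy f f1 0) / g); [|lra].
    apply Rmult_le_pos; [lra|]. left; now apply Rinv_0_lt_compat. }
  assert (H1 : k <= energy f f1 b).
  { assert (K := energy_incr 0 b (Rle_refl 0) ltac:(lra)).
    assert (g * b = g + 2 * (k - energy f f1 0)) by (unfold b; field; lra).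
    assert (g * b <= g * b * b) by nra. nra. }
  destruct (IVT_cor (fun q => energy f f1 q - k) 0 b) as (w & Hw & He).
  - intros q. apply continuity_pt_minus; [apply energy_continuity|].
    apply continuity_pt_const; intros ? ?; reflexivity.
  - lra.
  - nra.
  - exists w; split; lra.
Qed.

Lemma speed_nonneg k : c <= k -> 0 <= speed f f1 k.
Proof. apply speed_spec. Qed.

Lemma speed_energy k : c <= k -> speed f f1 k * slope f f1 k - f (speed f f1 k) = k.
Proof. apply speed_spec. Qed.

Lemma speed_incr k k' : c <= k -> k < k' -> speed f f1 k < speed f f1 k'.
Proof.
  intros Hk Hkk. destruct (speed_spec k Hk) as [H1 H2].
  destruct (speed_spec k' ltac:(lra)) as [H3 H4].
  apply Rnot_le_lt; intros Hle. assert (K := energy_incr _ _ H3 Hle).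
  assert (K2 := sc_sq_nonneg (speed f f1 k - speed f f1 k')). lra.
Qed.

(** The energy may be flat to first order at speed 0, so a Lipschitz bound can fail; its quadratic
    growth still gives Hölder exponent 1/2. *)
Lemma speed_holder k k' : c <= k -> c <= k' ->
  g / 2 * (speed f f1 k' - speed f f1 k) ^ 2 <= Rabs (k' - k).
Proof.
  intros Hk Hk'. destruct (speed_spec k Hk) as [H1 H2]. destruct (speed_spec k' Hk') as [H3 H4].
  destruct (Rle_dec (speed f f1 k) (speed f f1 k')) as [Hle|Hle].
  - assert (K := energy_incr _ _ H1 Hle). assert (K2 := Rle_abs (k' - k)). lra.
  - assert (K := energy_incr _ _ H3 (Rlt_le _ _ (Rnot_le_lt _ _ Hle))).
    assert (K2 := Rle_abs (- (k' - k))). rewrite Rabs_Ropp in K2.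
    replace ((speed f f1 k' - speed f f1 k) ^ 2) with ((speed f f1 k - speed f f1 k') ^ 2) by ring. lra.
Qed.

Lemma speed_speedlike : speedlike c (speed f f1).
Proof.
  assert (Hg := sc_pos _ _ _ Hsc).
  split.
  - apply speed_nonneg.
  - apply speed_incr.
  - intros k Hk eps Heps. exists (g / 2 * eps ^ 2); split.
    { apply Rmult_lt_0_compat; [lra|apply pow_lt; lra]. }
    intros k' Hk' Hd. assert (K := speed_holder k k' Hk Hk').
    apply Rnot_le_lt; intros Hle.
    rewrite <- (pow2_abs (_ - _)) in K.
    assert (eps ^ 2 <= Rabs (speed f f1 k' - speed f f1 k) ^ 2) by (apply pow_incr; lra).
    apply (Rmult_le_compat_l (g / 2)) in H; lra.
  - intros B. set (b := Rmax 0 B). assert (Hb : 0 <= b) by apply Rmax_l.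
    exists (Rmax c (energy f f1 b)). split; [apply Rmax_l|].
    destruct (speed_spec (Rmax c (energy f f1 b)) (Rmax_l _ _)) as [H1 H2].
    apply Rle_trans with b; [apply Rmax_r|].
    apply Rnot_lt_le; intros Hlt. assert (K := energy_incr _ _ H1 (Rlt_le _ _ Hlt)).
    assert (K2 := Rmax_r c (energy f f1 b)).
    assert (K3 := sc_pos _ _ _ Hsc).
    assert (0 < (b - speed f f1 (Rmax c (energy f f1 b))) ^ 2) by (apply pow_lt; lra). nra.
Qed.

(** The left side is the tangent to f at [speed f f1 k]: an energy k means that this tangent has
    value - k at 0. *)
Lemma slope_support k q : c <= k -> slope f f1 k * q - k <= f q.
Proof.
  intros Hk. assert (K := sc_low _ _ _ Hsc (speed f f1 k) q).
  assert (K1 := speed_energy k Hk). unfold slope in *.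
  assert (K2 := sc_sq_nonneg (q - speed f f1 k)). lra.
Qed.

(** The tangent at energy k' is evaluated at the speed of energy k. Thus the slope is concave in k
    with supergradient 1 / speed; the product form remains meaningful at speed 0. *)
Lemma slope_concave k k' : c <= k -> c <= k' ->
  speed f f1 k * (slope f f1 k' - slope f f1 k) <= k' - k.
Proof.
  intros Hk Hk'. assert (K := slope_support k' (speed f f1 k) Hk').
  assert (K1 := speed_energy k Hk). nra.
Qed.

Lemma slope_ge k : c <= k -> f1 0 <= slope f f1 k.
Proof.
  intros Hk. assert (K := sc_mono 0 _ (speed_nonneg k Hk)).
  assert (K2 := sc_pos _ _ _ Hsc). assert (K3 := speed_nonneg k Hk). unfold slope; nra.
Qed.

Lemma slope_incr k k' : c <= k -> k <= k' -> slope f f1 k <= slope f f1 k'.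
Proof.
  intros Hk [Hkk| ->]; [|lra]. assert (K := speed_incr k k' Hk Hkk).
  assert (K2 := sc_mono _ _ (Rlt_le _ _ K)). assert (K3 := sc_pos _ _ _ Hsc). unfold slope; nra.
Qed.

Lemma slope_cont k : c <= k -> forall eps, 0 < eps -> exists eta, 0 < eta /\
  forall k', c <= k' -> Rabs (k' - k) < eta -> Rabs (slope f f1 k' - slope f f1 k) < eps.
Proof.
  intros Hk eps Heps.
  destruct (proj1 (continuity_pt_eps _ _) (sc_cont _ _ _ Hsc (speed f f1 k)) eps Heps)
    as (e1 & He1 & H1).
  destruct (sl_cont _ _ speed_speedlike k Hk e1 He1) as (e2 & He2 & H2).
  exists e2; split; auto. intros; apply H1; auto.
Qed.

End Convex.

(* [k] is the energy level of an optimal path that runs through the vertex from distance s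
   to distance r with speeds [u k] and [w k]: the moving time is at most 1, and the path
   waits at the vertex only at the bottom level c.  When s = 0 the term [s / u k] is 0
   even if [u k = 0]. *)
Definition is_level (c : R) (u w : R -> R) (s r k : R) : Prop :=
  c <= k /\ (0 < s -> 0 < u k) /\ (0 < r -> 0 < w k) /\
  s / u k + r / w k <= 1 /\ (k = c \/ s / u k + r / w k = 1).

Definition level (c : R) (u w : R -> R) (s r : R) : R :=
  epsilon (inhabits 0) (is_level c u w s r).

Lemma div_nonneg s x : 0 <= s -> 0 <= x -> 0 <= s / x.
Proof.
  intros Hs [Hx| <-]; [apply Rmult_le_pos; auto; left; now apply Rinv_0_lt_compat|].
  unfold Rdiv; rewrite Rinv_0; lra.
Qed.

Lemma div_le_1_iff s x : 0 < x -> s / x <= 1 <-> s <= x.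
Proof.
  intros Hx; split; intros H.
  - apply (Rmult_le_compat_r x) in H; [|lra]. replace (s / x * x) with s in H by (field; lra). lra.
  - apply Rmult_le_reg_r with x; auto. replace (s / x * x) with s by (field; lra). lra.
Qed.

(** Freezing u below c gives a function continuous on the whole line, to which the intermediate
    value theorem applies. *)
Lemma continuity_extend c (u : R -> R) :
  (forall k, c <= k -> forall eps, 0 < eps -> exists eta, 0 < eta /\
     forall k', c <= k' -> Rabs (k' - k) < eta -> Rabs (u k' - u k) < eps) ->
  continuity (fun k => u (Rmax c k)).
Proof.
  intros H k. apply continuity_pt_eps. intros eps Heps.
  destruct (H (Rmax c k) (Rmax_l _ _) eps Heps) as (eta & Heta & H1).
  exists eta; split; auto. intros y Hy. apply H1; [apply Rmax_l|].
  eapply Rle_lt_trans; [|exact Hy].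
  unfold Rmax, Rabs; repeat destruct Rle_dec; repeat destruct Rcase_abs; lra.
Qed.

(** * Existence, uniqueness and continuity of the energy level *)

Section Level.
Context (c : R) (u w : R -> R) (Hu : speedlike c u) (Hw : speedlike c w).

Lemma speedlike_pos v k : speedlike c v -> c < k -> 0 < v k.
Proof.
  intros Hv Hk. assert (K := sl_incr _ _ Hv c k (Rle_refl c) Hk).
  assert (K2 := sl_nonneg _ _ Hv c (Rle_refl c)). lra.
Qed.

Lemma time_term_decr v s k k' : speedlike c v -> 0 <= s -> c <= k -> k < k' ->
  (0 < s -> 0 < v k) -> s / v k' <= s / v k /\ (0 < s -> s / v k' < s / v k).
Proof.
  intros Hv [Hs| <-] Hk Hkk Hp.
  - specialize (Hp Hs). assert (K := sl_incr _ _ Hv k k' Hk Hkk).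
    assert (K2 : s / v k' < s / v k).
    { apply Rmult_lt_compat_l; auto. apply Rinv_lt_contravar; auto. apply Rmult_lt_0_compat; lra. }
    lra.
  - unfold Rdiv; split; [lra|]. intros; lra.
Qed.

Lemma time_decr s r k k' : 0 <= s -> 0 <= r -> c <= k -> k < k' ->
  (0 < s -> 0 < u k) -> (0 < r -> 0 < w k) -> 0 < s + r ->
  s / u k' + r / w k' < s / u k + r / w k.
Proof.
  intros Hs Hr Hk Hkk H1 H2 Hsr.
  destruct (time_term_decr u s k k' Hu Hs Hk Hkk H1) as [A1 A2].
  destruct (time_term_decr w r k k' Hw Hr Hk Hkk H2) as [B1 B2].
  destruct Hs as [Hs| <-]; [specialize (A2 Hs); lra|]. specialize (B2 ltac:(lra)); lra.
Qed.

Lemma speedlike_bottom v s : speedlike c v -> (forall k, c < k -> s / v k <= 1) -> s <= v c.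
Proof.
  intros Hv H. apply Rnot_lt_le; intros Hlt.
  destruct (sl_cont _ _ Hv c (Rle_refl c) (s - v c)) as (eta & Heta & H2); [lra|].
  specialize (H2 (c + eta / 2) ltac:(lra)).
  replace (c + eta / 2 - c) with (eta / 2) in H2 by lra. rewrite Rabs_right in H2 by lra.
  specialize (H2 ltac:(lra)). apply Rabs_def2 in H2.
  assert (K := proj1 (div_le_1_iff s _ (speedlike_pos v (c + eta / 2) Hv ltac:(lra)))
    (H (c + eta / 2) ltac:(lra))). lra.
Qed.

(** A speed may vanish at [c], so the equation time = 1 is solved through [h], where the
    denominators are cleared. If the time exceeds 1 somewhere above [c] there is a root; otherwise
    [c] itself is a level, by passing to the limit. *)
Lemma is_level_exists s r : 0 <= s -> 0 <= r -> exists k, is_level c u w s r k.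
Proof.
  intros Hs Hr.
  set (h := fun k => u (Rmax c k) * w (Rmax c k) - s * w (Rmax c k) - r * u (Rmax c k)).
  assert (Hcu := continuity_extend c u (sl_cont _ _ Hu)).
  assert (Hcw := continuity_extend c w (sl_cont _ _ Hw)).
  assert (Hh : continuity h).
  { intros k. apply (continuity_pt_minus (fun k => u (Rmax c k) * w (Rmax c k) - s * w (Rmax c k))).
    - apply continuity_pt_minus; [now apply continuity_pt_mult|].
      apply (continuity_pt_scal (fun k => w (Rmax c k))); auto.
    - apply (continuity_pt_scal (fun k => u (Rmax c k))); auto. }
  assert (HT : forall k, c < k -> h k = u k * w k * (1 - (s / u k + r / w k))).
  { intros k Hk. assert (K1 := speedlike_pos u k Hu Hk). assert (K2 := speedlike_pos w k Hw Hk).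
    unfold h. rewrite Rmax_right by lra. field; lra. }
  destruct (classic (exists k0, c < k0 /\ 1 < s / u k0 + r / w k0)) as [(k0 & Hk0 & H0)|Hn].
  (* At speeds above 2 s and 2 r each part of the trip takes less than half the time, so [h] is
     nonnegative at [m]. *)
  - destruct (sl_unbounded _ _ Hu (2 * s + 1)) as (k1 & Hk1 & H1).
    destruct (sl_unbounded _ _ Hw (2 * r + 1)) as (k2 & Hk2 & H2).
    set (m := Rmax k0 (Rmax k1 k2) + 1).
    assert (Hm : k0 < m /\ k1 < m /\ k2 < m).
    { unfold m; generalize (Rmax_l k0 (Rmax k1 k2)) (Rmax_r k0 (Rmax k1 k2))
        (Rmax_l k1 k2) (Rmax_r k1 k2); lra. }
    assert (Hum := sl_incr _ _ Hu k1 m Hk1 ltac:(lra)).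
    assert (Hwm := sl_incr _ _ Hw k2 m Hk2 ltac:(lra)).
    destruct (IVT_cor h k0 m) as (k & Hk & He); auto; [lra| |].
    + assert (h k0 <= 0).
      { rewrite HT by auto. assert (K1 := speedlike_pos u k0 Hu Hk0).
        assert (K2 := speedlike_pos w k0 Hw Hk0).
        assert (0 < u k0 * w k0) by now apply Rmult_lt_0_compat. nra. }
      assert (0 <= h m).
      { unfold h; rewrite Rmax_right by lra.
        assert (0 <= w m * (u m - 2 * s)) by (apply Rmult_le_pos; lra).
        assert (0 <= u m * (w m - 2 * r)) by (apply Rmult_le_pos; lra). lra. }
      rewrite <- (Rmult_0_l (h m)). now apply Rmult_le_compat_r.
    + exists k. assert (Hck : c < k) by lra.
      assert (K1 := speedlike_pos u k Hu Hck). assert (K2 := speedlike_pos w k Hw Hck).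
      rewrite HT in He by auto. apply Rmult_integral in He as [He|He].
      { apply Rmult_integral in He as [He|He]; lra. }
      repeat split; auto; lra.
  - assert (H1 : forall k, c < k -> s / u k + r / w k <= 1).
    { intros k Hk. apply Rnot_lt_le; intros Hlt. apply Hn; now exists k. }
    assert (Hsu : s <= u c).
    { apply (speedlike_bottom u s Hu). intros k Hk. specialize (H1 k Hk).
      assert (K := div_nonneg r _ Hr (Rlt_le _ _ (speedlike_pos w k Hw Hk))). lra. }
    assert (Hrw : r <= w c).
    { apply (speedlike_bottom w r Hw). intros k Hk. specialize (H1 k Hk).
      assert (K := div_nonneg s _ Hs (Rlt_le _ _ (speedlike_pos u k Hu Hk))). lra. }
    exists c. repeat split; try lra.
    (* Only a positive distance forces a positive speed at [c]; a zero distance takes no time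
       whatever the speed. *)
    destruct (Req_dec s 0) as [->|Hs0].
    { destruct (Req_dec r 0) as [->|Hr0]; [unfold Rdiv; lra|].
      replace (0 / u c) with 0 by (unfold Rdiv; lra). rewrite Rplus_0_l. apply div_le_1_iff; lra. }
    destruct (Req_dec r 0) as [->|Hr0].
    { replace (0 / w c) with 0 by (unfold Rdiv; lra). rewrite Rplus_0_r. apply div_le_1_iff; lra. }
    assert (Hhc : 0 <= h c).
    { apply Rnot_lt_le; intros Hlt.
      destruct (proj1 (continuity_pt_eps _ _) (Hh c) (- h c)) as (eta & Heta & H2); [lra|].
      specialize (H2 (c + eta / 2)). replace (c + eta / 2 - c) with (eta / 2) in H2 by lra.
      rewrite Rabs_right in H2 by lra. specialize (H2 ltac:(lra)). apply Rabs_def2 in H2.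
      assert (K := H1 (c + eta / 2) ltac:(lra)).
      assert (K1 := speedlike_pos u (c + eta / 2) Hu ltac:(lra)).
      assert (K2 := speedlike_pos w (c + eta / 2) Hw ltac:(lra)).
      rewrite HT in H2 by lra.
      assert (0 < u (c + eta / 2) * w (c + eta / 2)) by now apply Rmult_lt_0_compat. nra. }
    unfold h in Hhc. rewrite Rmax_left in Hhc by lra.
    apply Rmult_le_reg_l with (u c * w c); [apply Rmult_lt_0_compat; lra|].
    replace (u c * w c * (s / u c + r / w c)) with (s * w c + r * u c) by (field; lra). lra.
Qed.

(** The larger of two levels is above [c], so its moving time is exactly 1; by strict monotonicity
    the smaller one would need more than 1. *)
Lemma is_level_unique s r k k' : 0 <= s -> 0 <= r ->
  is_level c u w s r k -> is_level c u w s r k' -> k = k'.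
Proof.
  assert (Hlt : forall k k', 0 <= s -> 0 <= r ->
    is_level c u w s r k -> is_level c u w s r k' -> ~ k < k').
  { clear k k'. intros k k' Hs Hr (H1 & H2 & H3 & H4 & H5) (H1' & H2' & H3' & H4' & H5') Hkk.
    destruct H5' as [->|H5']; [lra|].
    assert (Hsr : 0 < s + r).
    { destruct Hs as [Hs| <-]; [lra|]. destruct Hr as [Hr| <-]; [lra|].
      unfold Rdiv in H5'; lra. }
    assert (K := time_decr s r k k' Hs Hr H1 Hkk H2 H3 Hsr). lra. }
  intros Hs Hr Hk Hk'. destruct (Rtotal_order k k') as [H|[H|H]]; auto; exfalso.
  - now apply (Hlt k k').
  - now apply (Hlt k' k).
Qed.

Lemma level_spec s r : 0 <= s -> 0 <= r -> is_level c u w s r (level c u w s r).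
Proof. intros; unfold level; apply epsilon_spec. now apply is_level_exists. Qed.

Lemma level_ge s r : 0 <= s -> 0 <= r -> c <= level c u w s r.
Proof. intros Hs Hr; apply (level_spec s r Hs Hr). Qed.

Lemma level_lt s r k : 0 <= s -> 0 <= r -> c < k -> s / u k + r / w k < 1 ->
  level c u w s r <= k.
Proof.
  intros Hs Hr Hk HT. destruct (level_spec s r Hs Hr) as (H1 & H2 & H3 & H4 & [H5|H5]); [lra|].
  apply Rnot_lt_le; intros Hlt.
  destruct (Req_dec (s + r) 0) as [H0|H0].
  { assert (s = 0) by lra. assert (r = 0) by lra. subst. unfold Rdiv in H5; lra. }
  assert (K := time_decr s r k _ Hs Hr (Rlt_le _ _ Hk) Hlt (fun _ => speedlike_pos u k Hu Hk)
    (fun _ => speedlike_pos w k Hw Hk) ltac:(lra)). lra.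
Qed.

Lemma level_gt s r k : 0 <= s -> 0 <= r -> c < k -> 1 < s / u k + r / w k ->
  k <= level c u w s r.
Proof.
  intros Hs Hr Hk HT. destruct (level_spec s r Hs Hr) as (H1 & H2 & H3 & H4 & H5).
  apply Rnot_lt_le; intros Hlt.
  destruct (Req_dec (s + r) 0) as [H0|H0].
  { assert (s = 0) by lra. assert (r = 0) by lra. subst. unfold Rdiv in HT; lra. }
  assert (K := time_decr s r _ k Hs Hr H1 Hlt H2 H3 ltac:(lra)). lra.
Qed.

Lemma time_continuous s r k eps : c < k -> 0 < eps -> exists eta, 0 < eta /\
  forall s' r', Rabs (s' - s) + Rabs (r' - r) < eta ->
    Rabs (s' / u k + r' / w k - (s / u k + r / w k)) < eps.
Proof.
  intros Hk Heps. assert (K1 := speedlike_pos u k Hu Hk). assert (K2 := speedlike_pos w k Hw Hk).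
  assert (I1 := Rinv_0_lt_compat _ K1). assert (I2 := Rinv_0_lt_compat _ K2).
  exists (eps / (/ u k + / w k)); split; [apply Rdiv_lt_0_compat; lra|].
  intros s' r' H.
  replace (_ - _) with ((s' - s) * / u k + (r' - r) * / w k) by (unfold Rdiv; lra).
  eapply Rle_lt_trans; [apply Rabs_triang|].
  rewrite !Rabs_mult, (Rabs_right (/ u k)), (Rabs_right (/ w k)) by lra.
  apply (Rmult_lt_compat_r (/ u k + / w k)) in H; [|lra].
  replace (eps / (/ u k + / w k) * (/ u k + / w k)) with eps in H
    by (field; repeat split; apply Rgt_not_eq; nra).
  assert (P1 := Rabs_pos (s' - s)). assert (P2 := Rabs_pos (r' - r)). nra.
Qed.

(** The level is trapped by testing the time at [k0 + eps / 2] and [k0 - eps / 2]. At a fixed energy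
    above [c] the time is linear in the distances, so the strict inequalities persist nearby; near
    the bottom, [level_ge] gives the lower bound. *)
Lemma level_continuous s r eps : 0 <= s -> 0 <= r -> 0 < eps -> exists eta, 0 < eta /\
  forall s' r', 0 <= s' -> 0 <= r' -> Rabs (s' - s) + Rabs (r' - r) < eta ->
    Rabs (level c u w s' r' - level c u w s r) < eps.
Proof.
  intros Hs Hr Heps. set (k0 := level c u w s r).
  destruct (level_spec s r Hs Hr) as (H1 & H2 & H3 & H4 & H5). fold k0 in H1, H2, H3, H4, H5.
  assert (Hup : exists eta, 0 < eta /\ forall s' r', 0 <= s' -> 0 <= r' ->
    Rabs (s' - s) + Rabs (r' - r) < eta -> level c u w s' r' <= k0 + eps / 2).
  { set (k := k0 + eps / 2).
    assert (HT : s / u k + r / w k < 1).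
    { destruct (Req_dec (s + r) 0) as [H0|H0].
      - assert (s = 0) by lra. assert (r = 0) by lra. subst. unfold Rdiv; lra.
      - assert (K := time_decr s r k0 k Hs Hr H1 ltac:(unfold k; lra) H2 H3 ltac:(lra)). lra. }
    destruct (time_continuous s r k (1 - (s / u k + r / w k))) as (eta & Heta & H6);
      try (unfold k in *; lra).
    exists eta; split; auto. intros s' r' Hs' Hr' Hd. apply level_lt; auto; [unfold k; lra|].
    specialize (H6 s' r' Hd). apply Rabs_def2 in H6. lra. }
  assert (Hlo : exists eta, 0 < eta /\ forall s' r', 0 <= s' -> 0 <= r' ->
    Rabs (s' - s) + Rabs (r' - r) < eta -> k0 - eps < level c u w s' r').
  { destruct (Rlt_le_dec (k0 - eps) c) as [Hlt|Hle].
    - exists 1; split; [lra|]. intros s' r' Hs' Hr' _. assert (K := level_ge s' r' Hs' Hr'). lra.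
    - destruct H5 as [H5|H5]; [lra|]. set (k := k0 - eps / 2).
      assert (Hk : c < k) by (unfold k; lra).
      assert (HT : 1 < s / u k + r / w k).
      { rewrite <- H5. apply time_decr; auto; try (unfold k; lra).
        - intros; now apply speedlike_pos.
        - intros; now apply speedlike_pos.
        - destruct (Req_dec (s + r) 0) as [H0|H0]; [|lra].
          assert (s = 0) by lra. assert (r = 0) by lra. subst. unfold Rdiv in H5; lra. }
      destruct (time_continuous s r k (s / u k + r / w k - 1)) as (eta & Heta & H6); auto; try lra.
      exists eta; split; auto. intros s' r' Hs' Hr' Hd.
      apply Rlt_le_trans with k; [unfold k; lra|]. apply level_gt; auto.
      specialize (H6 s' r' Hd). apply Rabs_def2 in H6. lra. }
  destruct Hup as (e1 & He1 & K1). destruct Hlo as (e2 & He2 & K2).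
  exists (Rmin e1 e2); split; [now apply Rmin_glb_lt|]. intros s' r' Hs' Hr' Hd.
  assert (L1 := Rmin_l e1 e2). assert (L2 := Rmin_r e1 e2).
  specialize (K1 s' r' Hs' Hr' ltac:(lra)). specialize (K2 s' r' Hs' Hr' ltac:(lra)).
  apply Rabs_def1; lra.
Qed.

End Level.

(** With no distance to cover, the incoming speed drops out of the conditions. Hence the branch
    assigned to a starting point at the vertex has no influence on [Gam]. *)
Lemma level_indep_left c u u' w r : speedlike c u -> speedlike c u' -> speedlike c w -> 0 <= r ->
  level c u w 0 r = level c u' w 0 r.
Proof.
  intros Hu Hu' Hw Hr. apply (is_level_unique c u w Hu Hw 0 r); auto; try lra.
  - apply level_spec; auto; lra.
  - assert (K := level_spec c u' w Hu' Hw 0 r (Rle_refl 0) Hr).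
    unfold is_level, Rdiv in *. rewrite !Rmult_0_l in *. intuition lra.
Qed.

Lemma level_indep_right c u w w' s : speedlike c u -> speedlike c w -> speedlike c w' -> 0 <= s ->
  level c u w s 0 = level c u w' s 0.
Proof.
  intros Hu Hw Hw' Hs. apply (is_level_unique c u w Hu Hw s 0); auto; try lra.
  - apply level_spec; auto; lra.
  - assert (K := level_spec c u w' Hu Hw' s 0 Hs (Rle_refl 0)).
    unfold is_level, Rdiv in *. rewrite !Rmult_0_l in *. intuition lra.
Qed.

(** * The junction and the cost through the vertex *)

Definition dot (p q : pt) : R := fst p * fst q + snd p * snd q.

Record junction (N : nat) (e : nat -> pt) (L L1 : nat -> R -> R) (g : R) : Prop := {
  jn_pos : (1 <= N)%nat;
  jn_unit : forall i, (i < N)%nat -> pnorm (e i) = 1;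
  jn_dist : forall i j, (i < N)%nat -> (j < N)%nat -> i <> j -> e i <> e j;
  jn_conv : forall i, (i < N)%nat -> strconv g (L i) (L1 i) }.

Lemma bigmin_le n f k : (k <= n)%nat -> bigmin n f <= f k.
Proof.
  induction n as [|n IH]; intros Hk; simpl; [replace k with 0%nat by lia; lra|].
  destruct (Nat.eq_dec k (S n)) as [->|]; [apply Rmin_r|].
  eapply Rle_trans; [apply Rmin_l|apply IH; lia].
Qed.

Lemma bigmin_attained n f : exists k, (k <= n)%nat /\ bigmin n f = f k.
Proof.
  induction n as [|n (k & Hk & IH)]; simpl; [exists 0%nat; auto|].
  unfold Rmin; destruct Rle_dec; [exists k; auto|exists (S n); auto].
Qed.

Lemma bigmax_eq n f m : (forall k, (k <= n)%nat -> f k <= m) ->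
  (exists k, (k <= n)%nat /\ f k = m) -> bigmax n f = m.
Proof.
  intros H (k & Hk & Hm).
  assert (Hle : forall n', (n' <= n)%nat -> bigmax n' f <= m).
  { induction n' as [|n' IH]; simpl; intros Hn; [apply H; lia|].
    apply Rmax_lub; [apply IH; lia|apply H; lia]. }
  assert (Hge : forall n' , (k <= n')%nat -> f k <= bigmax n' f).
  { induction n' as [|n' IH]; simpl; intros Hn; [replace k with 0%nat by lia; lra|].
    destruct (Nat.eq_dec k (S n')) as [->|]; [apply Rmax_r|].
    eapply Rle_trans; [apply IH; lia|apply Rmax_l]. }
  apply Rle_antisym; [apply Hle; lia|]. rewrite <- Hm; auto.
Qed.

Lemma dot_smul_l s p q : dot (smul s p) q = s * dot p q.
Proof. unfold dot, smul; simpl; ring. Qed.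

Lemma smul_0 p : smul 0 p = pt0.
Proof. unfold smul, pt0; f_equal; lra. Qed.

Lemma pnorm_0 : pnorm pt0 = 0.
Proof. unfold pnorm, pt0; simpl. replace (0 * 0 + 0 * 0) with 0 by lra. apply sqrt_0. Qed.

Lemma pnorm_smul s p : 0 <= s -> pnorm (smul s p) = s * pnorm p.
Proof.
  intros Hs. unfold pnorm, smul; simpl.
  replace (s * fst p * (s * fst p) + s * snd p * (s * snd p))
    with ((s * s) * (fst p * fst p + snd p * snd p)) by ring.
  rewrite sqrt_mult_alt by nra. rewrite sqrt_square; auto.
Qed.

Section Junction.
Context {N : nat} {e : nat -> pt} {L L1 : nat -> R -> R} {g : R} (HJ : junction N e L L1 g).

Lemma dot_diag i : (i < N)%nat -> dot (e i) (e i) = 1.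
Proof.
  intros Hi. assert (K := jn_unit _ _ _ _ _ HJ i Hi). unfold pnorm in K. fold (dot (e i) (e i)) in K.
  rewrite <- (sqrt_sqrt (dot (e i) (e i))), K; [lra|unfold dot; nra].
Qed.

Lemma dot_off i j : (i < N)%nat -> (j < N)%nat -> i <> j -> dot (e i) (e j) < 1.
Proof.
  intros Hi Hj Hij. assert (K1 := dot_diag i Hi). assert (K2 := dot_diag j Hj).
  apply Rnot_le_lt; intros Hle. apply (jn_dist _ _ _ _ _ HJ i j Hi Hj Hij).
  destruct (e i) as [a b], (e j) as [a' b']; unfold dot in *; simpl in *.
  assert (H : (a - a') * (a - a') + (b - b') * (b - b') <= 0) by nra.
  assert (S1 := Rle_0_sqr (a - a')). assert (S2 := Rle_0_sqr (b - b')). unfold Rsqr in S1, S2.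
  assert (E1 : (a - a') * (a - a') = 0) by lra. assert (E2 : (b - b') * (b - b') = 0) by lra.
  apply Rmult_integral in E1. apply Rmult_integral in E2. f_equal; lra.
Qed.

Lemma pnorm_branch i s : (i < N)%nat -> 0 <= s -> pnorm (smul s (e i)) = s.
Proof. intros Hi Hs. rewrite pnorm_smul, (jn_unit _ _ _ _ _ HJ) by auto. lra. Qed.

Lemma branch_coord i j s t : (i < N)%nat -> (j < N)%nat -> 0 <= s -> 0 <= t ->
  smul s (e i) = smul t (e j) -> s = t.
Proof.
  intros Hi Hj Hs Ht H. rewrite <- (pnorm_branch i s Hi Hs), H. now apply pnorm_branch.
Qed.

Lemma branch_index i j s t : (i < N)%nat -> (j < N)%nat -> 0 < s -> 0 <= t ->
  smul s (e i) = smul t (e j) -> i = j.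
Proof.
  intros Hi Hj Hs Ht H. assert (s = t) by (apply (branch_coord i j); auto; lra). subst t.
  apply NNPP; intros Hij. apply (jn_dist _ _ _ _ _ HJ i j Hi Hj Hij).
  destruct (e i) as [a b], (e j) as [a' b']; unfold smul in H; simpl in H; injection H as H1 H2.
  f_equal; eapply Rmult_eq_reg_l; eauto; lra.
Qed.

Lemma smul_eq_0 i s : (i < N)%nat -> 0 <= s -> smul s (e i) = pt0 -> s = 0.
Proof.
  intros Hi Hs H. rewrite <- (pnorm_branch i s Hi Hs), H. apply pnorm_0.
Qed.

(* An arbitrary branch through x when x is the vertex. *)
Definition br (x : pt) : nat := epsilon (inhabits 0%nat) (fun i => (i < N)%nat /\ onbranch e i x).

Lemma br_spec x : inJ N e x -> (br x < N)%nat /\ x = smul (pnorm x) (e (br x)).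
Proof.
  intros Hx. assert (K : (br x < N)%nat /\ onbranch e (br x) x) by (unfold br; now apply epsilon_spec).
  destruct K as (K1 & s & Hs & K2); split; auto.
  rewrite K2 at 2. rewrite pnorm_branch by auto. congruence.
Qed.

Lemma inJ_branch i s : (i < N)%nat -> 0 <= s -> inJ N e (smul s (e i)).
Proof. intros; exists i; split; auto; exists s; auto. Qed.

Lemma br_branch i s : (i < N)%nat -> 0 < s -> br (smul s (e i)) = i.
Proof.
  intros Hi Hs. destruct (br_spec (smul s (e i)) (inJ_branch i s Hi (Rlt_le _ _ Hs))) as [K1 K2].
  rewrite pnorm_branch in K2 by (auto; lra). symmetry.
  eapply branch_index; [| | | |exact K2]; auto; lra.
Qed.

Lemma inJ_cases x : inJ N e x -> exists i s, (i < N)%nat /\ 0 <= s /\ x = smul s (e i).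
Proof. intros (i & Hi & s & Hs & ->); exists i, s; auto. Qed.

(** * Functions on J^2 glued from the products of branches *)

Definition lift {A} (G : nat -> nat -> R -> R -> A) (y x : pt) : A :=
  G (br y) (br x) (pnorm y) (pnorm x).

(** At the vertex [br] makes an arbitrary choice; this condition removes its effect, so that [lift]
    can be read on any pair of branches. *)
Definition vertex_compatible (G : nat -> nat -> R -> R -> R) : Prop :=
  (forall j j' i t, (j < N)%nat -> (j' < N)%nat -> (i < N)%nat -> 0 <= t -> G j i 0 t = G j' i 0 t) /\
  (forall j i i' s, (j < N)%nat -> (i < N)%nat -> (i' < N)%nat -> 0 <= s -> G j i s 0 = G j i' s 0).

Lemma lift_branch G j i s t : vertex_compatible G -> (j < N)%nat -> (i < N)%nat -> 0 <= s -> 0 <= t ->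
  lift G (smul s (e j)) (smul t (e i)) = G j i s t.
Proof.
  intros [H1 H2] Hj Hi Hs Ht. unfold lift. rewrite !pnorm_branch by auto.
  assert (B1 := proj1 (br_spec _ (inJ_branch j s Hj Hs))).
  assert (B2 := proj1 (br_spec _ (inJ_branch i t Hi Ht))).
  transitivity (G j (br (smul t (e i))) s t).
  - destruct Hs as [Hs| <-]; [now rewrite (br_branch j s)|auto].
  - destruct Ht as [Ht| <-]; [now rewrite (br_branch i t)|auto].
Qed.

Lemma dJ_branch_same i s t : (i < N)%nat -> 0 <= s -> 0 <= t ->
  dJ N e (smul s (e i)) (smul t (e i)) = Rabs (t - s).
Proof.
  intros Hi Hs Ht. unfold dJ. destruct excluded_middle_informative as [_|Hn].
  - assert (Hw : forall a b, a <= b -> pnorm (psub (smul a (e i)) (smul b (e i))) = b - a).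
    { intros a b Hab. replace (psub (smul a (e i)) (smul b (e i))) with (smul (a - b) (e i))
        by (unfold psub, smul; simpl; f_equal; ring).
      assert (K := pnorm_branch i (b - a) Hi ltac:(lra)). rewrite <- K.
      unfold pnorm, smul; simpl; f_equal; ring. }
    destruct (Rle_dec s t).
    + rewrite Hw, Rabs_right; lra.
    + replace (pnorm _) with (pnorm (psub (smul t (e i)) (smul s (e i)))).
      * rewrite Hw, Rabs_left; lra.
      * unfold pnorm, psub; simpl; f_equal; ring.
  - exfalso; apply Hn. exists i; split; auto; split; [exists s|exists t]; auto.
Qed.

Lemma dJ_branch_other i j s t : (i < N)%nat -> (j < N)%nat -> i <> j -> 0 < s -> 0 < t ->
  dJ N e (smul s (e i)) (smul t (e j)) = s + t.
Proof.
  intros Hi Hj Hij Hs Ht. unfold dJ. destruct excluded_middle_informative as [(k & Hk & (a & Ha & E1) & b & Hb & E2)|Hn].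
  - exfalso; apply Hij. rewrite (branch_index i k s a Hi Hk Hs Ha E1).
    symmetry. eapply branch_index; [| | | |exact E2]; auto.
  - rewrite !pnorm_branch; auto; lra.
Qed.

Lemma dJ_branch_ge j k s s' : (j < N)%nat -> (k < N)%nat -> j <> k -> 0 < s -> 0 <= s' ->
  s <= dJ N e (smul s (e j)) (smul s' (e k)).
Proof.
  intros Hj Hk Hjk Hs [Hs'| <-].
  - rewrite dJ_branch_other by auto; lra.
  - rewrite smul_0, <- (smul_0 (e j)), dJ_branch_same, Rabs_left; auto; lra.
Qed.

Lemma dJ_branch_sum j i s t : (j < N)%nat -> (i < N)%nat -> j <> i -> 0 <= s -> 0 <= t ->
  dJ N e (smul s (e j)) (smul t (e i)) = s + t.
Proof.
  intros Hj Hi Hji [Hs| <-] [Ht| <-].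
  - now apply dJ_branch_other.
  - rewrite smul_0, <- (smul_0 (e j)), dJ_branch_same, Rabs_left; auto; lra.
  - rewrite smul_0, <- (smul_0 (e i)), dJ_branch_same, Rabs_right; auto; lra.
  - rewrite !smul_0, <- (smul_0 (e i)), dJ_branch_same by (auto; lra).
    rewrite Rminus_diag, Rabs_R0; lra.
Qed.

Definition continuous_on_quadrant (f : R -> R -> R) : Prop :=
  forall a b, 0 <= a -> 0 <= b -> forall eps, 0 < eps -> exists eta, 0 < eta /\
    forall a' b', 0 <= a' -> 0 <= b' -> Rabs (a' - a) + Rabs (b' - b) < eta ->
      Rabs (f a' b' - f a b) < eps.

Lemma finite_eta (P : nat -> R -> Prop) n :
  (forall k r r', P k r -> 0 < r' <= r -> P k r') ->
  (forall k, (k < n)%nat -> exists r, 0 < r /\ P k r) ->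
  exists r, 0 < r /\ forall k, (k < n)%nat -> P k r.
Proof.
  intros Hdec. induction n as [|n IH]; intros H; [exists 1; split; [lra|lia]|].
  destruct IH as (r1 & Hr1 & H1); [intros; apply H; lia|].
  destruct (H n) as (r2 & Hr2 & H2); [lia|].
  exists (Rmin r1 r2); split; [now apply Rmin_glb_lt|]. intros k Hk.
  assert (0 < Rmin r1 r2) by now apply Rmin_glb_lt.
  destruct (Nat.eq_dec k n) as [->|].
  - apply (Hdec n r2); auto. split; auto. apply Rmin_r.
  - apply (Hdec k r1); [apply H1; lia|]. split; auto. apply Rmin_l.
Qed.

(** Only products of branches through the base point matter nearby. On these the distance is that of
    the coordinates, and finitely many radii have a common lower bound. *)
Lemma contJ2_lift G : vertex_compatible G ->
  (forall j i, (j < N)%nat -> (i < N)%nat -> continuous_on_quadrant (G j i)) ->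
  contJ2 N e (lift G).
Proof.
  intros Hvc HG y x Hy Hx eps Heps.
  (* On a branch that does not contain the base point, a small eta makes the claim void. *)
  assert (Hpt : forall z k, inJ N e z -> (k < N)%nat ->
    (exists s, 0 <= s /\ z = smul s (e k)) \/
    (exists r, 0 < r /\ forall s', 0 <= s' -> r <= dJ N e z (smul s' (e k)))).
  { intros z k Hz Hk. destruct (inJ_cases z Hz) as (j & s & Hj & [Hs| <-] & ->).
    - destruct (Nat.eq_dec j k) as [->|Hjk]; [left; exists s; split; auto; lra|].
      right; exists s; split; auto. intros; now apply dJ_branch_ge.
    - left; exists 0; split; [lra|]. now rewrite !smul_0. }
  assert (dJ_pos : forall z z', inJ N e z -> inJ N e z' -> 0 <= dJ N e z z').
  { intros z z' Hz Hz'. unfold dJ. destruct excluded_middle_informative; [apply sqrt_pos|].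
    assert (0 <= pnorm z) by apply sqrt_pos. assert (0 <= pnorm z') by apply sqrt_pos. lra. }
  set (P := fun j i r => forall s' t', 0 <= s' -> 0 <= t' ->
    dJ N e y (smul s' (e j)) + dJ N e x (smul t' (e i)) < r ->
    Rabs (lift G (smul s' (e j)) (smul t' (e i)) - lift G y x) < eps).
  assert (HP : forall j i, (j < N)%nat -> (i < N)%nat -> exists r, 0 < r /\ P j i r).
  { intros j i Hj Hi.
    destruct (Hpt y j Hy Hj) as [(s & Hs & Ey)|(r & Hr & Hf)].
    2:{ exists r; split; auto. intros s' t' Hs' Ht' Hd. specialize (Hf s' Hs').
        assert (K := dJ_pos x (smul t' (e i)) Hx (inJ_branch i t' Hi Ht')). lra. }
    destruct (Hpt x i Hx Hi) as [(t & Ht & Ex)|(r & Hr & Hf)].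
    2:{ exists r; split; auto. intros s' t' Hs' Ht' Hd. specialize (Hf t' Ht').
        assert (K := dJ_pos y (smul s' (e j)) Hy (inJ_branch j s' Hj Hs')). lra. }
    destruct (HG j i Hj Hi s t Hs Ht eps Heps) as (eta & Heta & Hc).
    exists eta; split; auto. intros s' t' Hs' Ht' Hd. subst y x.
    rewrite !dJ_branch_same in Hd by auto. rewrite !lift_branch by auto. auto. }
  destruct (finite_eta (fun j r => forall i, (i < N)%nat -> P j i r) N) as (r & Hr & H).
  { intros j r r' H Hr i Hi s' t' Hs' Ht' Hd. apply (H i Hi); auto; lra. }
  { intros j Hj. apply (finite_eta (fun i r => P j i r)); auto.
    intros i r r' H Hr s' t' Hs' Ht' Hd. apply H; auto; lra. }
  exists r; split; auto. intros y' x' Hy' Hx' Hd.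
  destruct (inJ_cases y' Hy') as (j & s & Hj & Hs & ->).
  destruct (inJ_cases x' Hx') as (i & t & Hi & Ht & ->). now apply (H j Hj i Hi).
Qed.

Lemma C1Q_continuous f f1 f2 : C1Q f f1 f2 -> continuous_on_quadrant f.
Proof.
  intros [H _] a b Ha Hb eps Heps.
  destruct (H a b Ha Hb 1 Rlt_0_1) as (eta & Heta & H1).
  set (m := 1 + Rabs (f1 a b) + Rabs (f2 a b)).
  assert (P1 := Rabs_pos (f1 a b)). assert (P2 := Rabs_pos (f2 a b)).
  assert (Hm : 0 < m) by (unfold m; lra).
  exists (Rmin eta (eps / m)); split; [apply Rmin_glb_lt; auto; now apply Rdiv_lt_0_compat|].
  intros a' b' Ha' Hb' Hd.
  assert (L1' := Rmin_l eta (eps / m)). assert (L2' := Rmin_r eta (eps / m)).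
  specialize (H1 (a' - a) (b' - b)).
  replace (a + (a' - a)) with a' in H1 by lra. replace (b + (b' - b)) with b' in H1 by lra.
  specialize (H1 Ha' Hb' ltac:(lra)).
  set (h := a' - a) in *. set (k := b' - b) in *.
  replace (f a' b' - f a b) with ((f a' b' - f a b - f1 a b * h - f2 a b * k) + (f1 a b * h + f2 a b * k)) by lra.
  eapply Rle_lt_trans; [apply Rabs_triang|].
  assert (K : Rabs (f1 a b * h + f2 a b * k) <= Rabs (f1 a b) * Rabs h + Rabs (f2 a b) * Rabs k).
  { eapply Rle_trans; [apply Rabs_triang|]. rewrite !Rabs_mult. lra. }
  assert (Q1 := Rabs_pos h). assert (Q2 := Rabs_pos k).
  assert (Hs : m * (Rabs h + Rabs k) < eps).
  { apply Rlt_le_trans with (m * (eps / m)); [apply Rmult_lt_compat_l; lra|].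
    right; field; lra. }
  unfold m in Hs. nra.
Qed.

Lemma C1Q_ext f f' f1 f2 : (forall a b, 0 <= a -> 0 <= b -> f a b = f' a b) ->
  C1Q f f1 f2 -> C1Q f' f1 f2.
Proof.
  intros He [H1 H2]; split; auto. intros a b Ha Hb eps Heps.
  destruct (H1 a b Ha Hb eps Heps) as (eta & Heta & H). exists eta; split; auto.
  intros h k Hh Hk Hd. rewrite <- !He by auto. auto.
Qed.

Lemma C1star_lift G D1 D2 : vertex_compatible G ->
  (forall j i, (j < N)%nat -> (i < N)%nat -> C1Q (G j i) (D1 j i) (D2 j i)) ->
  C1star N e (lift G) D2 D1.
Proof.
  intros Hvc H; split.
  - apply contJ2_lift; auto. intros; eapply C1Q_continuous; eauto.
  - intros j i Hj Hi. apply C1Q_ext with (G j i); auto.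
    intros; symmetry; now apply lift_branch.
Qed.

(** * The cost through the vertex as a maximum over energies *)

Definition vlag : R := L0 N L 0.
Definition uin (j : nat) : R -> R := speed (fun q => L j (- q)) (fun q => - L1 j (- q)).
Definition wout (i : nat) : R -> R := speed (L i) (L1 i).
Definition slin (j : nat) : R -> R := slope (fun q => L j (- q)) (fun q => - L1 j (- q)).
Definition slout (i : nat) : R -> R := slope (L i) (L1 i).
Definition lev (j i : nat) : R -> R -> R := level (- vlag) (uin j) (wout i).
Definition Gam (j i : nat) (s r : R) : R :=
  s * slin j (lev j i s r) + r * slout i (lev j i s r) - lev j i s r.

Lemma L0_le p k : (k < N)%nat -> L0 N L p <= L k p.
Proof. intros Hk. apply (bigmin_le (N - 1) (fun j => L j p)). lia. Qed.

Lemma L0_attained p : exists k, (k < N)%nat /\ L0 N L p = L k p.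
Proof.
  destruct (bigmin_attained (N - 1) (fun j => L j p)) as (k & Hk & E).
  exists k; split; auto. assert (K := jn_pos _ _ _ _ _ HJ). lia.
Qed.

Lemma vlag_le k : (k < N)%nat -> - L k 0 <= - vlag.
Proof. intros Hk. assert (K := L0_le 0 k Hk). unfold vlag; lra. Qed.

Lemma vlag_le_reflect k : (k < N)%nat -> - L k (- 0) <= - vlag.
Proof. rewrite Ropp_0; apply vlag_le. Qed.

Lemma conv_out k : (k < N)%nat -> strconv g (L k) (L1 k).
Proof. apply (jn_conv _ _ _ _ _ HJ). Qed.

Lemma conv_in k : (k < N)%nat -> strconv g (fun q => L k (- q)) (fun q => - L1 k (- q)).
Proof. intros; now apply strconv_reflect, conv_out. Qed.

Lemma uin_speedlike j : (j < N)%nat -> speedlike (- vlag) (uin j).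
Proof. intros Hj. apply (speed_speedlike g); [now apply conv_in|now apply vlag_le_reflect]. Qed.

Lemma wout_speedlike j : (j < N)%nat -> speedlike (- vlag) (wout j).
Proof. intros Hj. apply (speed_speedlike g); [now apply conv_out|now apply vlag_le]. Qed.

Lemma lev_spec j i s r : (j < N)%nat -> (i < N)%nat -> 0 <= s -> 0 <= r ->
  is_level (- vlag) (uin j) (wout i) s r (lev j i s r).
Proof. intros; apply level_spec; auto using uin_speedlike, wout_speedlike. Qed.

Lemma lev_ge j i s r : (j < N)%nat -> (i < N)%nat -> 0 <= s -> 0 <= r -> - vlag <= lev j i s r.
Proof. intros; now apply lev_spec. Qed.

Lemma lev_indep_left j j' i r : (j < N)%nat -> (j' < N)%nat -> (i < N)%nat -> 0 <= r ->
  lev j i 0 r = lev j' i 0 r.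
Proof. intros; apply level_indep_left; auto using uin_speedlike, wout_speedlike. Qed.

Lemma lev_indep_right j i i' s : (j < N)%nat -> (i < N)%nat -> (i' < N)%nat -> 0 <= s ->
  lev j i s 0 = lev j i' s 0.
Proof. intros; apply level_indep_right; auto using uin_speedlike, wout_speedlike. Qed.

Lemma Gam_compatible : vertex_compatible Gam.
Proof.
  split; intros.
  - unfold Gam. rewrite (lev_indep_left j j') by auto. lra.
  - unfold Gam. rewrite (lev_indep_right j i i') by auto. lra.
Qed.

Lemma slin_support j k p : (j < N)%nat -> - vlag <= k -> - slin j k * p - k <= L j p.
Proof.
  intros Hj Hk.
  assert (K := slope_support g (- vlag) _ _ (conv_in j Hj) (vlag_le_reflect j Hj) k (- p) Hk).
  cbv beta in K. rewrite Ropp_involutive in K. fold (slin j k) in K. lra.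
Qed.

Lemma slout_support i k p : (i < N)%nat -> - vlag <= k -> slout i k * p - k <= L i p.
Proof. intros Hi Hk. apply (slope_support g (- vlag)); auto using conv_out, vlag_le. Qed.

(** By concavity of the slopes, passing from the level m to k gains at most T (k - m), where T is
    the moving time at m. This is at most k - m: either T = 1, or m is the bottom level, where k >=
    m and T <= 1. *)
Lemma Gam_max j i s r k : (j < N)%nat -> (i < N)%nat -> 0 <= s -> 0 <= r -> - vlag <= k ->
  s * slin j k + r * slout i k - k <= Gam j i s r.
Proof.
  intros Hj Hi Hs Hr Hk. unfold Gam.
  destruct (lev_spec j i s r Hj Hi Hs Hr) as (H1 & H2 & H3 & H4 & H5).
  set (m := lev j i s r) in *.
  assert (K1 : s * (slin j k - slin j m) <= s / uin j m * (k - m)).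
  { destruct Hs as [Hs| <-]; [|unfold Rdiv; lra]. specialize (H2 Hs).
    assert (K := slope_concave g (- vlag) _ _ (conv_in j Hj) (vlag_le_reflect j Hj) m k H1 Hk).
    fold (slin j) (uin j) in K.
    replace (s * (slin j k - slin j m)) with (s / uin j m * (uin j m * (slin j k - slin j m)))
      by (field; lra).
    apply Rmult_le_compat_l; auto. apply div_nonneg; lra. }
  assert (K2 : r * (slout i k - slout i m) <= r / wout i m * (k - m)).
  { destruct Hr as [Hr| <-]; [|unfold Rdiv; lra]. specialize (H3 Hr).
    assert (K := slope_concave g (- vlag) _ _ (conv_out i Hi) (vlag_le i Hi) m k H1 Hk).
    fold (slout i) (wout i) in K.
    replace (r * (slout i k - slout i m)) with (r / wout i m * (wout i m * (slout i k - slout i m)))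
      by (field; lra).
    apply Rmult_le_compat_l; auto. apply div_nonneg; lra. }
  assert (K3 : (s / uin j m + r / wout i m) * (k - m) <= k - m).
  { destruct H5 as [H5|H5]; [|rewrite H5; lra].
    rewrite <- (Rmult_1_l (k - m)) at 2. apply Rmult_le_compat_r; lra. }
  lra.
Qed.

Lemma slin_lev_continuous j i : (j < N)%nat -> (i < N)%nat ->
  continuous_on_quadrant (fun s r => slin j (lev j i s r)).
Proof.
  intros Hj Hi a b Ha Hb eps Heps.
  destruct (slope_cont g (- vlag) _ _ (conv_in j Hj) (vlag_le_reflect j Hj) (lev j i a b)
    (lev_ge j i a b Hj Hi Ha Hb) eps Heps) as (e1 & He1 & H1).
  destruct (level_continuous (- vlag) (uin j) (wout i) (uin_speedlike j Hj) (wout_speedlike i Hi)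
    a b e1 Ha Hb He1) as (e2 & He2 & H2).
  exists e2; split; auto. intros. apply H1; [now apply lev_ge|]. now apply H2.
Qed.

Lemma slout_lev_continuous j i : (j < N)%nat -> (i < N)%nat ->
  continuous_on_quadrant (fun s r => slout i (lev j i s r)).
Proof.
  intros Hj Hi a b Ha Hb eps Heps.
  destruct (slope_cont g (- vlag) _ _ (conv_out i Hi) (vlag_le i Hi) (lev j i a b)
    (lev_ge j i a b Hj Hi Ha Hb) eps Heps) as (e1 & He1 & H1).
  destruct (level_continuous (- vlag) (uin j) (wout i) (uin_speedlike j Hj) (wout_speedlike i Hi)
    a b e1 Ha Hb He1) as (e2 & He2 & H2).
  exists e2; split; auto. intros. apply H1; [now apply lev_ge|]. now apply H2.
Qed.

(* Envelope argument: [Gam] is a supremum of functions that are affine in (s, r), and its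
   maximizer depends continuously on (s, r). *)
Lemma Gam_C1Q j i : (j < N)%nat -> (i < N)%nat ->
  C1Q (Gam j i) (fun s r => slin j (lev j i s r)) (fun s r => slout i (lev j i s r)).
Proof.
  intros Hj Hi.
  assert (C1 := slin_lev_continuous j i Hj Hi). assert (C2 := slout_lev_continuous j i Hj Hi).
  assert (C : forall a b, 0 <= a -> 0 <= b -> forall eps, 0 < eps -> exists eta, 0 < eta /\
    forall a' b', 0 <= a' -> 0 <= b' -> Rabs (a' - a) + Rabs (b' - b) < eta ->
      Rabs (slin j (lev j i a' b') - slin j (lev j i a b)) < eps /\
      Rabs (slout i (lev j i a' b') - slout i (lev j i a b)) < eps).
  { intros a b Ha Hb eps Heps.
    destruct (C1 a b Ha Hb eps Heps) as (e1 & He1 & H1).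
    destruct (C2 a b Ha Hb eps Heps) as (e2 & He2 & H2).
    exists (Rmin e1 e2); split; [now apply Rmin_glb_lt|]. intros a' b' Ha' Hb' Hd.
    assert (K1 := Rmin_l e1 e2). assert (K2 := Rmin_r e1 e2).
    split; [apply H1|apply H2]; auto; lra. }
  split; auto. intros a b Ha Hb eps Heps.
  destruct (C a b Ha Hb eps Heps) as (eta & Heta & H). exists eta; split; auto.
  intros h k Hh Hk Hd.
  destruct (H (a + h) (b + k) Hh Hk) as [D1 D2].
  { replace (a + h - a) with h by lra. replace (b + k - b) with k by lra. auto. }
  assert (M1 := Gam_max j i (a + h) (b + k) (lev j i a b) Hj Hi Hh Hk (lev_ge j i a b Hj Hi Ha Hb)).
  assert (M2 := Gam_max j i a b (lev j i (a + h) (b + k)) Hj Hi Ha Hb (lev_ge j i _ _ Hj Hi Hh Hk)).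
  assert (Q1 := Rabs_pos h). assert (Q2 := Rabs_pos k).
  set (A := slin j (lev j i a b)) in *. set (B := slout i (lev j i a b)) in *.
  set (A' := slin j (lev j i (a + h) (b + k))) in *. set (B' := slout i (lev j i (a + h) (b + k))) in *.
  assert (E1 : Gam j i a b = a * A + b * B - lev j i a b) by reflexivity.
  assert (E2 : Gam j i (a + h) (b + k) = (a + h) * A' + (b + k) * B' - lev j i (a + h) (b + k)) by reflexivity.
  assert (S1 : (A' - A) * h <= eps * Rabs h).
  { eapply Rle_trans; [apply Rle_abs|]. rewrite Rabs_mult. apply Rmult_le_compat_r; lra. }
  assert (S2 : (B' - B) * k <= eps * Rabs k).
  { eapply Rle_trans; [apply Rle_abs|]. rewrite Rabs_mult. apply Rmult_le_compat_r; lra. }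
  apply Rabs_le. assert (0 <= eps * Rabs h) by nra. assert (0 <= eps * Rabs k) by nra. lra.
Qed.

(** When one distance is zero, [Gam] reduces to a single tangent evaluated at r - s. *)
Lemma Gam_le_direct j s r : (j < N)%nat -> 0 <= s -> 0 <= r -> s = 0 \/ r = 0 ->
  Gam j j s r <= L j (r - s).
Proof.
  intros Hj Hs Hr H. unfold Gam.
  assert (K1 := slin_support j (lev j j s r) (r - s) Hj (lev_ge j j s r Hj Hj Hs Hr)).
  assert (K2 := slout_support j (lev j j s r) (r - s) Hj (lev_ge j j s r Hj Hj Hs Hr)).
  destruct H as [-> | ->]; lra.
Qed.

End Junction.

(** * Lower bound for the action *)

Lemma continuity_clamp (F : R -> R) :
  (forall t eps, 0 <= t <= 1 -> 0 < eps -> exists eta, 0 < eta /\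
     forall t', 0 <= t' <= 1 -> Rabs (t' - t) < eta -> Rabs (F t' - F t) < eps) ->
  continuity (fun t => F (Rmax 0 (Rmin 1 t))).
Proof.
  intros H x. apply continuity_pt_eps. intros eps Heps.
  assert (Hin : forall t, 0 <= Rmax 0 (Rmin 1 t) <= 1)
    by (intros t; unfold Rmax, Rmin; repeat destruct Rle_dec; lra).
  destruct (H (Rmax 0 (Rmin 1 x)) eps (Hin x) Heps) as (eta & Heta & H1).
  exists eta; split; auto. intros y Hy. apply H1; auto.
  eapply Rle_lt_trans; [|exact Hy].
  unfold Rmax, Rmin, Rabs; repeat destruct Rle_dec; repeat destruct Rcase_abs; lra.
Qed.

Section Trajectory.
Context {N : nat} {e : nat -> pt} {L L1 : nat -> R -> R} {g : R} (HJ : junction N e L L1 g).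

Lemma dot_gap j : (j < N)%nat ->
  exists th, th < 1 /\ forall k, (k < N)%nat -> k <> j -> dot (e k) (e j) < th.
Proof.
  intros Hj.
  assert (H : forall n, (n <= N)%nat -> exists th, th < 1 /\
    forall k, (k < n)%nat -> k <> j -> dot (e k) (e j) <= th).
  { induction n as [|n IH]; intros Hn; [exists 0; split; [lra|lia]|].
    destruct IH as (th & Hth & H); [lia|].
    destruct (Nat.eq_dec n j) as [->|Hnj].
    - exists th; split; auto. intros k Hk Hkj. apply H; lia.
    - exists (Rmax th (dot (e n) (e j))). split.
      + apply Rmax_lub_lt; auto. apply (dot_off HJ); lia.
      + intros k Hk Hkj. destruct (Nat.eq_dec k n) as [->|]; [apply Rmax_r|].
        eapply Rle_trans; [apply H; lia|apply Rmax_l]. }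
  destruct (H N (le_n N)) as (th & Hth & H1). exists ((1 + th) / 2); split; [lra|].
  intros k Hk Hkj. specialize (H1 k Hk Hkj). lra.
Qed.

(** The variation of a path is measured coordinate by coordinate, so the speed along a branch must
    be bounded in the same terms. *)
Lemma abs_coord_dot i p : (i < N)%nat ->
  Rabs p <= Rabs (fst (smul p (e i))) + Rabs (snd (smul p (e i))).
Proof.
  intros Hi. assert (K := dot_diag HJ i Hi). destruct (e i) as [a b]; unfold dot in K; simpl in *.
  rewrite !Rabs_mult. assert (Q := Rabs_pos p).
  assert (1 <= Rabs a + Rabs b); [|nra].
  assert (Rabs a * Rabs a = a * a) by (rewrite <- Rabs_mult; apply Rabs_right; nra).
  assert (Rabs b * Rabs b = b * b) by (rewrite <- Rabs_mult; apply Rabs_right; nra).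
  assert (A := Rabs_pos a). assert (B := Rabs_pos b). nra.
Qed.

(** * One admissible path, cut at its passages through the vertex *)

Section Path.
Context (X v : R -> pt) (ell : R -> R) (A1 A2 P : R -> R) (E : R -> Prop).
Context (HX1 : HKprim (fun t => fst (v t)) (fun t => fst (X t))).
Context (HX2 : HKprim (fun t => snd (v t)) (fun t => snd (X t))).
Context (HA1 : HKprim (fun t => Rabs (fst (v t))) A1).
Context (HA2 : HKprim (fun t => Rabs (snd (v t))) A2).
Context (HP : HKprim ell P).
Context (HE : null E).
Context (Hlag : forall t, 0 <= t <= 1 -> ~ E t -> LagRel N e L (X t) (v t) (ell t)).
Context (HXJ : forall t, 0 <= t <= 1 -> inJ N e (X t)).

Lemma path_zero_closed t : 0 <= t <= 1 -> X t <> pt0 -> exists eta, 0 < eta /\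
  forall t', 0 <= t' <= 1 -> Rabs (t' - t) < eta -> X t' <> pt0.
Proof.
  intros Ht Hn.
  assert (Hor : fst (X t) <> 0 \/ snd (X t) <> 0).
  { apply NNPP; intros H. apply Hn. destruct (X t) as [a b]; simpl in *. unfold pt0.
    f_equal; apply NNPP; intros Hc; apply H; auto. }
  destruct Hor as [H|H].
  - destruct (HKprim_continuous _ _ t (Rabs (fst (X t))) HX1 Ht) as (eta & Heta & Hc);
      [now apply Rabs_pos_lt|].
    exists eta; split; auto. intros t' Ht' Hd E0. specialize (Hc t' Ht' Hd). cbv beta in Hc.
    rewrite E0 in Hc; simpl in Hc. rewrite Rminus_0_l, Rabs_Ropp in Hc. lra.
  - destruct (HKprim_continuous _ _ t (Rabs (snd (X t))) HX2 Ht) as (eta & Heta & Hc);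
      [now apply Rabs_pos_lt|].
    exists eta; split; auto. intros t' Ht' Hd E0. specialize (Hc t' Ht' Hd). cbv beta in Hc.
    rewrite E0 in Hc; simpl in Hc. rewrite Rminus_0_l, Rabs_Ropp in Hc. lra.
Qed.

Lemma path_first_zero a b : 0 <= a -> a <= b -> b <= 1 ->
  (exists t, a <= t <= b /\ X t = pt0) ->
  exists z, a <= z <= b /\ X z = pt0 /\ forall t, a <= t < z -> X t <> pt0.
Proof.
  intros Ha Hab Hb (t0 & Ht0 & E0).
  set (S := fun x => a <= x <= b /\ forall t, a <= t < x -> X t <> pt0).
  destruct (completeness S) as [z [Hub Hlub]].
  { exists b; intros x [Hx _]; lra. }
  { exists a; split; [lra|]. intros; lra. }
  assert (Hz : a <= z <= b).
  { split; [apply Hub; split; [lra|intros; lra]|]. apply Hlub; intros x [Hx _]; lra. }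
  assert (Hbefore : forall t, a <= t < z -> X t <> pt0).
  { intros t Ht E1. assert (z <= t); [|lra]. apply Hlub. intros x [Hx Hx2].
    apply Rnot_lt_le; intros Hlt. apply (Hx2 t); auto; lra. }
  exists z; split; [auto|split; auto].
  apply NNPP; intros Hn. destruct (path_zero_closed z) as (eta & Heta & Hc); [lra|auto|].
  assert (Hzt : z < t0).
  { apply Rnot_le_lt; intros Hle. destruct Hle as [Hlt| ->]; [|auto].
    apply (Hbefore t0); auto; lra. }
  assert (Hz2 : S (Rmin t0 (z + eta / 2))).
  { assert (K1 := Rmin_l t0 (z + eta / 2)). assert (K2 := Rmin_r t0 (z + eta / 2)).
    assert (K3 : z < Rmin t0 (z + eta / 2)) by (apply Rmin_glb_lt; lra).
    split; [lra|]. intros t Ht. destruct (Rlt_le_dec t z) as [Hlt|Hle]; [apply Hbefore; lra|].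
    apply Hc; [lra|]. rewrite Rabs_right; lra. }
  apply Hub in Hz2. assert (K3 : z < Rmin t0 (z + eta / 2)) by (apply Rmin_glb_lt; lra). lra.
Qed.

Lemma path_last_zero a b : 0 <= a -> a <= b -> b <= 1 ->
  (exists t, a <= t <= b /\ X t = pt0) ->
  exists z, a <= z <= b /\ X z = pt0 /\ forall t, z < t <= b -> X t <> pt0.
Proof.
  intros Ha Hab Hb (t0 & Ht0 & E0).
  set (S := fun x => a <= x <= b /\ X x = pt0).
  destruct (completeness S) as [z [Hub Hlub]].
  { exists b; intros x [Hx _]; lra. }
  { now exists t0. }
  assert (Hz : a <= z <= b).
  { split; [apply Rle_trans with t0; [lra|now apply Hub]|]. apply Hlub; intros x [Hx _]; lra. }
  exists z; split; [auto|split].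
  - apply NNPP; intros Hn. destruct (path_zero_closed z) as (eta & Heta & Hc); [lra|auto|].
    assert (z <= z - eta); [|lra]. apply Hlub. intros x [Hx Hx0].
    apply Rnot_lt_le; intros Hlt. apply (Hc x); auto; [lra|].
    assert (x <= z) by (apply Hub; split; auto). rewrite Rabs_left1; lra.
  - intros t Ht E1. assert (t <= z); [|lra]. apply Hub; split; auto; lra.
Qed.

(* The sign of [<X, e_j> - th |X|] separates branch j from the others. *)
Lemma path_same_branch t1 t2 j : 0 <= t1 <= 1 -> 0 <= t2 <= 1 -> (j < N)%nat ->
  (forall t, Rmin t1 t2 <= t <= Rmax t1 t2 -> X t <> pt0) ->
  onbranch e j (X t1) -> onbranch e j (X t2).
Proof.
  intros Ht1 Ht2 Hj Hn (s1 & Hs1 & E1).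
  assert (HR : t1 <= Rmax t1 t2 /\ t2 <= Rmax t1 t2 /\ Rmin t1 t2 <= t1 /\ Rmin t1 t2 <= t2)
    by (unfold Rmax, Rmin; repeat destruct Rle_dec; lra).
  destruct (inJ_cases _ (HXJ t2 Ht2)) as (k & s2 & Hk & Hs2 & E2).
  destruct (Nat.eq_dec k j) as [->|Hkj]; [now exists s2|exfalso].
  assert (P1 : 0 < s1).
  { destruct Hs1 as [Hs1| <-]; auto. exfalso; apply (Hn t1); [lra|]. now rewrite E1, smul_0. }
  assert (P2 : 0 < s2).
  { destruct Hs2 as [Hs2| <-]; auto. exfalso; apply (Hn t2); [lra|]. now rewrite E2, smul_0. }
  destruct (dot_gap j Hj) as (th & Hth & Hgap).
  set (F := fun x : pt => dot x (e j) - th * pnorm x).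
  set (psi := fun t => F (X (Rmax 0 (Rmin 1 t)))).
  assert (HF : forall i s, (i < N)%nat -> 0 <= s -> F (smul s (e i)) = s * (dot (e i) (e j) - th)).
  { intros i s Hi Hs. unfold F. rewrite (pnorm_branch HJ) by auto.
    rewrite dot_smul_l. ring. }
  assert (Hcl : forall t, 0 <= t <= 1 -> Rmax 0 (Rmin 1 t) = t).
  { intros t Ht; unfold Rmax, Rmin; repeat destruct Rle_dec; lra. }
  assert (Hpsi : continuity psi).
  { assert (C1 := continuity_clamp (fun t => fst (X t))
      (fun t eps Ht He => HKprim_continuous _ _ t eps HX1 Ht He)).
    assert (C2 := continuity_clamp (fun t => snd (X t))
      (fun t eps Ht He => HKprim_continuous _ _ t eps HX2 Ht He)).
    cbv beta in C1, C2. intros t. specialize (C1 t); specialize (C2 t). unfold psi, F, dot, pnorm.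
    set (f1 := fun t => fst (X (Rmax 0 (Rmin 1 t)))) in *.
    set (f2 := fun t => snd (X (Rmax 0 (Rmin 1 t)))) in *.
    change (continuity_pt (fun t => (f1 t * fst (e j) + f2 t * snd (e j))
      - th * sqrt (f1 t * f1 t + f2 t * f2 t)) t).
    assert (Cc : forall c, continuity_pt (fun _ : R => c) t)
      by (intros c; apply continuity_pt_const; intros ? ?; reflexivity).
    apply (continuity_pt_minus (fun t => f1 t * fst (e j) + f2 t * snd (e j))).
    - apply (continuity_pt_plus (fun t => f1 t * fst (e j)));
        [apply (continuity_pt_mult f1 (fun _ => fst (e j)))|apply (continuity_pt_mult f2 (fun _ => snd (e j)))]; auto.
    - apply (continuity_pt_mult (fun _ => th)); auto.
      apply (continuity_pt_comp (fun t => f1 t * f1 t + f2 t * f2 t) sqrt).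
      + apply (continuity_pt_plus (fun t => f1 t * f1 t)); now apply continuity_pt_mult.
      + apply continuity_pt_sqrt. nra. }
  assert (V1 : 0 < psi t1).
  { unfold psi. rewrite Hcl, E1, HF, (dot_diag HJ) by auto. nra. }
  assert (V2 : psi t2 < 0).
  { unfold psi. rewrite Hcl, E2, HF by auto. specialize (Hgap k Hk Hkj). nra. }
  destruct (IVT_cor psi (Rmin t1 t2) (Rmax t1 t2) Hpsi) as (t & Ht & Et).
  { unfold Rmax, Rmin; repeat destruct Rle_dec; lra. }
  { unfold Rmax, Rmin; repeat destruct Rle_dec; nra. }
  assert (Ht01 : 0 <= t <= 1) by (unfold Rmax, Rmin in Ht; repeat destruct Rle_dec; lra).
  unfold psi in Et. rewrite Hcl in Et by auto. apply (Hn t Ht).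
  destruct (inJ_cases _ (HXJ t Ht01)) as (i & s & Hi & Hs & E3).
  rewrite E3 in Et |- *. rewrite HF in Et by auto.
  apply Rmult_integral in Et as [->|Et]; [apply smul_0|].
  destruct (Nat.eq_dec i j) as [->|Hij].
  - rewrite (dot_diag HJ) in Et by auto. lra.
  - specialize (Hgap i Hi Hij). lra.
Qed.

(** The branch is constant inside; an endpoint at the vertex lies on every branch, so the closed
    interval is allowed. *)
Lemma path_open_branch a b : 0 <= a -> a < b -> b <= 1 -> (forall t, a < t < b -> X t <> pt0) ->
  exists j, (j < N)%nat /\ forall t, a <= t <= b -> onbranch e j (X t).
Proof.
  intros Ha Hab Hb Hn. set (m := (a + b) / 2). assert (Hm : a < m < b) by (unfold m; lra).
  destruct (HXJ m ltac:(lra)) as (j & Hj & Hjm). exists j; split; auto.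
  intros t Ht. destruct (classic (X t = pt0)) as [E0|E0].
  { exists 0; split; [lra|]. now rewrite smul_0. }
  apply (path_same_branch m t j); auto; try lra.
  intros t' Ht'. destruct (Req_dec t' t) as [->|Hne]; auto.
  apply Hn. unfold Rmin, Rmax in Ht'; repeat destruct Rle_dec; lra.
Qed.

(** The tangent bound L_j(p) >= m p - k is integrated; the velocity along the branch is recovered as
    the scalar product with the unit vector [e j]. *)
Lemma path_branch_lower a b j m k ra rb : 0 <= a -> a <= b -> b <= 1 -> (j < N)%nat ->
  (forall p, m * p - k <= L j p) ->
  (forall t, a < t < b -> onbranch e j (X t) /\ X t <> pt0) ->
  X a = smul ra (e j) -> X b = smul rb (e j) ->
  m * (rb - ra) - k * (b - a) <= P b - P a.
Proof.
  intros Ha Hab Hb Hj Hm Hbr Ea Eb.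
  set (G := fun t => P t + (- m * (fst (e j) * fst (X t) + snd (e j) * snd (X t)) + k * t)).
  assert (HG : HKprim (fun t => ell t + (- m * (fst (e j) * fst (v t) + snd (e j) * snd (v t)) + k)) G).
  { unfold G. apply HKprim_plus; auto. apply HKprim_plus; [|apply HKprim_const].
    apply HKprim_scal, HKprim_plus; now apply HKprim_scal. }
  assert (K : G a <= G b).
  { apply (HKprim_nondecreasing_ae _ G E a b HG HE Ha Hab Hb). intros t Ht HEt.
    destruct (Hbr t Ht) as [(s & Hs & Es) Hnz].
    destruct (Hlag t ltac:(lra) HEt) as [[E0 _]|(i & s' & p & Hi & Hs' & E1 & E2 & E3)]; [contradiction|].
    assert (i = j). { eapply (branch_index HJ); [| | | |rewrite <- E1; exact Es]; auto. } subst i.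
    rewrite E2, E3. specialize (Hm p). assert (D := dot_diag HJ j Hj). unfold dot in D.
    destruct (e j) as [x y]; simpl in *.
    replace (x * (p * x) + y * (p * y)) with (p * (x * x + y * y)) by ring. rewrite D. lra. }
  unfold G in K. rewrite Ea, Eb in K. assert (D := dot_diag HJ j Hj). unfold dot in D.
  destruct (e j) as [x y]; simpl in *.
  replace (x * (ra * x) + y * (ra * y)) with (ra * (x * x + y * y)) in K by ring.
  replace (x * (rb * x) + y * (rb * y)) with (rb * (x * x + y * y)) in K by ring.
  rewrite D in K. lra.
Qed.

(** The tangent at velocity 0 makes an excursion on branch j cost at least L_j(0) per unit time plus
    the change of this potential. It vanishes at the vertex, so it contributes nothing between two
    passages. *)
Definition pot (x : pt) : R := L1 (br (N := N) (e := e) x) 0 * pnorm x.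

Lemma pot_branch j s : (j < N)%nat -> 0 <= s -> pot (smul s (e j)) = L1 j 0 * s.
Proof.
  intros Hj [Hs| <-]; unfold pot.
  - rewrite (br_branch HJ), (pnorm_branch HJ); auto; lra.
  - rewrite smul_0, pnorm_0. lra.
Qed.

Lemma pot_0 : pot pt0 = 0.
Proof. unfold pot. rewrite pnorm_0. lra. Qed.

Lemma tangent_at_0 j p : (j < N)%nat -> L1 j 0 * p + L j 0 <= L j p.
Proof.
  intros Hj. assert (K := sc_low _ _ _ (conv_out HJ j Hj) 0 p).
  assert (K2 := sc_sq_nonneg _ _ _ (conv_out HJ j Hj) (p - 0)). lra.
Qed.

Lemma path_excursion_lower a b : 0 <= a -> a <= b -> b <= 1 -> (forall t, a < t < b -> X t <> pt0) ->
  L0 N L 0 * (b - a) + (pot (X b) - pot (X a)) <= P b - P a.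
Proof.
  intros Ha [Hab| ->] Hb Hn; [|lra].
  destruct (path_open_branch a b Ha Hab Hb Hn) as (j & Hj & Hbr).
  destruct (Hbr a ltac:(lra)) as (ra & Hra & Ea). destruct (Hbr b ltac:(lra)) as (rb & Hrb & Eb).
  assert (K := path_branch_lower a b j (L1 j 0) (- L0 N L 0) ra rb Ha (Rlt_le _ _ Hab) Hb Hj).
  rewrite Ea, Eb, !pot_branch by auto.
  assert (K2 := K (fun p => ltac:(assert (K1 := tangent_at_0 j p Hj);
    assert (K3 := L0_le (L := L) 0 j Hj); lra))).
  assert (K3 := K2 (fun t Ht => conj (Hbr t ltac:(lra)) (Hn t Ht)) Ea Eb). lra.
Qed.

Lemma slope_bound : exists C, 0 <= C /\ forall k, (k < N)%nat -> Rabs (L1 k 0) <= C.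
Proof.
  assert (H : forall n, exists C, 0 <= C /\ forall k, (k < n)%nat -> Rabs (L1 k 0) <= C).
  { induction n as [|n (C & HC & H)]; [exists 0; split; [lra|lia]|].
    exists (Rmax C (Rabs (L1 n 0))); split; [eapply Rle_trans; [exact HC|apply Rmax_l]|].
    intros k Hk. destruct (Nat.eq_dec k n) as [->|]; [apply Rmax_r|].
    eapply Rle_trans; [apply H; lia|apply Rmax_l]. }
  apply H.
Qed.

(** At the vertex L_0(p) equals some L_k(p), so tangents at 0 bound the cost there too, with a loss
    at most linear in the speed. *)
Lemma path_crude_lower C a b : (forall k, (k < N)%nat -> Rabs (L1 k 0) <= C) ->
  0 <= a -> a <= b -> b <= 1 ->
  L0 N L 0 * (b - a) - C * (A1 b - A1 a + (A2 b - A2 a)) <= P b - P a.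
Proof.
  intros HC Ha Hab Hb.
  set (G := fun t => P t + (C * (A1 t + A2 t) + - L0 N L 0 * t)).
  assert (HG : HKprim (fun t => ell t + (C * (Rabs (fst (v t)) + Rabs (snd (v t))) + - L0 N L 0)) G).
  { unfold G. apply HKprim_plus; auto. apply HKprim_plus; [|apply HKprim_const].
    apply HKprim_scal, HKprim_plus; auto. }
  assert (K : G a <= G b); [|unfold G in K; lra].
  apply (HKprim_nondecreasing_ae _ G E a b HG HE Ha Hab Hb). intros t Ht HEt.
  assert (Hb2 : forall k i p, (k < N)%nat -> (i < N)%nat -> v t = smul p (e i) ->
    L0 N L 0 - C * (Rabs (fst (v t)) + Rabs (snd (v t))) <= L k p).
  { intros k i p Hk Hi Ev. assert (K1 := tangent_at_0 k p Hk).
    assert (K2 := L0_le (L := L) 0 k Hk). assert (K3 := abs_coord_dot i p Hi).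
    rewrite <- Ev in K3. assert (K4 := HC k Hk).
    assert (K5 : - (C * Rabs p) <= L1 k 0 * p).
    { assert (K6 := Rle_abs (- (L1 k 0 * p))). rewrite Rabs_Ropp, Rabs_mult in K6.
      assert (Q := Rabs_pos p). nra. }
    assert (Q := Rabs_pos (L1 k 0)).
    apply (Rmult_le_compat_l C) in K3; [|lra]. lra. }
  destruct (Hlag t ltac:(lra) HEt) as [(_ & i & p & Hi & Hp & Ev & El)|(i & s & p & Hi & Hs & _ & Ev & El)].
  - destruct (L0_attained (L := L) HJ p) as (k & Hk & E0). rewrite El, E0.
    specialize (Hb2 k i p Hk Hi Ev). lra.
  - rewrite El. specialize (Hb2 i i p Hi Hi Ev). lra.
Qed.

(* Excursions away from the vertex are handled by convexity; between the first and the
   last zero only a bound linear in the speed is available, but there the length travelled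
   is controlled by the variation that the chord from a to b misses. *)
Lemma path_local_lower C a b : 0 <= C -> (forall k, (k < N)%nat -> Rabs (L1 k 0) <= C) ->
  0 <= a -> a <= b -> b <= 1 ->
  L0 N L 0 * (b - a) + (pot (X b) - pot (X a))
    - C * (A1 b - A1 a + (A2 b - A2 a)
           - (Rabs (fst (X b) - fst (X a)) + Rabs (snd (X b) - snd (X a)))) <= P b - P a.
Proof.
  intros HC0 HC Ha Hab Hb.
  assert (HV : forall f F A u w, HKprim f F -> HKprim (fun t => Rabs (f t)) A ->
    0 <= u -> u <= w -> w <= 1 -> Rabs (F w - F u) <= A w - A u).
  { intros f F A u w HF HA Hu Huw Hw. apply Rabs_le; split.
    - assert (K := HKprim_le _ _ _ _ u w (HKprim_scal (-1) _ _ HA) HF Hu Huw Hw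
        (fun t _ => ltac:(cbv beta; unfold Rabs; destruct Rcase_abs; lra))). lra.
    - assert (K := HKprim_le _ _ _ _ u w HF HA Hu Huw Hw (fun t _ => Rle_abs _)). lra. }
  assert (V1 := fun u w => HV _ _ _ u w HX1 HA1). assert (V2 := fun u w => HV _ _ _ u w HX2 HA2).
  cbv beta in V1, V2.
  destruct (classic (exists t, a <= t <= b /\ X t = pt0)) as [Hz|Hz].
  - destruct (path_first_zero a b Ha Hab Hb Hz) as (z & Hz1 & Ez & Hbef).
    assert (Hz' : exists t, z <= t <= b /\ X t = pt0) by (exists z; split; [lra|auto]).
    destruct (path_last_zero z b ltac:(lra) ltac:(lra) Hb Hz')
      as (z' & Hz2 & Ez' & Haft).
    assert (K1 := path_excursion_lower a z Ha ltac:(lra) ltac:(lra) (fun t Ht => Hbef t ltac:(lra))).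
    assert (K2 := path_crude_lower C z z' HC ltac:(lra) ltac:(lra) ltac:(lra)).
    assert (K3 := path_excursion_lower z' b ltac:(lra) ltac:(lra) Hb (fun t Ht => Haft t ltac:(lra))).
    rewrite Ez, pot_0 in K1. rewrite Ez', pot_0 in K3.
    assert (W1 := V1 a z Ha ltac:(lra) ltac:(lra)). assert (W2 := V2 a z Ha ltac:(lra) ltac:(lra)).
    assert (W3 := V1 z' b ltac:(lra) ltac:(lra) Hb). assert (W4 := V2 z' b ltac:(lra) ltac:(lra) Hb).
    rewrite Ez in W1, W2. rewrite Ez' in W3, W4. simpl in W1, W2, W3, W4.
    rewrite Rminus_0_l, Rabs_Ropp in W1, W2. rewrite Rminus_0_r in W3, W4.
    assert (T1 : Rabs (fst (X b) - fst (X a)) <= Rabs (fst (X b)) + Rabs (fst (X a))).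
    { eapply Rle_trans; [apply Rabs_triang|]. rewrite Rabs_Ropp; lra. }
    assert (T2 : Rabs (snd (X b) - snd (X a)) <= Rabs (snd (X b)) + Rabs (snd (X a))).
    { eapply Rle_trans; [apply Rabs_triang|]. rewrite Rabs_Ropp; lra. }
    assert (C * (A1 z' - A1 z + (A2 z' - A2 z)) <= C * (A1 b - A1 a + (A2 b - A2 a)
           - (Rabs (fst (X b) - fst (X a)) + Rabs (snd (X b) - snd (X a))))).
    { apply Rmult_le_compat_l; auto. lra. }
    lra.
  - assert (K := path_excursion_lower a b Ha Hab Hb
      (fun t Ht E0 => Hz (ex_intro _ t (conj (conj (Rlt_le _ _ (proj1 Ht)) (Rlt_le _ _ (proj2 Ht))) E0)))).
    assert (W1 := V1 a b Ha Hab Hb). assert (W2 := V2 a b Ha Hab Hb).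
    assert (0 <= C * (A1 b - A1 a + (A2 b - A2 a)
           - (Rabs (fst (X b) - fst (X a)) + Rabs (snd (X b) - snd (X a))))).
    { apply Rmult_le_pos; auto. lra. }
    lra.
Qed.

(** The local bounds are summed over a fine division. Their main terms telescope, and their losses
    add up to C times the variation that the chords miss, which is arbitrarily small. *)
Lemma path_vertex_lower a b : 0 <= a -> a <= b -> b <= 1 ->
  L0 N L 0 * (b - a) + (pot (X b) - pot (X a)) <= P b - P a.
Proof.
  intros Ha Hab Hb. destruct slope_bound as (C & HC0 & HC).
  apply Rnot_lt_le; intros Hlt.
  set (gap := L0 N L 0 * (b - a) + (pot (X b) - pot (X a)) - (P b - P a)) in *.
  assert (Hgap : 0 < gap) by (unfold gap; lra).
  (* The two coordinates lose at most 2 [C] [eps] <= [gap] / 2; the added 1 covers [C] = 0. *)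
  set (eps := gap / (4 * (C + 1))).
  assert (Heps : 0 < eps) by (apply Rdiv_lt_0_compat; lra).
  destruct (variation_gauge _ _ _ eps HX1 HA1 a b Ha Hab Hb Heps) as (d1 & Hd1 & H1).
  destruct (variation_gauge _ _ _ eps HX2 HA2 a b Ha Hab Hb Heps) as (d2 & Hd2 & H2).
  destruct (cousin (fun t => Rmin (d1 t) (d2 t)) a b Hab) as (l & Hl & Hf); [now apply gauge_min|].
  apply fine_min in Hf as [Hf1 Hf2].
  specialize (H1 l Hl Hf1); specialize (H2 l Hl Hf2).
  set (S1 := tsum (fun u w _ => Rabs (fst (X w) - fst (X u))) l) in *.
  set (S2 := tsum (fun u w _ => Rabs (snd (X w) - snd (X u))) l) in *.
  set (H := fun t => L0 N L 0 * t + pot (X t) - C * (A1 t + A2 t)).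
  assert (K : H b - H a + C * (S1 + S2) <= P b - P a).
  { unfold S1, S2. rewrite <- (tsum_telescope H l _ _ Hl), <- (tsum_telescope P l _ _ Hl).
    rewrite <- tsum_plus, <- tsum_scal, <- tsum_plus. eapply tsum_le; eauto.
    intros u w t Hu Huw Hw Ht; cbv beta.
    assert (K := path_local_lower C u w HC0 HC ltac:(lra) ltac:(lra) ltac:(lra)).
    unfold H. lra. }
  unfold H in K.
  assert (C * (2 * eps) <= gap / 2).
  { replace (gap / 2) with ((C + 1) * (2 * eps)) by (unfold eps; field; lra).
    apply Rmult_le_compat_r; lra. }
  assert (C * (A1 b - A1 a + (A2 b - A2 a) - (S1 + S2)) <= C * (2 * eps)).
  { apply Rmult_le_compat_l; auto. lra. }
  unfold gap in *; lra.
Qed.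

Lemma path_lower j i s r : (j < N)%nat -> (i < N)%nat -> 0 <= s -> 0 <= r ->
  X 0 = smul s (e j) -> X 1 = smul r (e i) ->
  Gam (N := N) (L := L) (L1 := L1) j i s r <= P 1 - P 0 \/ (j = i /\ L j (r - s) <= P 1 - P 0).
Proof.
  intros Hj Hi Hs Hr E0 E1.
  destruct (classic (exists t, 0 <= t <= 1 /\ X t = pt0)) as [Hz|Hz].
  - left.
    destruct (path_first_zero 0 1 ltac:(lra) ltac:(lra) ltac:(lra) Hz) as (z & Hz1 & Ez & Hbef).
    assert (Hz' : exists t, z <= t <= 1 /\ X t = pt0) by (exists z; split; [lra|auto]).
    destruct (path_last_zero z 1 ltac:(lra) ltac:(lra) ltac:(lra) Hz')
      as (z' & Hz2 & Ez' & Haft).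
    (* A single level serves the approach, the time between the first and last passages, and the
       departure, so the terms in [k] sum to [- k] over the total time 1. In the middle, L_0(0) >= -
       [k]. *)
    set (k := lev (N := N) (L := L) (L1 := L1) j i s r).
    assert (Hk := lev_ge HJ j i s r Hj Hi Hs Hr). fold k in Hk.
    assert (K1 : s * slin (L := L) (L1 := L1) j k - k * z <= P z - P 0).
    { destruct (proj1 Hz1) as [Hz0|Hz0].
      - assert (Hn0 : X 0 <> pt0) by (apply Hbef; lra).
        destruct (path_open_branch 0 z ltac:(lra) Hz0 ltac:(lra) (fun t Ht => Hbef t ltac:(lra)))
          as (j' & Hj' & Hbr).
        assert (j = j').
        { destruct (Hbr 0 ltac:(lra)) as (s' & Hs' & E'). rewrite E0 in E'.
          assert (0 < s). { destruct Hs as [Hs| <-]; auto. exfalso; apply Hn0. now rewrite E0, smul_0. }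
          eapply (branch_index HJ); [| | | |exact E']; auto. }
        subst j'.
        assert (K := path_branch_lower 0 z j (- slin (L := L) (L1 := L1) j k) k s 0 ltac:(lra) ltac:(lra) ltac:(lra) Hj
          (fun p => slin_support HJ j k p Hj Hk)
          (fun t Ht => conj (Hbr t ltac:(lra)) (Hbef t ltac:(lra))) E0).
        rewrite smul_0 in K. specialize (K Ez). lra.
      - subst z. rewrite E0 in Ez. apply (smul_eq_0 HJ) in Ez; auto. subst s. lra. }
    assert (K3 : r * slout (L := L) (L1 := L1) i k - k * (1 - z') <= P 1 - P z').
    { destruct (proj2 Hz2) as [Hz0|Hz0].
      - assert (Hn0 : X 1 <> pt0) by (apply Haft; lra).
        destruct (path_open_branch z' 1 ltac:(lra) Hz0 ltac:(lra) (fun t Ht => Haft t ltac:(lra)))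
          as (i' & Hi' & Hbr).
        assert (i = i').
        { destruct (Hbr 1 ltac:(lra)) as (r' & Hr' & E'). rewrite E1 in E'.
          assert (0 < r). { destruct Hr as [Hr| <-]; auto. exfalso; apply Hn0. now rewrite E1, smul_0. }
          eapply (branch_index HJ); [| | | |exact E']; auto. }
        subst i'.
        assert (K := path_branch_lower z' 1 i (slout (L := L) (L1 := L1) i k) k 0 r ltac:(lra) ltac:(lra) ltac:(lra) Hi
          (fun p => slout_support HJ i k p Hi Hk)
          (fun t Ht => conj (Hbr t ltac:(lra)) (Haft t ltac:(lra)))).
        rewrite smul_0 in K. specialize (K Ez' E1). lra.
      - subst z'. rewrite E1 in Ez'. apply (smul_eq_0 HJ) in Ez'; auto. subst r. lra. }
    assert (K2 := path_vertex_lower z z' ltac:(lra) ltac:(lra) ltac:(lra)).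
    rewrite Ez, Ez', pot_0 in K2.
    assert (K4 : - k * (z' - z) <= L0 N L 0 * (z' - z)).
    { apply Rmult_le_compat_r; [lra|]. unfold vlag in Hk. lra. }
    unfold Gam. fold k. lra.
  - right.
    assert (Hnz : forall t, 0 <= t <= 1 -> X t <> pt0) by (intros t Ht E2; apply Hz; now exists t).
    destruct (path_open_branch 0 1 ltac:(lra) ltac:(lra) ltac:(lra) (fun t Ht => Hnz t ltac:(lra)))
      as (j' & Hj' & Hbr).
    destruct (Hbr 0 ltac:(lra)) as (s' & Hs' & Es). destruct (Hbr 1 ltac:(lra)) as (r' & Hr' & Er).
    assert (N0 := Hnz 0 ltac:(lra)). assert (N1 := Hnz 1 ltac:(lra)).
    rewrite E0 in Es, N0. rewrite E1 in Er, N1.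
    assert (Ps : 0 < s). { destruct Hs as [Hs| <-]; auto. exfalso; apply N0, smul_0. }
    assert (Pr : 0 < r). { destruct Hr as [Hr| <-]; auto. exfalso; apply N1, smul_0. }
    assert (j = j') by (eapply (branch_index HJ); [| | | |exact Es]; auto).
    assert (i = j') by (eapply (branch_index HJ); [| | | |exact Er]; auto).
    subst j' i. split; auto.
    (* Jensen's inequality, through the tangent of [L j] at the mean velocity. *)
    set (q := r - s).
    assert (K := path_branch_lower 0 1 j (L1 j q) (L1 j q * q - L j q) s r ltac:(lra) ltac:(lra) ltac:(lra) Hj).
    assert (K2 := K (fun p => ltac:(assert (M1 := sc_low _ _ _ (conv_out HJ j Hj) q p);
      assert (M2 := sc_sq_nonneg _ _ _ (conv_out HJ j Hj) (p - q)); lra))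
      (fun t Ht => conj (Hbr t ltac:(lra)) (Hnz t ltac:(lra))) E0 E1).
    fold q in K2. lra.
Qed.

End Path.

Lemma actions_lower j i s r I : (j < N)%nat -> (i < N)%nat -> 0 <= s -> 0 <= r ->
  actions N e L (smul s (e j)) (smul r (e i)) I ->
  Gam (N := N) (L := L) (L1 := L1) j i s r <= I \/ (j = i /\ L j (r - s) <= I).
Proof.
  intros Hj Hi Hs Hr (X & v & ell & ((_ & HA1) & (_ & HA2) & HX) & E0 & E1 & HXJ & HE & HI).
  destruct (HKprim_exists _ HA1) as [A1 PA1]. destruct (HKprim_exists _ HA2) as [A2 PA2].
  destruct (HKprim_exists ell (ex_intro _ I HI)) as [P HP].
  assert (HPI : P 1 - P 0 = I).
  { apply (HKint_unique ell 0 1); [lra|apply HP; lra|auto]. }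
  rewrite <- HPI.
  apply (path_lower X v ell A1 A2 P (fun t => 0 <= t <= 1 /\ ~ LagRel N e L (X t) (v t) (ell t))); auto.
  - apply HKprim_of_origin. intros t Ht; apply HX; auto.
  - apply HKprim_of_origin. intros t Ht; apply HX; auto.
  - intros t Ht Hn. apply NNPP; intros Hc. apply Hn; auto.
Qed.

End Trajectory.

(** * Optimal paths and the value of D_0 *)

(** The middle value is taken on the closed interval [t1,t2], where the optimal path rests at the
    vertex; its velocity is then admissible at every time, switching times included. *)
Definition step (a b c t1 t2 t : R) : R :=
  if Rlt_dec t t1 then a else if Rle_dec t t2 then b else c.

Definition step_int (a b c t1 t2 t : R) : R :=
  b * t + (a - b) * Rmin t t1 + (c - b) * (t - Rmin t t2).

Lemma HKint_step a b c t1 t2 lo hi : t1 <= t2 ->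
  HKint (step a b c t1 t2) lo hi (step_int a b c t1 t2 hi - step_int a b c t1 t2 lo).
Proof.
  intros Ht.
  set (h1 := fun t => if Rlt_dec t t1 then 1 else 0).
  set (h2 := fun t => if Rle_dec t t2 then 1 else 0).
  assert (H1 : HKint h1 lo hi (Rmin hi t1 - Rmin lo t1)).
  { apply HKint_indicator; intros t H; unfold h1; destruct Rlt_dec; auto; lra. }
  assert (H2 : HKint h2 lo hi (Rmin hi t2 - Rmin lo t2)).
  { apply HKint_indicator; intros t H; unfold h2; destruct Rle_dec; auto; lra. }
  assert (K := HKint_plus _ _ lo hi _ _ (HKint_const c lo hi)
    (HKint_plus _ _ lo hi _ _ (HKint_scal (a - b) _ lo hi _ H1) (HKint_scal (b - c) _ lo hi _ H2))).
  cbv beta in K.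
  replace (step_int a b c t1 t2 hi - step_int a b c t1 t2 lo) with
    (c * (hi - lo) + ((a - b) * (Rmin hi t1 - Rmin lo t1) + (b - c) * (Rmin hi t2 - Rmin lo t2)))
    by (unfold step_int; ring).
  revert K; apply HKint_ext. intros t _. unfold step, h1, h2.
  destruct Rlt_dec, Rle_dec; lra.
Qed.

Lemma Rabs_step a b c t1 t2 t :
  Rabs (step a b c t1 t2 t) = step (Rabs a) (Rabs b) (Rabs c) t1 t2 t.
Proof. unfold step; destruct Rlt_dec; [|destruct Rle_dec]; auto. Qed.

Lemma Lint_step a b c t1 t2 : t1 <= t2 -> Lint (step a b c t1 t2) 0 1.
Proof.
  intros Ht; split; eexists; [now apply HKint_step|].
  eapply HKint_ext; [|apply (HKint_step (Rabs a) (Rabs b) (Rabs c) t1 t2 0 1 Ht)].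
  intros; symmetry; apply Rabs_step.
Qed.

Lemma ae01_everywhere (Q : R -> Prop) : (forall t, 0 <= t <= 1 -> Q t) -> ae01 Q.
Proof.
  intros H eps Heps. exists (fun _ => 0), (fun _ => 0). split; [|split].
  - intros; lra.
  - intros z [Hz Hn]. now apply H in Hz.
  - intros n. replace (fsum n _) with 0; auto. clear; induction n; simpl; lra.
Qed.

Lemma inf_R_eq E m : is_glb E m -> inf_R E = m.
Proof.
  intros [H1 H2]. unfold inf_R. destruct excluded_middle_informative as [h|h].
  - destruct (constructive_indefinite_description _ h) as [m' [K1 K2]]; simpl.
    apply Rle_antisym; auto.
  - exfalso; apply h. exists m; split; auto.
Qed.

Lemma sup_R_max (E : R -> Prop) m : E m -> (forall z, E z -> z <= m) -> sup_R E = m.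
Proof.
  intros H1 H2. unfold sup_R. destruct excluded_middle_informative as [h|h].
  - destruct (constructive_indefinite_description _ h) as [m' [K1 K2]]; simpl.
    apply Rle_antisym; auto.
  - exfalso; apply h. exists m; split; auto.
Qed.

(** * Hamiltonians at tangent slopes, and calculus on the quadrant *)

Section ConvexHam.
Context (g : R) (f f1 : R -> R) (Hsc : strconv g f f1).

Lemma tangent q p : f1 q * p - energy f f1 q <= f p.
Proof.
  assert (K := sc_low _ _ _ Hsc q p). assert (K2 := sc_sq_nonneg _ _ _ Hsc (p - q)).
  unfold energy. lra.
Qed.

Lemma Ham_slope q : Ham f (f1 q) = energy f f1 q.
Proof.
  apply sup_R_max.
  - exists q. unfold energy; ring.
  - intros z (p & ->). assert (K := tangent q p). lra.
Qed.

Lemma Hamm_slope q : q <= 0 -> Hamm f (f1 q) = energy f f1 q.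
Proof.
  intros Hq. apply sup_R_max.
  - exists q; split; auto. unfold energy; ring.
  - intros z (p & _ & ->). assert (K := tangent q p). lra.
Qed.

(** For a slope of at least f'(0) the constrained supremum is attained at q = 0. This is why
    outgoing slopes do not reveal their energy to H^-. *)
Lemma Hamm_large p : f1 0 <= p -> Hamm f p = - f 0.
Proof.
  intros Hp. apply sup_R_max.
  - exists 0; split; [lra|ring].
  - intros z (q & Hq & ->). assert (K := tangent 0 q). unfold energy in K. nra.
Qed.

Lemma slope_abs_bound q b : Rabs q <= b -> Rabs (f1 q) <= Rabs (f1 b) + Rabs (f1 (- b)).
Proof.
  intros Hq. assert (H : - b <= q <= b) by (unfold Rabs in Hq; destruct Rcase_abs; lra).
  assert (K1 := sc_mono _ _ _ Hsc (- b) q ltac:(lra)). assert (K2 := sc_mono _ _ _ Hsc q b ltac:(lra)).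
  assert (Hg := sc_pos _ _ _ Hsc).
  assert (f1 (- b) <= f1 q) by nra. assert (f1 q <= f1 b) by nra.
  unfold Rabs; repeat destruct Rcase_abs; lra.
Qed.

Lemma value_abs_bound q b : Rabs q <= b -> f q <= f 0 + (Rabs (f1 b) + Rabs (f1 (- b))) * b.
Proof.
  intros Hq. assert (K := slope_abs_bound q b Hq). assert (K2 := tangent q 0). unfold energy in K2.
  assert (K3 := Rle_abs (q * f1 q)). rewrite Rabs_mult in K3.
  assert (Q1 := Rabs_pos q). assert (Q2 := Rabs_pos (f1 q)).
  assert (Rabs q * Rabs (f1 q) <= b * (Rabs (f1 b) + Rabs (f1 (- b)))) by (apply Rmult_le_compat; auto).
  lra.
Qed.

Lemma C1Q_difference : C1Q (fun s r => f (r - s)) (fun s r => - f1 (r - s)) (fun s r => f1 (r - s)).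
Proof.
  split.
  - intros a b Ha Hb eps Heps.
    destruct (sc_der _ _ _ Hsc (b - a) eps Heps) as [d Hd].
    exists d; split; [apply cond_pos|]. intros h k Hh Hk Hhk.
    replace (b + k - (a + h)) with (b - a + (k - h)) by ring.
    assert (T : Rabs (k - h) <= Rabs h + Rabs k).
    { eapply Rle_trans; [apply Rabs_triang|]. rewrite Rabs_Ropp; lra. }
    replace (_ - _ - _ - _) with (f (b - a + (k - h)) - f (b - a) - f1 (b - a) * (k - h)) by ring.
    destruct (Req_dec (k - h) 0) as [E0|E0].
    + rewrite E0, Rplus_0_r. replace (_ - _ - _) with 0 by ring. rewrite Rabs_R0.
      apply Rmult_le_pos; [lra|]. assert (Q1 := Rabs_pos h). assert (Q2 := Rabs_pos k). lra.
    + specialize (Hd (k - h) E0 ltac:(lra)).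
      replace (f (b - a + (k - h)) - f (b - a) - f1 (b - a) * (k - h))
        with (((f (b - a + (k - h)) - f (b - a)) / (k - h) - f1 (b - a)) * (k - h)) by (field; auto).
      rewrite Rabs_mult. apply Rmult_le_compat; auto using Rabs_pos; lra.
  - intros a b Ha Hb eps Heps.
    destruct (proj1 (continuity_pt_eps _ _) (sc_cont _ _ _ Hsc (b - a)) eps Heps) as (d & Hd & H).
    exists d; split; auto. intros a' b' Ha' Hb' Hab.
    assert (K : Rabs (f1 (b' - a') - f1 (b - a)) < eps).
    { apply H. replace (b' - a' - (b - a)) with ((b' - b) + - (a' - a)) by ring.
      eapply Rle_lt_trans; [apply Rabs_triang|]. rewrite Rabs_Ropp; lra. }
    split; auto.
    replace (- f1 (b' - a') - - f1 (b - a)) with (- (f1 (b' - a') - f1 (b - a))) by ring.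
    now rewrite Rabs_Ropp.
Qed.

End ConvexHam.

Lemma C1Q_lincomb c f f1 f2 h h1 h2 : C1Q f f1 f2 -> C1Q h h1 h2 ->
  C1Q (fun s r => f s r + c * h s r) (fun s r => f1 s r + c * h1 s r) (fun s r => f2 s r + c * h2 s r).
Proof.
  intros [A1 A2] [B1 B2].
  assert (Hm : 0 < Rabs c + 1) by (assert (Q := Rabs_pos c); lra).
  split; intros a b Ha Hb eps Heps;
    assert (He : 0 < eps / 2 / (Rabs c + 1)) by (apply Rdiv_lt_0_compat; lra);
    assert (Hle : Rabs c * (eps / 2 / (Rabs c + 1)) <= eps / 2)
      by (apply Rle_trans with ((Rabs c + 1) * (eps / 2 / (Rabs c + 1)));
          [apply Rmult_le_compat_r; lra|right; field; lra]).
  - destruct (A1 a b Ha Hb (eps / 2)) as (d1 & Hd1 & H1); [lra|].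
    destruct (B1 a b Ha Hb _ He) as (d2 & Hd2 & H2).
    exists (Rmin d1 d2); split; [now apply Rmin_glb_lt|]. intros x y Hx Hy Hxy.
    assert (K1 := Rmin_l d1 d2). assert (K2 := Rmin_r d1 d2).
    specialize (H1 x y Hx Hy ltac:(lra)). specialize (H2 x y Hx Hy ltac:(lra)).
    replace (_ - _ - _ - _) with ((f (a + x) (b + y) - f a b - f1 a b * x - f2 a b * y)
      + c * (h (a + x) (b + y) - h a b - h1 a b * x - h2 a b * y)) by ring.
    eapply Rle_trans; [apply Rabs_triang|]. rewrite (Rabs_mult c).
    assert (Q1 := Rabs_pos x). assert (Q2 := Rabs_pos y).
    apply (Rmult_le_compat_l (Rabs c)) in H2; [|apply Rabs_pos].
    apply (Rmult_le_compat_r (Rabs x + Rabs y)) in Hle; lra.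
  - destruct (A2 a b Ha Hb (eps / 2)) as (d1 & Hd1 & H1); [lra|].
    destruct (B2 a b Ha Hb _ He) as (d2 & Hd2 & H2).
    exists (Rmin d1 d2); split; [now apply Rmin_glb_lt|]. intros x y Hx Hy Hxy.
    assert (K1 := Rmin_l d1 d2). assert (K2 := Rmin_r d1 d2).
    destruct (H1 x y Hx Hy ltac:(lra)) as [P1 P2]. destruct (H2 x y Hx Hy ltac:(lra)) as [P3 P4].
    apply Rlt_le in P3, P4.
    apply (Rmult_le_compat_l (Rabs c)) in P3; [|apply Rabs_pos].
    apply (Rmult_le_compat_l (Rabs c)) in P4; [|apply Rabs_pos].
    split.
    + replace (_ - _) with ((f1 x y - f1 a b) + c * (h1 x y - h1 a b)) by ring.
      eapply Rle_lt_trans; [apply Rabs_triang|]. rewrite (Rabs_mult c). lra.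
    + replace (_ - _) with ((f2 x y - f2 a b) + c * (h2 x y - h2 a b)) by ring.
      eapply Rle_lt_trans; [apply Rabs_triang|]. rewrite (Rabs_mult c). lra.
Qed.

(** Keeping or freezing each coordinate by a boolean treats a quadrant, its two edges and its corner
    in one formula. *)
Definition mask (b : bool) (x : R) : R := if b then x else 0.

(** Composition with a linear map that does not increase the coordinates in absolute value, so the
    same [eta] works. *)
Lemma C1Q_mask b1 b2 f f1 f2 : C1Q f f1 f2 ->
  C1Q (fun s r => f (mask b1 s) (mask b2 r)) (fun s r => mask b1 (f1 (mask b1 s) (mask b2 r)))
      (fun s r => mask b2 (f2 (mask b1 s) (mask b2 r))).
Proof.
  intros [A B].
  assert (Hp : forall b x, 0 <= x -> 0 <= mask b x) by (intros [] x Hx; simpl; lra).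
  assert (Hd : forall b x y, mask b x - mask b y = mask b (x - y)) by (intros [] x y; simpl; lra).
  assert (Ha : forall b x, Rabs (mask b x) <= Rabs x)
    by (intros [] x; simpl; [lra|rewrite Rabs_R0; apply Rabs_pos]).
  assert (Hs : forall b x h, mask b (x + h) = mask b x + mask b h) by (intros [] x h; simpl; lra).
  assert (Hm : forall b x y, mask b x * y = x * mask b y) by (intros [] x y; simpl; lra).
  split; intros a b Ha' Hb' eps Heps.
  - destruct (A _ _ (Hp b1 a Ha') (Hp b2 b Hb') eps Heps) as (d & Hdp & H).
    exists d; split; auto. intros h k Hh Hk Hhk.
    assert (K1 := Ha b1 h). assert (K2 := Ha b2 k).
    rewrite !Hs, !Hm.
    eapply Rle_trans; [apply H|].
    + rewrite <- Hs; auto.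
    + rewrite <- Hs; auto.
    + lra.
    + apply Rmult_le_compat_l; lra.
  - destruct (B _ _ (Hp b1 a Ha') (Hp b2 b Hb') eps Heps) as (d & Hdp & H).
    exists d; split; auto. intros x y Hx Hy Hxy.
    assert (K1 := Ha b1 (x - a)). assert (K2 := Ha b2 (y - b)).
    destruct (H (mask b1 x) (mask b2 y)) as [P1 P2]; auto; [rewrite !Hd; lra|].
    rewrite !Hd. split; (eapply Rle_lt_trans; [apply Ha|]); auto.
Qed.

Lemma finite_bound (f : nat -> R) n : exists C, 0 <= C /\ forall k, (k < n)%nat -> f k <= C.
Proof.
  induction n as [|n (C & HC & H)]; [exists 0; split; [lra|lia]|].
  exists (Rmax C (f n)); split; [eapply Rle_trans; [exact HC|apply Rmax_l]|].
  intros k Hk. destruct (Nat.eq_dec k n) as [->|]; [apply Rmax_r|].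
  eapply Rle_trans; [apply H; lia|apply Rmax_l].
Qed.

Lemma gradnorm_bound N t f i C : (1 <= N)%nat -> 0 <= C ->
  (0 < t -> Rabs (f i) <= C) -> (~ 0 < t -> forall k, (k < N)%nat -> Rabs (f k) <= C) ->
  gradnorm N t f i <= INR N * C.
Proof.
  intros HN HC H1 H2. assert (HN1 : 1 <= INR N) by (apply (le_INR 1); auto).
  unfold gradnorm. destruct Rlt_dec as [Ht|Ht]; [specialize (H1 Ht); nra|].
  specialize (H2 Ht).
  assert (K : fsum N (fun k => f k * f k) <= INR N * (C * C)).
  { clear - H2 HC. induction N as [|n IH]; [simpl; lra|].
    rewrite S_INR; simpl fsum. assert (K := IH (fun k Hk => H2 k (Nat.lt_lt_succ_r _ _ Hk))).
    assert (f n * f n <= C * C).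
    { rewrite <- (Rabs_right (f n * f n)) by nra. rewrite Rabs_mult.
      specialize (H2 n (Nat.lt_succ_diag_r n)). apply Rmult_le_compat; auto using Rabs_pos. }
    lra. }
  rewrite <- (sqrt_square (INR N * C)) by nra. apply sqrt_le_1_alt.
  eapply Rle_trans; [exact K|]. assert (0 <= C * C) by nra. nra.
Qed.

(** * The optimal actions and their infimum *)

Section Value.
Context {N : nat} {e : nat -> pt} {L L1 : nat -> R -> R} {g : R} (HJ : junction N e L L1 g).

Notation Gm := (Gam (N := N) (L := L) (L1 := L1)).
Notation lv := (lev (N := N) (L := L) (L1 := L1)).
Notation sli := (slin (L := L) (L1 := L1)).
Notation slo := (slout (L := L) (L1 := L1)).
Notation vl := (vlag (N := N) (L := L)).
Notation ui := (uin (L := L) (L1 := L1)).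
Notation wo := (wout (L := L) (L1 := L1)).

(** Undoes the reflection: incoming motion at speed u has velocity - u, and its tangent slope is -
    [slin]. *)
Lemma in_energy j k : (j < N)%nat -> - vl <= k ->
  - sli j k = L1 j (- ui j k) /\ energy (L j) (L1 j) (- ui j k) = k /\ 0 <= ui j k.
Proof.
  intros Hj Hk.
  assert (K := speed_energy _ _ _ _ (conv_in HJ j Hj) (vlag_le_reflect j Hj) k Hk).
  assert (K2 := speed_nonneg _ _ _ _ (conv_in HJ j Hj) (vlag_le_reflect j Hj) k Hk).
  unfold slin, slope, energy in *. fold (ui j) in *. cbv beta in *. repeat split; auto; lra.
Qed.

Lemma out_energy i k : (i < N)%nat -> - vl <= k ->
  slo i k = L1 i (wo i k) /\ energy (L i) (L1 i) (wo i k) = k /\ 0 <= wo i k.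
Proof.
  intros Hi Hk.
  assert (K := speed_energy _ _ _ _ (conv_out HJ i Hi) (vlag_le i Hi) k Hk).
  assert (K2 := speed_nonneg _ _ _ _ (conv_out HJ i Hi) (vlag_le i Hi) k Hk).
  unfold slout, slope, energy in *. fold (wo i) in *. repeat split; auto; lra.
Qed.

Lemma action_direct j s r : (j < N)%nat -> 0 < s -> 0 < r ->
  actions N e L (smul s (e j)) (smul r (e j)) (L j (r - s)).
Proof.
  intros Hj Hs Hr.
  exists (fun t => smul (s + t * (r - s)) (e j)), (fun _ => smul (r - s) (e j)), (fun _ => L j (r - s)).
  assert (Hpos : forall t, 0 <= t <= 1 -> 0 < s + t * (r - s)).
  { intros t Ht. destruct (Req_dec t 1) as [->|]; [lra|].
    assert (0 < (1 - t) * s) by (apply Rmult_lt_0_compat; lra).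
    assert (0 <= t * r) by (apply Rmult_le_pos; lra). lra. }
  assert (HL : forall c, Lint (fun _ => c) 0 1) by (intros c; split; eexists; apply HKint_const).
  assert (HD : forall c tau, HKint (fun _ => (r - s) * c) 0 tau
    ((s + tau * (r - s)) * c - (s + 0 * (r - s)) * c)).
  { intros c tau. replace ((s + tau * (r - s)) * c - (s + 0 * (r - s)) * c)
      with ((r - s) * c * (tau - 0)) by ring. apply HKint_const. }
  split; [split; [apply HL|split; [apply HL|]]|split; [|split; [|split; [|split]]]].
  - intros tau _. split; apply HD.
  - cbv beta. f_equal; ring.
  - cbv beta. f_equal; ring.
  - intros t Ht. apply inJ_branch; auto. specialize (Hpos t Ht); lra.
  - apply ae01_everywhere. intros t Ht. right.
    exists j, (s + t * (r - s)), (r - s). repeat split; auto.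
  - assert (K := HKint_const (L j (r - s)) 0 1). replace (L j (r - s) * (1 - 0)) with (L j (r - s)) in K by ring.
    exact K.
Qed.

Lemma action_vertex j i s r : (j < N)%nat -> (i < N)%nat -> 0 <= s -> 0 <= r ->
  actions N e L (smul s (e j)) (smul r (e i)) (Gm j i s r).
Proof.
  intros Hj Hi Hs Hr.
  destruct (lev_spec HJ j i s r Hj Hi Hs Hr) as (H1 & H2 & H3 & H4 & H5).
  set (k := lv j i s r) in *.
  destruct (in_energy j k Hj H1) as (I1 & I2 & I3). destruct (out_energy i k Hi H1) as (O1 & O2 & O3).
  set (u := ui j k) in *. set (w := wo i k) in *.
  set (t1 := s / u) in *. set (t3 := r / w) in *. set (t2 := 1 - t3).
  assert (Es : s = u * t1).
  { unfold t1. destruct Hs as [Hs| <-]; [specialize (H2 Hs); field; lra|unfold Rdiv; ring]. }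
  assert (Er : r = w * t3).
  { unfold t3. destruct Hr as [Hr| <-]; [specialize (H3 Hr); field; lra|unfold Rdiv; ring]. }
  assert (P1 : 0 <= t1) by now apply div_nonneg. assert (P3 : 0 <= t3) by now apply div_nonneg.
  assert (Ht12 : t1 <= t2) by (unfold t2; lra).
  assert (Hm1 : Rmin 0 t1 = 0) by (rewrite Rmin_left; lra).
  assert (Hm2 : Rmin 0 t2 = 0) by (rewrite Rmin_left; lra).
  assert (Hm3 : Rmin 1 t1 = t1) by (rewrite Rmin_right; unfold t2 in *; lra).
  assert (Hm4 : Rmin 1 t2 = t2) by (rewrite Rmin_right; unfold t2 in *; lra).
  (* The truncations stop the incoming term at [t1] and start the outgoing one at [t2], so that [X]
     has the same form as [step_int]. *)
  set (X := fun t => padd (smul (s - u * Rmin t t1) (e j)) (smul (w * (t - Rmin t t2)) (e i))).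
  set (v := fun t => (step (- u * fst (e j)) 0 (w * fst (e i)) t1 t2 t,
                      step (- u * snd (e j)) 0 (w * snd (e i)) t1 t2 t)).
  assert (X1 : forall t, t < t1 -> X t = smul (s - u * t) (e j)).
  { intros t Ht. unfold X. rewrite !Rmin_left by lra. unfold padd, smul; simpl; f_equal; ring. }
  assert (X2 : forall t, t1 <= t <= t2 -> X t = pt0).
  { intros t Ht. unfold X. rewrite Rmin_right, Rmin_left by lra. rewrite Es.
    unfold padd, smul, pt0; simpl; f_equal; ring. }
  assert (X3 : forall t, t2 < t -> X t = smul (w * (t - t2)) (e i)).
  { intros t Ht. unfold X. rewrite !Rmin_right by lra. rewrite Es.
    unfold padd, smul; simpl; f_equal; ring. }
  assert (Q1 : forall t, 0 <= t -> t < t1 -> 0 < s - u * t).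
  { intros t Ht0 Ht. assert (0 < s).
    { destruct Hs as [Hs| <-]; auto. unfold t1, Rdiv in Ht; lra. }
    specialize (H2 H). rewrite Es. assert (0 < u * (t1 - t)) by (apply Rmult_lt_0_compat; lra). lra. }
  assert (Q3 : forall t, t2 < t -> t <= 1 -> 0 < w * (t - t2)).
  { intros t Ht Ht1. assert (0 < r).
    { destruct Hr as [Hr| <-]; auto. unfold t2, t3, Rdiv in Ht; lra. }
    specialize (H3 H). apply Rmult_lt_0_compat; lra. }
  assert (HL : Gm j i s r = step_int (L j (- u)) vl (L i w) t1 t2 1 - step_int (L j (- u)) vl (L i w) t1 t2 0).
  { unfold step_int. rewrite Hm1, Hm2, Hm3, Hm4. unfold Gam. fold k.
    assert (A1 : s * sli j k = t1 * (u * sli j k)) by (rewrite Es at 1; ring).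
    assert (A2 : r * slo i k = t3 * (w * slo i k)) by (rewrite Er at 1; ring).
    assert (B1 : u * sli j k = k + L j (- u)) by (unfold energy in I2; rewrite <- I1 in I2; lra).
    assert (B2 : w * slo i k = k + L i w) by (unfold energy in O2; rewrite <- O1 in O2; lra).
    rewrite A1, A2, B1, B2. unfold t2.
    (* Complementary slackness: there is no waiting, or [k] is the bottom level and waiting at the
       rate [vl] costs exactly [- k] per unit time. *)
    assert (D : (k + vl) * (1 - (t1 + t3)) = 0) by (destruct H5 as [-> | ->]; ring). lra. }
  exists X, v, (step (L j (- u)) vl (L i w) t1 t2). split; [split; [|split]|split; [|split; [|split; [|split]]]].
  - now apply (Lint_step (- u * fst (e j)) 0 (w * fst (e i))).
  - now apply (Lint_step (- u * snd (e j)) 0 (w * snd (e i))).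
  - intros tau Htau.
    assert (Hz : forall a b, (s - u * Rmin tau t1) * a + w * (tau - Rmin tau t2) * b -
      ((s - u * Rmin 0 t1) * a + w * (0 - Rmin 0 t2) * b)
      = step_int (- u * a) 0 (w * b) t1 t2 tau - step_int (- u * a) 0 (w * b) t1 t2 0).
    { intros a b. unfold step_int. rewrite Hm1, Hm2. ring. }
    split.
    + unfold X, padd, smul; simpl. rewrite Hz. now apply (HKint_step (- u * fst (e j)) 0 (w * fst (e i))).
    + unfold X, padd, smul; simpl. rewrite Hz. now apply (HKint_step (- u * snd (e j)) 0 (w * snd (e i))).
  - unfold X. rewrite Hm1, Hm2. unfold padd, smul; simpl; f_equal; ring.
  - unfold X. rewrite Hm3, Hm4. rewrite Es, Er. unfold t2, padd, smul; simpl; f_equal; ring.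
  - intros t Ht. destruct (Rlt_le_dec t t1) as [Hc|Hc].
    + rewrite X1 by auto. apply inJ_branch; auto. assert (K := Q1 t ltac:(lra) Hc). lra.
    + destruct (Rle_lt_dec t t2) as [Hc2|Hc2].
      * rewrite X2 by lra. rewrite <- (smul_0 (e j)). apply inJ_branch; auto; lra.
      * rewrite X3 by auto. apply inJ_branch; auto. assert (K := Q3 t Hc2 ltac:(lra)). lra.
  - apply ae01_everywhere. intros t Ht. unfold v, step. destruct Rlt_dec as [Hc|Hc].
    + right. exists j, (s - u * t), (- u). repeat split; auto. apply Q1; lra.
    + destruct Rle_dec as [Hc2|Hc2].
      * left. split; [apply X2; lra|]. exists i, 0. repeat split; auto; [lra|]. rewrite smul_0. reflexivity.
      * right. exists i, (w * (t - t2)), w. repeat split; auto; [apply Q3; lra|apply X3; lra].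
  - rewrite HL. now apply HKint_step.
Qed.

Definition value (j i : nat) (s r : R) : R :=
  if Nat.eq_dec j i then Rmin (L j (r - s)) (Gm j i s r) else Gm j i s r.

Lemma value_le_Gam j i s r : value j i s r <= Gm j i s r.
Proof. unfold value; destruct Nat.eq_dec; [apply Rmin_r|lra]. Qed.

Lemma value_edge j i s r : (j < N)%nat -> (i < N)%nat -> 0 <= s -> 0 <= r -> s = 0 \/ r = 0 ->
  value j i s r = Gm j i s r.
Proof.
  intros Hj Hi Hs Hr H. unfold value; destruct Nat.eq_dec as [->|]; auto.
  apply Rmin_right. now apply (Gam_le_direct HJ).
Qed.

Lemma value_compatible : vertex_compatible (N := N) value.
Proof.
  destruct (Gam_compatible HJ) as [H1 H2].
  split; intros; rewrite !value_edge; auto; lra.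
Qed.

(** On the edges the direct cost is at least [Gam]; inside, both candidates are realized when the
    branches coincide. The infimum is thus the cost of an actual path. *)
Lemma value_is_glb j i s r : (j < N)%nat -> (i < N)%nat -> 0 <= s -> 0 <= r ->
  is_glb (actions N e L (smul s (e j)) (smul r (e i))) (value j i s r).
Proof.
  intros Hj Hi Hs Hr. split.
  - intros I HI. destruct (actions_lower HJ j i s r I Hj Hi Hs Hr HI) as [K|[-> K]].
    + eapply Rle_trans; [apply value_le_Gam|auto].
    + unfold value. destruct Nat.eq_dec; [|contradiction].
      eapply Rle_trans; [apply Rmin_l|auto].
  - intros b Hb. assert (HG := Hb _ (action_vertex j i s r Hj Hi Hs Hr)).
    destruct Hs as [Hs| <-]; [|rewrite value_edge; auto; lra].
    destruct Hr as [Hr| <-]; [|rewrite value_edge; auto; lra].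
    unfold value. destruct Nat.eq_dec as [->|]; auto.
    apply Rmin_glb; auto. apply Hb. now apply action_direct.
Qed.

Lemma D0_value j i s r : (j < N)%nat -> (i < N)%nat -> 0 <= s -> 0 <= r ->
  D0 N e L (smul s (e j)) (smul r (e i)) = value j i s r.
Proof. intros; apply inf_R_eq. now apply value_is_glb. Qed.

Lemma value_continuous j i : (j < N)%nat -> (i < N)%nat -> continuous_on_quadrant (value j i).
Proof.
  intros Hj Hi. unfold value. destruct Nat.eq_dec as [->|].
  - intros a b Ha Hb eps Heps.
    destruct (C1Q_continuous _ _ _ (C1Q_difference _ _ _ (conv_out HJ i Hi)) a b Ha Hb eps Heps)
      as (d1 & Hd1 & H1).
    destruct (C1Q_continuous _ _ _ (Gam_C1Q HJ i i Hi Hi) a b Ha Hb eps Heps) as (d2 & Hd2 & H2).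
    exists (Rmin d1 d2); split; [now apply Rmin_glb_lt|]. intros x y Hx Hy Hxy.
    assert (K1 := Rmin_l d1 d2). assert (K2 := Rmin_r d1 d2).
    specialize (H1 x y Hx Hy ltac:(lra)). specialize (H2 x y Hx Hy ltac:(lra)).
    cbv beta in H1. apply Rabs_def2 in H1; apply Rabs_def2 in H2.
    apply Rabs_def1; unfold Rmin; repeat destruct Rle_dec; lra.
  - exact (C1Q_continuous _ _ _ (Gam_C1Q HJ j i Hj Hi)).
Qed.

Lemma D0_continuous : contJ2 N e (D0 N e L).
Proof.
  assert (HC := contJ2_lift HJ value value_compatible value_continuous).
  assert (HE : forall y x, inJ N e y -> inJ N e x ->
    D0 N e L y x = lift (N := N) (e := e) value y x).
  { intros y x Hy Hx. destruct (inJ_cases y Hy) as (j & s & Hj & Hs & ->).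
    destruct (inJ_cases x Hx) as (i & t & Hi & Ht & ->).
    rewrite D0_value by auto. symmetry. apply (lift_branch HJ); auto using value_compatible. }
  intros y x Hy Hx eps Heps. destruct (HC y x Hy Hx eps Heps) as (eta & Heta & H).
  exists eta; split; auto. intros y' x' Hy' Hx' Hd. rewrite !HE by auto. auto.
Qed.

(** At a common energy where all speeds exceed twice the distances, the moving time is below 1, so
    the level cannot be higher. *)
Lemma lev_bounded B : exists K, - vl <= K /\ forall j i s r, (j < N)%nat -> (i < N)%nat ->
  0 <= s <= B -> 0 <= r <= B -> lv j i s r <= K.
Proof.
  set (b := Rmax 0 B). assert (Hb : 0 <= b) by apply Rmax_l. assert (HB : B <= b) by apply Rmax_r.
  assert (HU : forall v : nat -> R -> R, (forall j, (j < N)%nat -> speedlike (- vl) (v j)) ->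
    exists K, - vl <= K /\ forall j k, (j < N)%nat -> K <= k -> 2 * b + 1 <= v j k).
  { intros v Hv.
    assert (HK : forall j, exists k, (j < N)%nat -> - vl <= k /\ 2 * b + 1 <= v j k).
    { intros j. destruct (classic (j < N)%nat) as [Hj|Hj]; [|exists 0; tauto].
      destruct (sl_unbounded _ _ (Hv j Hj) (2 * b + 1)) as (k & Hk); exists k; auto. }
    apply choice in HK as [kk Hkk].
    destruct (finite_bound kk N) as (C & _ & HC).
    exists (Rmax C (- vl)); split; [apply Rmax_r|]. intros j k Hj Hk.
    destruct (Hkk j Hj) as [E1 E2]. specialize (HC j Hj).
    assert (M := Rmax_l C (- vl)).
    destruct (Req_dec (kk j) k) as [<-|]; auto.
    assert (K := sl_incr _ _ (Hv j Hj) (kk j) k E1 ltac:(lra)). lra. }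
  destruct (HU ui (uin_speedlike HJ)) as (K1 & E1 & F1).
  destruct (HU wo (wout_speedlike HJ)) as (K2 & E2 & F2).
  set (K := Rmax K1 K2 + 1).
  assert (M1 := Rmax_l K1 K2). assert (M2 := Rmax_r K1 K2).
  exists K; split; [unfold K; lra|]. intros j i s r Hj Hi Hs Hr.
  apply (level_lt (- vl) (ui j) (wo i) (uin_speedlike HJ j Hj) (wout_speedlike HJ i Hi));
    try (unfold K; lra).
  specialize (F1 j K Hj ltac:(unfold K; lra)). specialize (F2 i K Hi ltac:(unfold K; lra)).
  assert (S1 : s / ui j K < / 2).
  { apply Rmult_lt_reg_r with (ui j K); [lra|]. replace (s / ui j K * ui j K) with s by (field; lra). lra. }
  assert (S2 : r / wo i K < / 2).
  { apply Rmult_lt_reg_r with (wo i K); [lra|]. replace (r / wo i K * wo i K) with r by (field; lra). lra. }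
  lra.
Qed.

Lemma slopes_bounded B : exists C, 0 <= C /\ forall j i k s r, (j < N)%nat -> (i < N)%nat -> (k < N)%nat ->
  0 <= s <= B -> 0 <= r <= B -> Rabs (sli k (lv j i s r)) <= C /\ Rabs (slo k (lv j i s r)) <= C.
Proof.
  destruct (lev_bounded B) as (K & HK & HB).
  destruct (finite_bound (fun k => Rabs (sli k (- vl)) + Rabs (sli k K)) N) as (C1 & P1 & H1).
  destruct (finite_bound (fun k => Rabs (slo k (- vl)) + Rabs (slo k K)) N) as (C2 & P2 & H2).
  exists (C1 + C2); split; [lra|]. intros j i k s r Hj Hi Hk Hs Hr.
  specialize (HB j i s r Hj Hi Hs Hr). specialize (H1 k Hk). specialize (H2 k Hk). cbv beta in *.
  assert (Hge := lev_ge HJ j i s r Hj Hi (proj1 Hs) (proj1 Hr)).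
  set (m := lv j i s r) in *.
  assert (A1 := slope_incr _ _ _ _ (conv_in HJ k Hk) (vlag_le_reflect k Hk) (- vl) m (Rle_refl _) Hge).
  assert (A2 := slope_incr _ _ _ _ (conv_in HJ k Hk) (vlag_le_reflect k Hk) m K Hge HB).
  assert (A3 := slope_incr _ _ _ _ (conv_out HJ k Hk) (vlag_le k Hk) (- vl) m (Rle_refl _) Hge).
  assert (A4 := slope_incr _ _ _ _ (conv_out HJ k Hk) (vlag_le k Hk) m K Hge HB).
  fold (sli k) in A1, A2. fold (slo k) in A3, A4.
  split; unfold Rabs in *; repeat destruct Rcase_abs; lra.
Qed.

(** [Gam_max] is used at a fixed energy where every slope is at least 1. This bounds both distances
    when the route through the vertex beats a direct path of bounded cost. *)
Lemma Gam_coercive : exists K, forall j i s r, (j < N)%nat -> (i < N)%nat -> 0 <= s -> 0 <= r ->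
  s + r - K <= Gm j i s r.
Proof.
  assert (Hg : 0 < g).
  { assert (H := jn_pos _ _ _ _ _ HJ). exact (sc_pos _ _ _ (conv_out HJ 0%nat ltac:(lia))). }
  assert (HU : forall f f1 : nat -> R -> R, (forall j, (j < N)%nat -> strconv g (f j) (f1 j)) ->
    (forall j, (j < N)%nat -> - f j 0 <= - vl) ->
    exists K, - vl <= K /\ forall j k, (j < N)%nat -> K <= k -> 1 <= slope (f j) (f1 j) k).
  { intros f f1 Hf Hf0.
    assert (HK : forall j, exists k, (j < N)%nat -> - vl <= k /\ 1 <= slope (f j) (f1 j) k).
    { intros j. destruct (classic (j < N)%nat) as [Hj|Hj]; [|exists 0; tauto].
      destruct (sl_unbounded _ _ (speed_speedlike g (- vl) _ _ (Hf j Hj) (Hf0 j Hj))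
        ((1 + Rabs (f1 j 0)) / g)) as (k & Hk & Hu).
      exists k; intros _; split; auto.
      assert (M := sc_mono _ _ _ (Hf j Hj) 0 _ (speed_nonneg g (- vl) _ _ (Hf j Hj) (Hf0 j Hj) k Hk)).
      apply (Rmult_le_compat_l g) in Hu; [|lra].
      replace (g * ((1 + Rabs (f1 j 0)) / g)) with (1 + Rabs (f1 j 0)) in Hu by (field; lra).
      unfold slope. assert (Q := Rle_abs (- f1 j 0)). rewrite Rabs_Ropp in Q. lra. }
    apply choice in HK as [kk Hkk].
    destruct (finite_bound kk N) as (C & _ & HC).
    exists (Rmax C (- vl)); split; [apply Rmax_r|]. intros j k Hj Hk.
    destruct (Hkk j Hj) as [E1 E2]. specialize (HC j Hj). assert (M := Rmax_l C (- vl)).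
    eapply Rle_trans; [exact E2|]. apply (slope_incr g (- vl)); auto. lra. }
  destruct (HU (fun j q => L j (- q)) (fun j q => - L1 j (- q)) (conv_in HJ) (vlag_le_reflect))
    as (K1 & E1 & F1).
  destruct (HU L L1 (conv_out HJ) vlag_le) as (K2 & E2 & F2).
  set (K := Rmax K1 K2). assert (M1 : K1 <= K) by apply Rmax_l. assert (M2 : K2 <= K) by apply Rmax_r.
  exists K. intros j i s r Hj Hi Hs Hr.
  assert (HM := Gam_max HJ j i s r K Hj Hi Hs Hr ltac:(lra)).
  specialize (F1 j K Hj M1). specialize (F2 i K Hi M2). fold (sli j) in F1. fold (slo i) in F2. nra.
Qed.

End Value.

(** * Test functions *)

Section TestFunctions.
Context {N : nat} {e : nat -> pt} {L L1 : nat -> R -> R} {g : R} (HJ : junction N e L L1 g).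

Notation Gm := (Gam (N := N) (L := L) (L1 := L1)).
Notation lv := (lev (N := N) (L := L) (L1 := L1)).
Notation sli := (slin (L := L) (L1 := L1)).
Notation slo := (slout (L := L) (L1 := L1)).
Notation vl := (vlag (N := N) (L := L)).
Notation ui := (uin (L := L) (L1 := L1)).
Notation val := (value (N := N) (L := L) (L1 := L1)).
Notation bra := (br (N := N) (e := e)).
Notation lif := (lift (N := N) (e := e)).

(** The factor -1 here, like the factor 1 in [direct], keeps the shape of [C1Q_lincomb]. *)
Definition chi (j : nat) (s r : R) : R := L j (r - s) + -1 * Gm j j s r.
Definition chi_in (j : nat) (s r : R) : R := - L1 j (r - s) + -1 * sli j (lv j j s r).
Definition chi_out (j : nat) (s r : R) : R := L1 j (r - s) + -1 * slo j (lv j j s r).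

(* Equal to [L j (r - s)] on J_j x J_j; elsewhere [Gam] plus the restriction of the
   difference to the edges, which is nonnegative. *)
Definition direct (j j' i' : nat) (s r : R) : R :=
  Gm j' i' s r + 1 * chi j (mask (Nat.eqb j' j) s) (mask (Nat.eqb i' j) r).
Definition direct_in (j j' i' : nat) (s r : R) : R :=
  sli j' (lv j' i' s r)
  + 1 * mask (Nat.eqb j' j) (chi_in j (mask (Nat.eqb j' j) s) (mask (Nat.eqb i' j) r)).
Definition direct_out (j j' i' : nat) (s r : R) : R :=
  slo i' (lv j' i' s r)
  + 1 * mask (Nat.eqb i' j) (chi_out j (mask (Nat.eqb j' j) s) (mask (Nat.eqb i' j) r)).

(** The case y = 0 is left to [Gam]; with s > 0 the branch is determined by y alone, and x may be
    the vertex. The non-strict inequality sends ties here. *)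
Definition goes_direct (y x : pt) : Prop :=
  exists j s r, (j < N)%nat /\ 0 < s /\ 0 <= r /\ y = smul s (e j) /\ x = smul r (e j) /\
    L j (r - s) <= Gm j j s r.

Definition test_family (y x : pt) : nat -> nat -> R -> R -> R :=
  if excluded_middle_informative (goes_direct y x) then direct (bra y) else Gm.
Definition test_in (y x : pt) : nat -> nat -> R -> R -> R :=
  if excluded_middle_informative (goes_direct y x) then direct_in (bra y)
  else fun j i s r => sli j (lv j i s r).
Definition test_out (y x : pt) : nat -> nat -> R -> R -> R :=
  if excluded_middle_informative (goes_direct y x) then direct_out (bra y)
  else fun j i s r => slo i (lv j i s r).

Lemma mask_0 b : mask b 0 = 0.
Proof. destruct b; reflexivity. Qed.

Lemma mask_nonneg b s : 0 <= s -> 0 <= mask b s.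
Proof. destruct b; simpl; lra. Qed.

Lemma direct_compatible j : vertex_compatible (N := N) (direct j).
Proof.
  destruct (Gam_compatible HJ) as [H1 H2]. split; intros; unfold direct; rewrite !mask_0.
  - rewrite (H1 j0 j' i t); auto.
  - rewrite (H2 j0 i i' s); auto.
Qed.

Lemma direct_C1Q j j' i' : (j < N)%nat -> (j' < N)%nat -> (i' < N)%nat ->
  C1Q (direct j j' i') (direct_in j j' i') (direct_out j j' i').
Proof.
  intros Hj Hj' Hi'.
  apply (C1Q_lincomb 1 (Gm j' i') _ _ _ _ _ (Gam_C1Q HJ j' i' Hj' Hi')).
  apply (C1Q_mask (Nat.eqb j' j) (Nat.eqb i' j) (chi j) (chi_in j) (chi_out j)).
  apply (C1Q_lincomb (-1) _ _ _ _ _ _ (C1Q_difference _ _ _ (conv_out HJ j Hj)) (Gam_C1Q HJ j j Hj Hj)).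
Qed.

Lemma direct_diag j s r : direct j j j s r = L j (r - s).
Proof. unfold direct, chi. rewrite Nat.eqb_refl. simpl mask. lra. Qed.

Lemma direct_ge j j' i' s r : (j < N)%nat -> (j' < N)%nat -> (i' < N)%nat -> 0 <= s -> 0 <= r ->
  val j' i' s r <= direct j j' i' s r.
Proof.
  intros Hj Hj' Hi' Hs Hr.
  assert (H : (j' = j /\ i' = j) \/ (j' <> j \/ i' <> j)).
  { destruct (Nat.eq_dec j' j), (Nat.eq_dec i' j); auto. }
  destruct H as [[-> ->]|H].
  - rewrite direct_diag. unfold value. destruct Nat.eq_dec; [apply Rmin_l|contradiction].
  - eapply Rle_trans; [apply value_le_Gam|]. unfold direct, chi.
    assert (K := Gam_le_direct HJ j _ _ Hj (mask_nonneg (Nat.eqb j' j) s Hs) (mask_nonneg (Nat.eqb i' j) r Hr)).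
    assert (K2 : mask (Nat.eqb j' j) s = 0 \/ mask (Nat.eqb i' j) r = 0).
    { destruct H as [H|H]; apply Nat.eqb_neq in H; rewrite H; auto. }
    specialize (K K2). lra.
Qed.

Lemma goes_direct_branch y x j s : (j < N)%nat -> 0 <= s -> y = smul s (e j) -> goes_direct y x ->
  bra y = j /\ 0 < s /\ exists r, 0 <= r /\ x = smul r (e j) /\ L j (r - s) <= Gm j j s r.
Proof.
  intros Hj Hs -> (j0 & s0 & r & Hj0 & Hs0 & Hr & Ey & Ex & HL).
  assert (j0 = j) by (eapply (branch_index HJ); [| | | |symmetry; exact Ey]; auto). subst j0.
  assert (s0 = s) by (apply (branch_coord HJ j j); auto; lra). subst s0.
  split; [now apply (br_branch HJ)|split; auto]. exists r; auto.
Qed.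

Lemma test_compatible y x : vertex_compatible (N := N) (test_family y x).
Proof.
  unfold test_family; destruct excluded_middle_informative;
    [apply direct_compatible|apply (Gam_compatible HJ)].
Qed.

Lemma test_C1Q y x j i : inJ N e y -> (j < N)%nat -> (i < N)%nat ->
  C1Q (test_family y x j i) (test_in y x j i) (test_out y x j i).
Proof.
  intros Hy Hj Hi. unfold test_family, test_in, test_out; destruct excluded_middle_informative.
  - apply direct_C1Q; auto. now apply (br_spec HJ).
  - now apply (Gam_C1Q HJ).
Qed.

Lemma test_ge y x j i s r : inJ N e y -> (j < N)%nat -> (i < N)%nat -> 0 <= s -> 0 <= r ->
  val j i s r <= test_family y x j i s r.
Proof.
  intros Hy Hj Hi Hs Hr. unfold test_family; destruct excluded_middle_informative.
  - apply direct_ge; auto. now apply (br_spec HJ).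
  - apply value_le_Gam.
Qed.

Lemma not_direct_lt j s r : (j < N)%nat -> 0 < s -> 0 <= r ->
  ~ goes_direct (smul s (e j)) (smul r (e j)) -> Gm j j s r < L j (r - s).
Proof.
  intros Hj Hs Hr Hn. apply Rnot_le_lt; intros Hle. apply Hn. exists j, s, r. repeat split; auto.
Qed.

Lemma test_touches j i s t : (j < N)%nat -> (i < N)%nat -> 0 <= s -> 0 <= t ->
  test_family (smul s (e j)) (smul t (e i)) j i s t = val j i s t.
Proof.
  intros Hj Hi Hs Ht. unfold test_family; destruct excluded_middle_informative as [Hd|Hn].
  - destruct (goes_direct_branch _ _ j s Hj Hs eq_refl Hd) as (-> & Hs0 & r & Hr & Ex & HL).
    assert (t = r) by (apply (branch_coord HJ i j); auto). subst r.
    assert (Ei : direct j j i s t = direct j j j s t /\ val j i s t = val j j s t).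
    { destruct Ht as [Ht| <-].
      - assert (i = j) by (eapply (branch_index HJ); [| | | |exact Ex]; auto). subst i; auto.
      - split; [apply direct_compatible|apply (value_compatible HJ)]; auto. }
    destruct Ei as [-> ->]. rewrite direct_diag. unfold value.
    destruct Nat.eq_dec; [rewrite Rmin_left; auto|contradiction].
  - unfold value; destruct Nat.eq_dec as [->|]; auto. symmetry; apply Rmin_right.
    destruct Hs as [Hs| <-]; [|apply (Gam_le_direct HJ); auto; lra].
    left. now apply not_direct_lt.
Qed.

(** Above the bottom level the moving time is 1. With r = 0 this means s = u(k), hence [Gam] equals
    L_j(- s), against the strict inequality. *)
Lemma lev_bottom j i s : (j < N)%nat -> (i < N)%nat -> 0 <= s ->
  (0 < s -> Gm j j s 0 < L j (0 - s)) -> lv j i s 0 = - vl.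
Proof.
  intros Hj Hi Hs Hn. rewrite (lev_indep_right HJ j i j) by auto.
  destruct (lev_spec HJ j j s 0 Hj Hj Hs (Rle_refl 0)) as (H1 & H2 & _ & H4 & [H5|H5]); auto.
  exfalso. set (k := lv j j s 0) in *. destruct Hs as [Hs| <-]; [|unfold Rdiv in H5; lra].
  specialize (H2 Hs). specialize (Hn Hs).
  replace (0 / wout j k) with 0 in H5 by (unfold Rdiv; ring).
  assert (Es : s = ui j k).
  { assert (s / ui j k * ui j k = s) by (field; lra). replace (s / ui j k) with 1 in H by lra. lra. }
  destruct (in_energy HJ j k Hj H1) as (I1 & I2 & _). unfold Gam in Hn. fold k in Hn.
  rewrite <- Es in I1, I2. unfold energy in I2. rewrite <- I1 in I2.
  replace (0 - s) with (- s) in Hn by ring. lra.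
Qed.

(** For r = 0, [Gam] is the tangent at - u(k) evaluated at - s, below L_j(- s) by a quadratic gap.
    The hypothesis closes the gap, so s = u(k) and the energy is an admissible level. *)
Lemma direct_level j s : (j < N)%nat -> 0 < s -> L j (0 - s) <= Gm j j s 0 ->
  - vl <= energy (L j) (L1 j) (- s).
Proof.
  intros Hj Hs HL. set (k := lv j j s 0).
  assert (Hk := lev_ge HJ j j s 0 Hj Hj (Rlt_le _ _ Hs) (Rle_refl 0)). fold k in Hk.
  destruct (in_energy HJ j k Hj Hk) as (I1 & I2 & I3).
  assert (K := sc_low _ _ _ (conv_out HJ j Hj) (- ui j k) (- s)).
  rewrite <- I1 in K. unfold energy in I2. rewrite <- I1 in I2.
  unfold Gam in HL. fold k in HL. replace (0 - s) with (- s) in HL by ring.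
  assert (Hg := sc_pos _ _ _ (conv_out HJ j Hj)).
  assert (Hsq : (- s - - ui j k) ^ 2 <= 0).
  { apply Rmult_le_reg_l with (g / 2); lra. }
  assert (Es : s = ui j k).
  { apply NNPP; intros Hne. assert (0 < (- s - - ui j k) ^ 2); [|lra].
    rewrite <- Rsqr_pow2. apply Rsqr_pos_lt. lra. }
  rewrite Es. unfold energy. rewrite <- I1. lra.
Qed.

(** On J_j x J_j the test function is L_j(t - s), which gives the energy identity. At t = 0 the
    velocity - s is nonpositive, so branch j attains the energy in the maximum; the other branches
    give - L_k(0), no more than it by [direct_level]. *)
Lemma direct_equations j i s t (G := direct j) : (j < N)%nat -> (i < N)%nat -> 0 < s -> 0 <= t ->
  (0 < t -> i = j) -> L j (t - s) <= Gm j j s t ->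
  let E := G j i s t - t * direct_out j j i s t - s * direct_in j j i s t in
  E = - energy (L j) (L1 j) (t - s) /\
  - direct_in j j i s t = L1 j (t - s) /\
  (0 < t -> direct_out j j i s t = L1 j (t - s)) /\
  (t = 0 -> bigmax (N - 1) (fun k => Hamm (L k) (direct_out j j k s 0)) = energy (L j) (L1 j) (t - s)).
Proof.
  intros Hj Hi Hs Ht Hij HL E.
  assert (Hin : direct_in j j j s t = - L1 j (t - s)).
  { unfold direct_in, chi_in. rewrite Nat.eqb_refl. simpl mask. ring. }
  assert (Hout : direct_out j j j s t = L1 j (t - s)).
  { unfold direct_out, chi_out. rewrite Nat.eqb_refl. simpl mask. ring. }
  assert (Ei : direct_in j j i s t = - L1 j (t - s)).
  { destruct Ht as [Ht| <-]; [now rewrite (Hij Ht)|]. rewrite <- Hin. unfold direct_in.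
    rewrite !mask_0, (lev_indep_right HJ j i j) by (auto; lra). reflexivity. }
  assert (EG : G j i s t = L j (t - s)).
  { unfold G. rewrite <- direct_diag. destruct Ht as [Ht| <-]; [now rewrite (Hij Ht)|].
    apply direct_compatible; auto; lra. }
  split; [|split; [rewrite Ei; ring|split]].
  - unfold E. rewrite EG, Ei. unfold energy.
    destruct Ht as [Ht| <-]; [rewrite (Hij Ht), Hout|]; ring.
  - intros Ht0. rewrite (Hij Ht0). exact Hout.
  - intros ->. apply bigmax_eq.
    + intros k Hk. assert (HkN : (k < N)%nat) by (assert (P := jn_pos _ _ _ _ _ HJ); lia).
      destruct (Nat.eq_dec k j) as [->|Hkj].
      * rewrite Hout, (Hamm_slope _ _ _ (conv_out HJ j Hj)); lra.
      * unfold direct_out. apply Nat.eqb_neq in Hkj. rewrite Hkj. simpl mask at 1.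
        assert (Hkv := lev_ge HJ j k s 0 Hj HkN (Rlt_le _ _ Hs) (Rle_refl 0)).
        rewrite (Hamm_large _ _ _ (conv_out HJ k HkN)).
        -- replace (0 - s) with (- s) in * by ring.
           assert (K := vlag_le (L := L) k HkN).
           assert (K2 := direct_level j s Hj Hs). replace (0 - s) with (- s) in K2 by ring.
           specialize (K2 HL). lra.
        -- assert (K := slope_ge _ _ _ _ (conv_out HJ k HkN) (vlag_le k HkN) _ Hkv).
           fold (slo k) in K. lra.
    + exists j. split; [lia|]. rewrite Hout. apply (Hamm_slope _ _ _ (conv_out HJ j Hj)). lra.
Qed.

(** Homogeneity of the maximized expression gives - k. The full Hamiltonians recover k on both
    sides; among the one-sided ones, incoming slopes all give k, while outgoing slopes give -
    L_m(0), with maximum - L_0(0). *)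
Lemma vertex_equations j i s t : (j < N)%nat -> (i < N)%nat -> 0 <= s -> 0 <= t ->
  let k := lv j i s t in
  Gm j i s t - t * slo i k - s * sli j k = - k /\
  Ham (L i) (slo i k) = k /\ Ham (L j) (- sli j k) = k /\
  bigmax (N - 1) (fun m => Hamm (L m) (slo m (lv j m s 0))) = - vl /\
  bigmax (N - 1) (fun m => Hamm (L m) (- sli m (lv m i 0 t))) = lv j i 0 t.
Proof.
  intros Hj Hi Hs Ht k.
  assert (P := jn_pos _ _ _ _ _ HJ).
  assert (Hk := lev_ge HJ j i s t Hj Hi Hs Ht). fold k in Hk.
  destruct (in_energy HJ j k Hj Hk) as (I1 & I2 & I3).
  destruct (out_energy HJ i k Hi Hk) as (O1 & O2 & O3).
  repeat split.
  - unfold Gam. fold k. ring.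
  - rewrite O1, (Ham_slope _ _ _ (conv_out HJ i Hi)). exact O2.
  - rewrite I1, (Ham_slope _ _ _ (conv_out HJ j Hj)). exact I2.
  - assert (Hm : forall m, (m < N)%nat -> Hamm (L m) (slo m (lv j m s 0)) = - L m 0).
    { intros m Hm. apply (Hamm_large _ _ _ (conv_out HJ m Hm)).
      apply (slope_ge _ _ _ _ (conv_out HJ m Hm) (vlag_le m Hm)). apply (lev_ge HJ); auto; lra. }
    apply bigmax_eq.
    + intros m Hm'. rewrite Hm by lia. apply vlag_le; lia.
    + destruct (L0_attained (L := L) HJ 0) as (m & HmN & E0). exists m; split; [lia|].
      rewrite Hm by auto. unfold vlag. now rewrite E0.
  - assert (Hm : forall m, (m < N)%nat -> Hamm (L m) (- sli m (lv m i 0 t)) = lv j i 0 t).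
    { intros m Hm. rewrite (lev_indep_left HJ m j i t) by auto.
      assert (Hk0 := lev_ge HJ j i 0 t Hj Hi (Rle_refl 0) Ht).
      destruct (in_energy HJ m _ Hm Hk0) as (M1 & M2 & M3).
      rewrite M1, (Hamm_slope _ _ _ (conv_out HJ m Hm)); lra. }
    apply bigmax_eq.
    + intros m Hm'. rewrite Hm by lia. lra.
    + exists j; split; [lia|]. now apply Hm.
Qed.

Lemma test_equations j i s t : (j < N)%nat -> (i < N)%nat -> 0 <= s -> 0 <= t ->
  let y := smul s (e j) in let x := smul t (e i) in
  let E := test_family y x j i s t - t * test_out y x j i s t - s * test_in y x j i s t in
  (0 < t -> E + Ham (L i) (test_out y x j i s t) = 0) /\
  (t = 0 -> E + bigmax (N - 1) (fun k => Hamm (L k) (test_out y x j k s 0)) = 0) /\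
  (0 < s -> E + Ham (L j) (- test_in y x j i s t) = 0) /\
  (s = 0 -> E + bigmax (N - 1) (fun k => Hamm (L k) (- test_in y x k i 0 t)) = 0) /\
  (s = 0 -> N = 1%nat -> E + Ham (L 0%nat) (- test_in y x 0%nat i 0 t) = 0).
Proof.
  intros Hj Hi Hs Ht y x. subst y x. unfold test_family, test_in, test_out.
  destruct excluded_middle_informative as [Hd|Hn].
  - destruct (goes_direct_branch _ _ j s Hj Hs eq_refl Hd) as (-> & Hs0 & r & Hr & Ex & HL).
    assert (t = r) by (apply (branch_coord HJ i j); auto). subst r.
    destruct (direct_equations j i s t Hj Hi Hs0 Ht) as (E1 & E2 & E3 & E4); auto.
    { intros Ht0. eapply (branch_index HJ); [| | | |exact Ex]; auto. }
    cbv zeta. rewrite E1, E2. split; [|split; [|split; [|split]]].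
    + intros Ht0. rewrite (E3 Ht0).
      assert (i = j) by (eapply (branch_index HJ); [| | | |exact Ex]; auto). subst i.
      rewrite (Ham_slope _ _ _ (conv_out HJ j Hj)). lra.
    + intros Ht0. rewrite (E4 Ht0). lra.
    + intros _. rewrite (Ham_slope _ _ _ (conv_out HJ j Hj)). lra.
    + intros ->; lra.
    + intros ->; lra.
  - destruct (vertex_equations j i s t Hj Hi Hs Ht) as (E1 & E2 & E3 & E4 & E5).
    cbv zeta. rewrite E1. split; [|split; [|split; [|split]]].
    + intros _. rewrite E2. lra.
    (* The tie-break pays off here: not going direct means a strict inequality, which forces the
       bottom level. *)
    + intros ->. assert (Hb : lv j i s 0 = - vl).
      { apply lev_bottom; auto. intros Hs0. apply not_direct_lt; auto.
        now rewrite smul_0, <- (smul_0 (e j)) in Hn. }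
      rewrite E4, Hb. lra.
    + intros _. rewrite E3. lra.
    + intros ->. rewrite E5. lra.
    + intros -> HN1. assert (j = 0%nat) by lia. subst j. rewrite E3. lra.
Qed.

(** Points on one branch can be close together yet far from the vertex. Direct slopes depend only on
    t - s; if instead the vertex route is used, coercivity keeps both points near the vertex. *)
Lemma test_gradient_bound Rad : 0 < Rad -> exists C, 0 <= C /\
  forall j i s t, (j < N)%nat -> (i < N)%nat -> 0 <= s -> 0 <= t ->
    let y := smul s (e j) in let x := smul t (e i) in
    dJ N e y x <= Rad ->
    (0 < t -> Rabs (test_out y x j i s t) <= C) /\
    (~ 0 < t -> forall k, (k < N)%nat -> Rabs (test_out y x j k s t) <= C) /\
    (0 < s -> Rabs (test_in y x j i s t) <= C) /\
    (~ 0 < s -> forall k, (k < N)%nat -> Rabs (test_in y x k i s t) <= C).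
Proof.
  intros HR.
  destruct (finite_bound (fun k => L k 0 + (Rabs (L1 k Rad) + Rabs (L1 k (- Rad))) * Rad) N)
    as (M & HM & HM1).
  destruct (finite_bound (fun k => Rabs (L1 k Rad) + Rabs (L1 k (- Rad))) N) as (D & HD & HD1).
  destruct (Gam_coercive HJ) as (K & HK).
  (* Bounds the distances wherever a [Gam] slope occurs: s + t is at most [Rad], or at most [M + K]
     when the vertex route beats the direct cost [M]. *)
  set (B := Rad + M + Rabs K). assert (HKa := Rle_abs K). assert (HKp := Rabs_pos K).
  destruct (slopes_bounded HJ B) as (C & HC & HC1).
  exists (C + D); split; [lra|]. intros j i s t Hj Hi Hs Ht y x Hdist. subst y x.
  destruct (Nat.eq_dec j i) as [Eji|Hji].
  - subst i. rewrite (dJ_branch_same HJ) in Hdist by auto.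
    unfold test_in, test_out. destruct excluded_middle_informative as [Hd|Hn].
    + destruct (goes_direct_branch _ _ j s Hj Hs eq_refl Hd) as (-> & Hs0 & r & Hr & Ex & HL).
      assert (t = r) by (apply (branch_coord HJ j j); auto). subst r.
      destruct (direct_equations j j s t Hj Hj Hs0 Ht) as (E1 & E2 & E3 & E4); auto.
      assert (HL1 := slope_abs_bound _ _ _ (conv_out HJ j Hj) (t - s) Rad Hdist).
      specialize (HD1 j Hj). cbv beta in HD1.
      repeat split.
      * intros Ht0. rewrite (E3 Ht0). lra.
      * intros Ht0 k Hk. assert (t = 0) by lra. subst t.
        destruct (Nat.eq_dec k j) as [->|Hkj].
        -- unfold direct_out, chi_out. rewrite Nat.eqb_refl. simpl mask.
           replace (_ + _) with (L1 j (0 - s)) by ring. lra.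
        -- unfold direct_out. apply Nat.eqb_neq in Hkj. rewrite Hkj. simpl mask at 1.
           rewrite Rmult_0_r, Rplus_0_r.
           replace (0 - s) with (- s) in Hdist by ring. rewrite Rabs_Ropp, Rabs_right in Hdist by lra.
           destruct (HC1 j k k s 0 Hj Hk Hk ltac:(unfold B; lra) ltac:(unfold B; lra)) as [_ K2]. lra.
      * intros _. rewrite <- Rabs_Ropp, E2. lra.
      * intros Hc; contradiction.
    + assert (Hst : s + t <= B).
      { destruct Hs as [Hs| <-].
        - assert (HL := not_direct_lt j s t Hj Hs Ht Hn).
          assert (HV := value_abs_bound _ _ _ (conv_out HJ j Hj) (t - s) Rad Hdist).
          specialize (HM1 j Hj). specialize (HK j j s t Hj Hj (Rlt_le _ _ Hs) Ht).
          cbv beta in HM1. unfold B. lra.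
        - rewrite Rminus_0_r, Rabs_right in Hdist by lra. unfold B; lra. }
      repeat split; intros;
        first [destruct (HC1 j j j s t) as [K1 K2]; auto; lra
              |destruct (HC1 j k k s t) as [K1 K2]; auto; lra
              |destruct (HC1 k j k s t) as [K1 K2]; auto; lra].
  - rewrite (dJ_branch_sum HJ) in Hdist by auto.
    assert (Hst : s + t <= B) by (unfold B; lra).
    unfold test_in, test_out. destruct excluded_middle_informative as [Hd|Hn].
    + destruct (goes_direct_branch _ _ j s Hj Hs eq_refl Hd) as (-> & Hs0 & r & Hr & Ex & HL).
      assert (t = r) by (apply (branch_coord HJ i j); auto). subst r.
      assert (t = 0).
      { destruct Ht as [Ht| <-]; auto. exfalso; apply Hji. symmetry.
        eapply (branch_index HJ); [| | | |exact Ex]; auto. }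
      subst t.
      destruct (direct_equations j i s 0 Hj Hi Hs0 Ht) as (E1 & E2 & E3 & E4); auto; try (intros; lra).
      assert (Hds : Rabs (0 - s) <= Rad).
      { replace (0 - s) with (- s) by ring. rewrite Rabs_Ropp, Rabs_right; lra. }
      assert (HL1 := slope_abs_bound _ _ _ (conv_out HJ j Hj) (0 - s) Rad Hds).
      specialize (HD1 j Hj). cbv beta in HD1.
      repeat split.
      * intros Ht0; lra.
      * intros _ k Hk.
        destruct (Nat.eq_dec k j) as [->|Hkj].
        -- unfold direct_out, chi_out. rewrite Nat.eqb_refl. simpl mask.
           replace (_ + _) with (L1 j (0 - s)) by ring. lra.
        -- unfold direct_out. apply Nat.eqb_neq in Hkj. rewrite Hkj. simpl mask at 1.
           rewrite Rmult_0_r, Rplus_0_r.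
           destruct (HC1 j k k s 0 Hj Hk Hk ltac:(unfold B; lra) ltac:(unfold B; lra)) as [_ K2]. lra.
      * intros _. rewrite <- Rabs_Ropp, E2. lra.
      * intros Hc; contradiction.
    + repeat split; intros.
      * destruct (HC1 j i i s t) as [K1 K2]; auto; lra.
      * destruct (HC1 j k k s t) as [K1 K2]; auto; lra.
      * destruct (HC1 j i j s t) as [K1 K2]; auto; lra.
      * destruct (HC1 k i k s t) as [K1 K2]; auto; lra.
Qed.

End TestFunctions.

Theorem mainTheorem7 (N : nat) (e : nat -> pt) (L : nat -> R -> R)
  (hN : (1 <= N)%nat)
  (he_unit : forall i, (i < N)%nat -> pnorm (e i) = 1)
  (he_dist : forall i j, (i < N)%nat -> (j < N)%nat -> i <> j -> e i <> e j)
  (hA1 : AssumA1 N L) :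
  (forall y x, inJ N e y -> inJ N e x -> exists m, is_glb (actions N e L y x) m) /\
  contJ2 N e (D0 N e L) /\
  exists (Phi : pt -> pt -> pt -> pt -> R)
         (DX DY : pt -> pt -> nat -> nat -> R -> R -> R),
    (forall y x, inJ N e y -> inJ N e x ->
       C1star N e (Phi y x) (DX y x) (DY y x) /\
       (forall y' x', inJ N e y' -> inJ N e x' -> D0 N e L y' x' <= Phi y x y' x') /\
       Phi y x y x = D0 N e L y x /\
       (forall j i s t, (j < N)%nat -> (i < N)%nat -> 0 <= s -> 0 <= t ->
          y = smul s (e j) -> x = smul t (e i) ->
          let E := Phi y x y x - t * DX y x j i s t - s * DY y x j i s t in
          (0 < t -> E + Ham (L i) (DX y x j i s t) = 0) /\
          (t = 0 -> E + bigmax (N - 1) (fun k => Hamm (L k) (DX y x j k s 0)) = 0) /\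
          (0 < s -> E + Ham (L j) (- DY y x j i s t) = 0) /\
          (s = 0 -> (2 <= N)%nat ->
             E + bigmax (N - 1) (fun k => Hamm (L k) (- DY y x k i 0 t)) = 0) /\
          (s = 0 -> N = 1%nat -> E + Ham (L 0%nat) (- DY y x 0%nat i 0 t) = 0))) /\
    (forall Rad, 0 < Rad -> exists C, 0 < C /\
       forall y x, inJ N e y -> inJ N e x -> dJ N e y x <= Rad ->
       forall j i s t, (j < N)%nat -> (i < N)%nat -> 0 <= s -> 0 <= t ->
          y = smul s (e j) -> x = smul t (e i) ->
          gradnorm N t (fun k => DX y x j k s t) i
          + gradnorm N s (fun k => DY y x k i s t) j <= C).
Proof.
  destruct hA1 as (g & Hg & L1 & L2 & HL).
  assert (HJ : junction N e L L1 g).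
  { split; auto. intros i Hi. destruct (HL i Hi) as (H1 & H2 & _ & H4).
    now apply strconv_of_second_derivative with (L2 i). }
  split; [|split].
  - intros y x Hy Hx. destruct (inJ_cases y Hy) as (j & s & Hj & Hs & ->).
    destruct (inJ_cases x Hx) as (i & t & Hi & Ht & ->).
    eexists; now apply (value_is_glb HJ).
  - apply (D0_continuous HJ).
  - set (F := test_family (N := N) (e := e) (L := L) (L1 := L1)).
    exists (fun y x => lift (N := N) (e := e) (F y x)).
    exists (test_out (N := N) (e := e) (L := L) (L1 := L1)), (test_in (N := N) (e := e) (L := L) (L1 := L1)).
    assert (Hvc : forall y x, vertex_compatible (N := N) (F y x)) by (intros; apply (test_compatible HJ)).
    split.
    + intros y x Hy Hx. split; [|split; [|split]].
      * apply (C1star_lift HJ); auto. intros; now apply (test_C1Q HJ).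
      * intros y' x' Hy' Hx'. destruct (inJ_cases y' Hy') as (j & s & Hj & Hs & ->).
        destruct (inJ_cases x' Hx') as (i & t & Hi & Ht & ->).
        rewrite (D0_value HJ), (lift_branch HJ) by auto. now apply (test_ge HJ).
      * destruct (inJ_cases y Hy) as (j & s & Hj & Hs & ->).
        destruct (inJ_cases x Hx) as (i & t & Hi & Ht & ->).
        rewrite (D0_value HJ), (lift_branch HJ) by auto. now apply (test_touches HJ).
      * intros j i s t Hj Hi Hs Ht -> ->. rewrite (lift_branch HJ) by auto.
        destruct (test_equations HJ j i s t Hj Hi Hs Ht) as (E1 & E2 & E3 & E4 & E5).
        split; [|split; [|split; [|split]]]; auto.
    + intros Rad HR. destruct (test_gradient_bound HJ Rad HR) as (C & HC & HB).
      assert (HN := pos_INR N).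
      exists (INR N * C + INR N * C + 1). split.
      { assert (0 <= INR N * C) by now apply Rmult_le_pos. lra. }
      intros y x Hy Hx Hd j i s t Hj Hi Hs Ht -> ->.
      destruct (HB j i s t Hj Hi Hs Ht Hd) as (B1 & B2 & B3 & B4).
      assert (K1 := gradnorm_bound N t (fun k => test_out (N := N) (e := e) (L := L) (L1 := L1)
        (smul s (e j)) (smul t (e i)) j k s t) i C hN HC B1 B2).
      assert (K2 := gradnorm_bound N s (fun k => test_in (N := N) (e := e) (L := L) (L1 := L1)
        (smul s (e j)) (smul t (e i)) k i s t) j C hN HC B3 B4).
      lra.
Qed.
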